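(* Let $(G/K,g)$ be a homogeneous space, consider the metric reductive decomposition $(\mathfrak g=\mathfrak k\oplus\mathfrak p,\langle\cdot,\cdot\rangle)$ such that $B(\mathfrak k,\mathfrak p)=0$, and the orthogonal decomposition $\mathfrak p=\mathfrak h\oplus\mathfrak n$, where $\mathfrak n$ is the nilradical of $\mathfrak g$. Assume that $(G/K,g)$ is an expanding semi-algebraic soliton with $\operatorname{Ric}=cI+S(D_{\mathfrak p})$, $c<0$, $D=\begin{bmatrix}0&0\\0&D_{\mathfrak p}\end{bmatrix}\in\operatorname{Der}(\mathfrak g)$. Then the following conditions are equivalent: (i) $(G/K,g)$ is an algebraic soliton (i.e. $S(D)\in\operatorname{Der}(\mathfrak g)$). (ii) $S(D_{\mathfrak p})\in\operatorname{Der}([\cdot,\cdot]_{\mathfrak p})$. (iii) $S(\operatorname{ad}_{\mathfrak p}H)\in\operatorname{Der}([\cdot,\cdot]_{\mathfrak p})$ (or equivalently, $S(\operatorname{ad}H)\in\operatorname{Der}(\mathfrak g)$). (iv) $\operatorname{ad}_{\mathfrak p}H$ is normal (or equivalently, $\operatorname{ad}H$ is normal). (v) $S(D|_{\mathfrak h})=0$. (vi) $S(\operatorname{ad}H|_{\mathfrak h})=0$. (vii) $\operatorname{Ric}|_{\mathfrak h}=cI$.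
   Context: A homogeneous space $(G/K,g)$ is a connected manifold $G/K$ ($G$ a Lie group, $K$ a closed subgroup) with a $G$-invariant Riemannian metric $g$, assumed almost-effective: $\{x\in G:xhK=hK\ \forall h\in G\}$ is discrete. $\mathfrak g,\mathfrak k$ are the Lie algebras of $G,K$. A metric reductive decomposition $(\mathfrak g=\mathfrak k\oplus\mathfrak p,\langle\cdot,\cdot\rangle)$ consists of an $\operatorname{Ad}(K)$-invariant complement $\mathfrak p$ of $\mathfrak k$, identified with $T_{eK}G/K$, and an $\operatorname{Ad}(K)$-invariant inner product on $\mathfrak g$ with $\langle\mathfrak k,\mathfrak p\rangle=0$ whose restriction to $\mathfrak p$ is $g(eK)$. $B$ is the Killing form of $\mathfrak g$; it is negative definite on $\mathfrak k$, so there is a unique reductive decomposition with $B(\mathfrak k,\mathfrak p)=0$, and for it the nilradical $\mathfrak n$ (maximal nilpotent ideal) lies in $\mathfrak p$. $S(A)=\tfrac12(A+A^t)$. $[\cdot,\cdot]_{\mathfrak p}:\mathfrak p\times\mathfrak p\to\mathfrak p$ is the $\mathfrak p$-component of the Lie bracket restricted to $\mathfrak p\times\mathfrak p$, and $\operatorname{Der}([\cdot,\cdot]_{\mathfrak p})$ is the space of derivations of the algebra $(\mathfrak p,[\cdot,\cdot]_{\mathfrak p})$. $H\in\mathfrak p$ is the unique element with $\langle H,X\rangle=\operatorname{tr}\operatorname{ad}X$ for all $X\in\mathfrak g$, and $\operatorname{ad}_{\mathfrak p}H(X)=[H,X]_{\mathfrak p}$ for $X\in\mathfrak p$. $\operatorname{Ric}$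 is the Ricci operator of $(G/K,g)$ at $eK$, an operator on $\mathfrak p$. Under the hypotheses, $D$ and $\operatorname{ad}H$ leave $\mathfrak h$ and $\mathfrak n$ invariant and vanish on $\mathfrak k$. $(G/K,g)$ is a semi-algebraic soliton if there is a one-parameter family $\tilde\varphi_t\in\operatorname{Aut}(G)$ with $\tilde\varphi_t(K)=K$ such that $g(t)=c_t\varphi_t^*g$, $g(0)=g$, solves the Ricci flow $\partial_tg(t)=-2\operatorname{Rc}(g(t))$ for some scaling $c_t>0$, where $\varphi_t\in\operatorname{Diff}(G/K)$ is the equivariant diffeomorphism determined by $\tilde\varphi_t$. It is known that then, for the metric reductive decomposition with $B(\mathfrak k,\mathfrak p)=0$, $\operatorname{Ric}=cI+S(D_{\mathfrak p})$ for some $c\in\mathbb R$ (the cosmological constant) and some $D=\begin{bmatrix}0&0\\0&D_{\mathfrak p}\end{bmatrix}\in\operatorname{Der}(\mathfrak g)$; it is expanding if $c<0$. It is an algebraic soliton if $D$ can be taken symmetric, so that $\operatorname{Ric}=cI+D_{\mathfrak p}$. *)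

(* Defs.v *)
From HB Require Import structures.
From mathcomp Require Import all_boot all_order all_algebra.
From mathcomp Require Import classical_sets reals topology normedtype derive.
Set Implicit Arguments.
Unset Strict Implicit.
Unset Printing Implicit Defensive.
Import Order.TTheory GRing.Theory Num.Theory.
Import numFieldNormedType.Exports.
Local Open Scope ring_scope.

(* A homogeneous space (G/K, g) with a metric reductive decomposition enters
   through its infinitesimal data: the Lie bracket br on gg = Lie(G), the
   subalgebra k = Lie(K), the complement p, identified with T_{eK} G/K, and the
   inner product ip on gg.  G-invariant tensors on G/K are identified with their
   values at eK, that is, with tensors on p. *)

Section LinearAlgebra.
Variable (R : realType) (V : vectType R).
Implicit Types (Q : V -> V -> R) (A : 'End(V)).

Definition lftrace A : R :=
  \sum_(i < \dim {:V}) coord (vbasis {:V}) i (A (vbasis {:V})`_i).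

Definition derivation (mul : V -> V -> V) A : Prop :=
  forall x y, A (mul x y) = mul (A x) y + mul x (A y).

(* y |-> Q (-, y), with values in the dual space *)
Definition flat Q : 'Hom(V, 'Hom(V, R^o)) :=
  linfun (fun y => linfun (fun x => Q x y : R^o)).

(* A^t, the conjugate of the dual map of A by flat Q; see adjointP *)
Definition adjoint Q A : 'End(V) :=
  linfun (fun y => (flat Q)^-1%VF (flat Q y \o A)%VF).

Definition sympart Q A : 'End(V) := 2^-1 *: (A + adjoint Q A).

Definition normal Q A : Prop := (A \o adjoint Q A = adjoint Q A \o A)%VF.

Section Adjoint.
Variable Q : V -> V -> R.
Hypothesis Ql : forall y, linear (fun x => Q x y : R^o).
Hypothesis Qr : forall x, linear (fun y => Q x y : R^o).
Hypothesis Q_gt0 : forall x, x != 0 -> 0 < Q x x.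

Lemma flatE x y : flat Q y x = Q x y.
Proof.
have lin y' : linfun (fun x => Q x y' : R^o) =1 (fun x => Q x y').
  pose f := GRing.isLinear.Build R V R^o *:%R (fun x => Q x y' : R^o) (Ql y').
  pose F : {linear V -> R^o} := HB.pack (fun x => Q x y' : R^o) f.
  by move=> u; rewrite -[LHS]/(linfun F u) lfunE.
have L : linear (fun y => linfun (fun x => Q x y : R^o)).
  by move=> a u v; apply/lfunP => z; rewrite !lfun_simp !lin Qr.
pose f := GRing.isLinear.Build R V 'Hom(V, R^o) *:%R _ L.
pose F : {linear V -> 'Hom(V, R^o)} :=
  HB.pack (fun y => linfun (fun x => Q x y : R^o)) f.
by rewrite -[flat Q]/(linfun F) lfunE /= lin.
Qed.

Lemma flat_ker : lker (flat Q) = 0%VS.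
Proof.
apply/eqP; rewrite -subv0; apply/subvP => y; rewrite memv_ker memv0 => /eqP y0.
by apply/contraT => /Q_gt0; rewrite -flatE y0 zero_lfunE ltxx.
Qed.

Lemma adjointP A x y : Q (A x) y = Q x (adjoint Q A y).
Proof.
have L : linear (fun y => (flat Q)^-1%VF (flat Q y \o A)%VF).
  by move=> a u v; rewrite linearP comp_lfunDl -comp_lfunZl linearP.
pose f := GRing.isLinear.Build R V V *:%R _ L.
pose F : {linear V -> V} :=
  HB.pack (fun y => (flat Q)^-1%VF (flat Q y \o A)%VF) f.
rewrite -[adjoint Q A]/(linfun F) lfunE /= -[RHS]flatE.
have -> : flat Q ((flat Q)^-1%VF (flat Q y \o A)%VF) = (flat Q y \o A)%VF.
  apply: limg_lfunVK; suff -> : limg (flat Q) = fullv by rewrite memvf.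
  apply/eqP; rewrite eqEdim subvf /=.
  have := limg_ker_dim (flat Q) fullv.
  rewrite flat_ker capv0 dimv0 add0n => ->; rewrite !dimvf.
  by rewrite [dim 'Hom(_, _)]/dim /= muln1.
by rewrite comp_lfunE flatE.
Qed.
End Adjoint.
End LinearAlgebra.

(* The (U, U)-block of f with respect to the decomposition U (+) W; the
   W-component of f u is discarded, so this is the restriction of f to U
   whenever f leaves U invariant. *)
Definition block (R : realType) (V : vectType R) (U W : {vspace V})
    (f : 'End(V)) : 'End(subvs_of U) :=
  linfun (fun u => vsproj U (daddv_pi U W (f (vsval u)))).

Definition restr_form (R : realType) (V : vectType R) (Q : V -> V -> R)
    (U : {vspace V}) : subvs_of U -> subvs_of U -> R :=
  fun x y => Q (vsval x) (vsval y).

Section LieAlgebra.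
Variable (R : realType) (gg : vectType R) (br : {bilinear gg -> gg -> gg}).
Implicit Types a n k p : {vspace gg}.

Definition lie_bracket : Prop :=
  (forall x, br x x = 0) /\
  (forall x y z, br x (br y z) + br y (br z x) + br z (br x y) = 0).

Definition ad (x : gg) : 'End(gg) := linfun (br x).

Definition killing (x y : gg) : R := lftrace (ad x \o ad y)%VF.

Definition ideal a : Prop := forall x y, y \in a -> br x y \in a.

Definition bracket_space a b : {vspace gg} :=
  <<[seq br x y | x <- vbasis a, y <- vbasis b]>>%VS.

Definition lower_central a m : {vspace gg} := iter m (bracket_space a) a.

Definition nilpotent a : Prop := exists m, lower_central a m = 0%VS.

Definition nilradical n : Prop :=
  [/\ ideal n, nilpotent n &
      forall a, ideal a -> nilpotent a -> (a <= n)%VS].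

(* Almost-effectiveness says that the kernel of the action of G on G/K is
   discrete; the Lie algebra of this kernel is the largest ideal of gg
   contained in k. *)
Record metric_reductive k p (ip : {dot gg for idfun}) : Prop := {
  mr_lie : lie_bracket;
  mr_subalgebra : forall x y, x \in k -> y \in k -> br x y \in k;
  mr_sum : (k + p)%VS = fullv;
  mr_direct : (k :&: p)%VS = 0%VS;
  mr_reductive : forall z x, z \in k -> x \in p -> br z x \in p;
  mr_invariant : forall z x y, z \in k -> ip (br z x) y + ip x (br z y) = 0;
  mr_orthogonal : forall z x, z \in k -> x \in p -> ip z x = 0;
  mr_effective : forall a, ideal a -> (a <= k)%VS -> a = 0%VS }.

Section Curvature.
Variables k p : {vspace gg}.
Local Notation P := (subvs_of p).
Implicit Types (Q : P -> P -> R) (nab : 'Hom(P, 'End(P))).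

Definition p_bracket (x y : P) : P :=
  vsproj p (daddv_pi p k (br (vsval x) (vsval y))).

(* G-invariant affine connections on G/K correspond to linear maps
   nab : p -> End(p) (Nomizu); the Levi-Civita connection is the metric and
   torsion-free one. *)
Definition levi_civita Q nab : Prop :=
  (forall x y z, Q (nab x y) z + Q y (nab x z) = 0) /\
  (forall x y, nab x y - nab y x = p_bracket x y).

(* R(x, y) = [nab x, nab y] - nab [x, y]_p - ad [x, y]_k *)
Definition curvature nab (x y z : P) : P :=
  nab x (nab y z) - nab y (nab x z) - nab (p_bracket x y) z
  - vsproj p (br (daddv_pi k p (br (vsval x) (vsval y))) (vsval z)).

(* Rc(y, z) = tr (x |-> R(x, y) z) *)
Definition is_ricci_form Q (rc : P -> P -> R) : Prop :=
  exists nab, levi_civita Q nab /\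
    forall y z, rc y z = lftrace (linfun (fun x => curvature nab x y z)).

Definition is_ricci_operator Q (Ric : 'End(P)) : Prop :=
  is_ricci_form Q (fun x y => Q (Ric x) y).

Definition automorphism_preserving_k (f : 'End(gg)) : Prop :=
  [/\ lker f = 0%VS, (forall x y, f (br x y) = br (f x) (f y))
    & (f @: k)%VS = k].

(* The differential at eK of the diffeomorphism of G/K induced by an
   automorphism of (G, K) with differential f is block p k f. *)
Definition scaled_pullback Q (c : R) (f : 'End(gg)) : P -> P -> R :=
  fun x y => c * Q (block p k f x) (block p k f y).

Definition semi_algebraic_soliton Q : Prop :=
  exists (T : R) (c : R -> R) (f : R -> 'End(gg)),
    let g t := scaled_pullback Q (c t) (f t) in
    [/\ 0 < T, (forall x y, g 0 x y = Q x y) &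
        forall t, `|t| < T ->
          [/\ 0 < c t, automorphism_preserving_k (f t) &
              exists rc, is_ricci_form (g t) rc /\
                forall x y, is_derive (t : R^o) (1 : R^o)
                  (fun s : R^o => g s x y : R^o) (- 2 * rc x y)]].

(* derivations of the form diag(0, D_p) with respect to gg = k (+) p *)
Definition soliton_derivation (D : 'End(gg)) : Prop :=
  [/\ derivation br D, (k <= lker D)%VS & (D @: p <= p)%VS].

Definition algebraic_soliton (ip : gg -> gg -> R) : Prop :=
  semi_algebraic_soliton (restr_form ip (U := p)) /\
  exists Ric : 'End(P), is_ricci_operator (restr_form ip (U := p)) Ric /\
    exists (c : R) (D : 'End(gg)),
      [/\ soliton_derivation D, adjoint ip D = D
        & Ric = c *: \1%VF + block p k D].

End Curvature.

Definition mean_curvature_vector p (ip : gg -> gg -> R) (H : gg) : Prop :=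
  H \in p /\ forall x, ip H x = lftrace (ad x).

End LieAlgebra.

(* Main.v *)
(** Put E = D + ad H and F = S(E).  By the formula for the Ricci operator, the soliton equation
says that the moment map of the bracket mu of p is represented by M = c P + F + P beta P / 2,
where beta represents the Killing form: <X.mu, mu> = 4 tr (M X) for every endomorphism X, and
X = E gives |F|^2 = -c tr E.

Let s be the radical of the Killing form.  Among the weights f on bases of s that make s a
filtered Lie algebra, sum f^2 - 2 sum f has a minimizer, and its filtration is unique, hence
invariant under automorphisms and under derivations.  Comparing it with the eigenvalues of the
hyperbolic part of E, and testing the moment map on the diagonal operator -c f, forces F to be
this operator.  So F is a derivation with non-negative eigenvalues, whose image is a nilpotent
ideal.  A norm comparison for the operators ad x, x central in the nilradical of ker F, shows
that the nilradical of g is exactly the image of F, so ker F = k + h.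

Consequently S(D) = -S(ad H) on k + h and S(D) + S(ad H) is always a derivation.  As
S(ad H) H = 0, S(ad H) is a derivation iff ad H is normal.  If it is, the moment map at H puts
the image of S(D) in s, and Cartan's criterion makes S(D) vanish on h; conversely, if S(D)
vanishes on h, then tr (M [ad H, ad H^t]) = 0, which makes ad H^t a derivation. *)

Require Import Defs.
From HB Require Import structures.
From mathcomp Require Import all_boot all_order all_algebra.
From mathcomp Require Import boolp classical_sets functions reals.
From mathcomp Require Import topology normedtype derive sequences exp.
From mathcomp Require Import ring lra.
From mathcomp.real_closed Require Import complex.
Set Implicit Arguments.
Unset Strict Implicit.
Unset Printing Implicit Defensive.
Import Order.TTheory GRing.Theory Num.Theory.
Import numFieldNormedType.Exports.
Local Open Scope ring_scope.

(** * Inner products, adjoints and traces *)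

(** The operator [E] need be neither normal nor diagonalizable; [F] is pinned down by two opposite
    inequalities. Let X be the diagonal operator -c f on s, zero on the orthogonal complement of s.
    Minimality along the ray through f gives sum f^2 = sum f, hence |X|^2 = c^2 sum f^2 = -c tr X.
    The eigenvalues of the hyperbolic part of E restricted to s, divided by -c, are admissible
    weights; comparing their cost with that of f and using tr (E|s) = tr E together with |F|^2 = -c
    tr E yields |F| <= |X|. Conversely, f is superadditive on nonzero structure constants, so 0 <=
    <X.mu, mu> = 4 (<F, X> - |X|^2). Together |F - X|^2 <= 0, and equality in the second estimate
    says that X is a derivation. The radical s is the right place for the weights: the Killing term
    of M vanishes there, while on g/s the operator E is skew for a nondegenerate form and
    contributes no trace. The cost is |f - (1,...,1)|^2 up to a constant, so it is strictly convex,
    which makes the filtration unique. *)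

Lemma linfun_linear (R : nzRingType) (U V : vectType R) (f : U -> V) :
  linear f -> forall x, linfun f x = f x.
Proof.
move=> fl x; pose m := GRing.isLinear.Build R U V *:%R f fl.
pose F : {linear U -> V} := HB.pack f m.
by rewrite -[LHS]/(linfun F x) lfunE.
Qed.

Section CompLfun.
Variables (R : comNzRingType) (U V W : vectType R).
Lemma comp_lfunBl (f1 f2 : 'Hom(V, W)) (g : 'Hom(U, V)) :
  ((f1 - f2) \o g)%VF = (f1 \o g)%VF - (f2 \o g)%VF.
Proof. by rewrite comp_lfunDl comp_lfunNl. Qed.
Lemma comp_lfunBr (f : 'Hom(V, W)) (g1 g2 : 'Hom(U, V)) :
  (f \o (g1 - g2))%VF = (f \o g1)%VF - (f \o g2)%VF.
Proof. by rewrite comp_lfunDr comp_lfunNr. Qed.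
End CompLfun.

(** A predicate on bare functions, so that one theory serves the dot product of the Lie algebra, its
    restrictions to subspaces and the trace form on endomorphisms. *)
Record inner_product (R : realType) (V : vectType R) (Q : V -> V -> R) : Prop := {
  ip_linear : forall a x y z, Q (a *: x + y) z = a * Q x z + Q y z;
  ip_sym : forall x y, Q x y = Q y x;
  ip_gt0 : forall x, x != 0 -> 0 < Q x x }.

Section InnerProduct.
Variables (R : realType) (V : vectType R) (Q : V -> V -> R).
Hypothesis QP : inner_product Q.
Implicit Types (x y z : V) (A B X Y : 'End(V)).

Lemma ipDl x y z : Q (x + y) z = Q x z + Q y z.
Proof. by have := ip_linear QP 1 x y z; rewrite scale1r mul1r. Qed.
Lemma ip0l z : Q 0 z = 0.
Proof. by have := ipDl 0 0 z; rewrite addr0; lra. Qed.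
Lemma ipZl a x z : Q (a *: x) z = a * Q x z.
Proof. by have := ip_linear QP a x 0 z; rewrite !addr0 ip0l addr0. Qed.
Lemma ipNl x z : Q (- x) z = - Q x z.
Proof. by rewrite -scaleN1r ipZl mulN1r. Qed.
Lemma ipBl x y z : Q (x - y) z = Q x z - Q y z.
Proof. by rewrite ipDl ipNl. Qed.
Lemma ipDr x y z : Q x (y + z) = Q x y + Q x z.
Proof. by rewrite !(ip_sym QP x) ipDl. Qed.
Lemma ip0r z : Q z 0 = 0.
Proof. by rewrite (ip_sym QP) ip0l. Qed.
Lemma ipZr a x z : Q x (a *: z) = a * Q x z.
Proof. by rewrite !(ip_sym QP x) ipZl. Qed.
Lemma ipNr x z : Q x (- z) = - Q x z.
Proof. by rewrite !(ip_sym QP x) ipNl. Qed.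
Lemma ipBr x y z : Q x (y - z) = Q x y - Q x z.
Proof. by rewrite !(ip_sym QP x) ipBl. Qed.
Lemma ip_suml I (r : seq I) (P : pred I) (F : I -> V) z :
  Q (\sum_(i <- r | P i) F i) z = \sum_(i <- r | P i) Q (F i) z.
Proof. exact: (big_morph (fun x => Q x z) (fun x y => ipDl x y z) (ip0l z)). Qed.
Lemma ip_sumr I (r : seq I) (P : pred I) (F : I -> V) z :
  Q z (\sum_(i <- r | P i) F i) = \sum_(i <- r | P i) Q z (F i).
Proof. exact: (big_morph (Q z) (fun x y => ipDr z x y) (ip0r z)). Qed.

Lemma ip_ge0 x : 0 <= Q x x.
Proof. by have [->|/(ip_gt0 QP)/ltW//] := eqVneq x 0; rewrite ip0l. Qed.
Lemma ip_eq0 x : Q x x = 0 -> x = 0.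
Proof. by move=> xx; apply/eqP; apply/contraT => /(ip_gt0 QP); rewrite xx ltxx. Qed.
Lemma ip_inj x y : (forall z, Q x z = Q y z) -> x = y.
Proof.
move=> xy; apply/eqP; rewrite -subr_eq0; apply/eqP/ip_eq0.
by rewrite ipBl !ipBr !xy subrr.
Qed.

Lemma ip_CauchySchwarz x y : Q x y ^+ 2 <= Q x x * Q y y.
Proof.
have [->|/(ip_gt0 QP) yy] := eqVneq y 0; first by rewrite ip0r expr0n ip0l mulr0.
have := ip_ge0 (Q y y *: x - Q x y *: y).
rewrite ipBl !ipBr !ipZl !ipZr (ip_sym QP y x).
have -> : Q y y * (Q y y * Q x x) - Q y y * (Q x y * Q x y) -
  (Q x y * (Q y y * Q x y) - Q x y * (Q x y * Q y y)) =
  Q y y * (Q x x * Q y y - Q x y ^+ 2) by ring.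
by rewrite pmulr_rge0 // subr_ge0.
Qed.

Lemma ip_linl z : linear (fun x => Q x z : R^o).
Proof. by move=> a x y; rewrite (ip_linear QP). Qed.
Lemma ip_linr z : linear (fun x => Q z x : R^o).
Proof. by move=> a x y; rewrite !(ip_sym QP z) (ip_linear QP). Qed.

Local Notation adj := (adjoint Q).

Lemma adjE A x y : Q (A x) y = Q x (adj A y).
Proof. exact: (adjointP ip_linl ip_linr (ip_gt0 QP)). Qed.
Lemma adjEr A x y : Q x (A y) = Q (adj A x) y.
Proof. by rewrite !(ip_sym QP x) adjE (ip_sym QP). Qed.
Lemma adj_uniq A B : (forall x y, Q (A x) y = Q x (B y)) -> B = adj A.
Proof.
move=> AB; apply/lfunP => y; apply: ip_inj => z.
by rewrite !(ip_sym QP _ z) -AB adjE.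
Qed.
Lemma adjK A : adj (adj A) = A.
Proof. by apply/esym/adj_uniq => x y; rewrite -adjEr. Qed.
Lemma adjD A B : adj (A + B) = adj A + adj B.
Proof. by apply/esym/adj_uniq => x y; rewrite !add_lfunE ipDl ipDr !adjE. Qed.
Lemma adjZ a A : adj (a *: A) = a *: adj A.
Proof. by apply/esym/adj_uniq => x y; rewrite !scale_lfunE ipZl ipZr adjE. Qed.
Lemma adjN A : adj (- A) = - adj A.
Proof. by rewrite -scaleN1r adjZ scaleN1r. Qed.
Lemma adjB A B : adj (A - B) = adj A - adj B.
Proof. by rewrite adjD adjN. Qed.
Lemma adj_comp A B : adj (A \o B)%VF = (adj B \o adj A)%VF.
Proof. by apply/esym/adj_uniq => x y; rewrite !comp_lfunE !adjE. Qed.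
Lemma adj0 : adj 0 = 0.
Proof. by apply/esym/adj_uniq => x y; rewrite !zero_lfunE ip0l ip0r. Qed.
Lemma adj1 : adj \1%VF = \1%VF.
Proof. by apply/esym/adj_uniq => x y; rewrite !id_lfunE. Qed.

Lemma sympart_adj A : adj (sympart Q A) = sympart Q A.
Proof. by rewrite /sympart adjZ adjD adjK addrC. Qed.
Lemma sympartD A B : sympart Q (A + B) = sympart Q A + sympart Q B.
Proof. by rewrite /sympart adjD -scalerDr addrACA. Qed.
Lemma sympart_ip A x y : Q (sympart Q A x) y = 2^-1 * (Q (A x) y + Q x (A y)).
Proof. by rewrite /sympart scale_lfunE add_lfunE ipZl ipDl -adjEr. Qed.

Definition onb n (e : 'I_n -> V) : Prop :=
  (forall i j, Q (e i) (e j) = (i == j)%:R) /\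
  (forall x, x = \sum_i Q x (e i) *: e i).

Definition orthonormal_seq (s : seq V) : Prop :=
  forall i j, (i < size s)%N -> (j < size s)%N -> Q s`_i s`_j = (i == j)%:R.

Lemma orthonormal_rcons s v : orthonormal_seq s -> Q v v = 1 ->
  (forall i, (i < size s)%N -> Q s`_i v = 0) -> orthonormal_seq (rcons s v).
Proof.
move=> os v1 vs i j; rewrite size_rcons !ltnS.
rewrite leq_eqVlt => /orP[/eqP->|ilt]; rewrite leq_eqVlt => /orP[/eqP->|jlt].
- by rewrite nth_rcons ltnn eqxx v1.
- by rewrite !nth_rcons ltnn eqxx jlt (ip_sym QP) vs // gtn_eqF.
- by rewrite !nth_rcons ltnn eqxx ilt vs // ltn_eqF.
- by rewrite !nth_rcons ilt jlt os.
Qed.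

Lemma span_rcons (s : seq V) v : (<<rcons s v>> = <<s>> + <[v]>)%VS.
Proof. by rewrite -cats1 span_cat span_seq1. Qed.

Lemma orthonormal_span s x : orthonormal_seq s -> x \in <<s>>%VS ->
  x = \sum_(i < size s) Q x s`_i *: s`_i.
Proof.
move=> os xs; have xE := @coord_span _ _ _ (in_tuple s) x xs.
rewrite [LHS]xE; apply: eq_bigr => i _; congr (_ *: _).
rewrite {2}xE ip_suml (bigD1 i) //= ipZl os // eqxx mulr1.
rewrite big1 ?addr0 // => j ji; rewrite ipZl os ?ltn_ord //.
by rewrite (inj_eq val_inj) (negbTE ji) mulr0.
Qed.

(** The clause on prefixes records that the whole flag is preserved; this later makes orthonormal a
    basis adapted to a filtration. *)
Lemma gram_schmidt (s : seq V) : free s -> exists t : seq V,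
  [/\ size t = size s, orthonormal_seq t &
      forall k, (k <= size s)%N -> <<take k t>>%VS = <<take k s>>%VS].
Proof.
elim/last_ind: s => [|s v IH].
  by exists [::]; split.
rewrite (perm_free (permEl (perm_rcons v s))) free_cons => /andP[vnz fs].
have [t [ts ot st]] := IH fs.
have stE : (<<t>> = <<s>>)%VS by have := st _ (leqnn _); rewrite -{1}ts !take_size.
pose w := v - \sum_(i < size t) Q v t`_i *: t`_i.
have wt a : (a < size t)%N -> Q t`_a w = 0.
  move=> it; rewrite ipBr ip_sumr (bigD1 (Ordinal it)) //= ipZr ot // eqxx mulr1.
  rewrite (ip_sym QP) big1 ?addr0 ?subrr // => j ji; rewrite ipZr ot // eq_sym.
  by rewrite -[a]/(nat_of_ord (Ordinal it)) (inj_eq val_inj) (negbTE ji) mulr0.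
have sumt : \sum_(i < size t) Q v t`_i *: t`_i \in <<t>>%VS.
  by apply: memv_suml => i _; apply/memvZ/memv_span/mem_nth.
have w0 : w != 0.
  by apply: contraNneq vnz => /eqP; rewrite subr_eq0 => /eqP ->; rewrite -stE.
pose c := (Num.sqrt (Q w w))^-1.
have cne : c != 0 by rewrite invr_eq0 sqrtr_eq0 -ltNge (ip_gt0 QP).
have ww : c * (c * Q w w) = 1.
  rewrite mulrA -expr2 exprVn sqr_sqrtr ?ip_ge0 // mulVf //.
  by rewrite gt_eqF // (ip_gt0 QP).
exists (rcons t (c *: w)); split.
- by rewrite !size_rcons ts.
- apply: orthonormal_rcons => //; first by rewrite ipZl ipZr.
  by move=> i it; rewrite ipZr wt // mulr0.
- move=> k; rewrite size_rcons leq_eqVlt => /orP[/eqP ->|klt].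
    rewrite -{1}ts -(size_rcons t (c *: w)) -(size_rcons s v) !take_size !span_rcons stE.
    apply/eqP; rewrite eqEsubv !subv_add !addvSl /= -!memvE.
    apply/andP; split.
      rewrite memvZ // memvB //; last by rewrite memvE (subv_trans _ (addvSl _ _)) // -memvE -stE.
      by rewrite memvE addvSr.
    have -> : v = c^-1 *: (c *: w) + \sum_(i < size t) Q v t`_i *: t`_i.
      by rewrite scalerA mulVf // scale1r subrK.
    rewrite memvD //; first by rewrite memvZ // memvE addvSr.
    by rewrite memvE (subv_trans _ (addvSl _ _)) // -memvE -stE.
  by rewrite -!cats1 !takel_cat ?ts // st.
Qed.

End InnerProduct.

Section InnerProduct2.
Variables (R : realType) (V : vectType R) (Q : V -> V -> R).
Hypothesis QP : inner_product Q.
Implicit Types (x y z : V) (A B X Y : 'End(V)) (U W : {vspace V}).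
Local Notation adj := (adjoint Q).
Local Notation tr := (@lftrace R V).

Lemma orthonormal_basis U : exists n (u : 'I_n -> V),
  [/\ forall i j, Q (u i) (u j) = (i == j)%:R, forall i, u i \in U &
      forall x, x \in U -> x = \sum_i Q x (u i) *: u i].
Proof.
have [t [ts ot st]] := gram_schmidt QP (basis_free (vbasisP U)).
have stU : <<t>>%VS = U.
  have := st _ (leqnn _); rewrite -{1}ts !take_size => ->.
  exact: span_basis (vbasisP U).
exists (size t), (fun i => t`_i); split.
- by move=> i j; rewrite ot.
- by move=> i; rewrite -stU memv_span // mem_nth.
- by move=> x; rewrite -stU; apply: orthonormal_span.
Qed.

Lemma onb_exists : exists n (e : 'I_n -> V), onb Q e.
Proof.
have [n [e [e1 _ e3]]] := orthonormal_basis fullv.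
by exists n, e; split=> // x; apply: e3; rewrite memvf.
Qed.

Definition orthoproj U X : Prop :=
  [/\ forall x y, Q (X x) y = Q x (X y), forall x, X x \in U & forall x, x \in U -> X x = x].

Lemma orthoproj_exists U : exists X, orthoproj U X.
Proof.
have [n [u [u1 u2 u3]]] := orthonormal_basis U.
have L : linear (fun x => \sum_i Q x (u i) *: u i).
  move=> a x y; rewrite scaler_sumr -big_split /=; apply: eq_bigr => i _.
  by rewrite (ip_linear QP) scalerDl scalerA.
exists (linfun (fun x => \sum_i Q x (u i) *: u i)); split.
- move=> x y; rewrite !(linfun_linear L) (ip_suml QP) (ip_sumr QP).
  by apply: eq_bigr => i _; rewrite (ipZl QP) (ipZr QP) mulrC (ip_sym QP (u i)).
- by move=> x; rewrite (linfun_linear L); apply: memv_suml => i _; apply: memvZ.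
- by move=> x xU; rewrite (linfun_linear L) -u3.
Qed.

Section Onb.
Variables (n : nat) (e : 'I_n -> V).
Hypothesis eP : onb Q e.

Lemma onb_expand x : x = \sum_i Q x (e i) *: e i. Proof. by case: eP. Qed.

Lemma onb_parseval x y : Q x y = \sum_i Q x (e i) * Q y (e i).
Proof.
rewrite {1}(onb_expand x) (ip_suml QP); apply: eq_bigr => i _.
by rewrite (ipZl QP) (ip_sym QP y).
Qed.

(** Expanding the vectors of [vbasis] in [e], or the images of the [e j] in [vbasis], leads to the
    same double sum. *)
Lemma trE A : tr A = \sum_i Q (A (e i)) (e i).
Proof.
pose b := vbasis {:V}.
transitivity (\sum_(i < \dim {:V}) \sum_j Q b`_i (e j) * coord b i (A (e j))).
  apply: eq_bigr => i _; rewrite {1}(onb_expand b`_i) !linear_sum /=.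
  by apply: eq_bigr => j _; rewrite !linearZ.
rewrite exchange_big; apply: eq_bigr => j _ /=.
rewrite {2}(coord_vbasis (memvf (A (e j)))) (ip_suml QP).
by apply: eq_bigr => i _; rewrite (ipZl QP) mulrC.
Qed.

End Onb.

Lemma tr_comp A B : tr (A \o B)%VF = tr (B \o A)%VF.
Proof.
have [n [e eP]] := onb_exists; rewrite !(trE eP).
transitivity (\sum_i \sum_j Q (B (e i)) (e j) * Q (A (e j)) (e i)).
  apply: eq_bigr => i _; rewrite comp_lfunE {1}(onb_expand eP (B (e i))).
  by rewrite linear_sum (ip_suml QP); apply: eq_bigr => j _; rewrite linearZ (ipZl QP).
rewrite exchange_big; apply: eq_bigr => j _ /=.
rewrite comp_lfunE {2}(onb_expand eP (A (e j))).
by rewrite linear_sum (ip_suml QP); apply: eq_bigr => i _; rewrite linearZ (ipZl QP) mulrC.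
Qed.

Lemma tr_adj A : tr (adj A) = tr A.
Proof.
have [n [e eP]] := onb_exists; rewrite !(trE eP).
by apply: eq_bigr => i _; rewrite -(adjEr QP) (ip_sym QP).
Qed.
Lemma trD A B : tr (A + B) = tr A + tr B.
Proof.
have [n [e eP]] := onb_exists; rewrite !(trE eP) -big_split /=.
by apply: eq_bigr => i _; rewrite add_lfunE (ipDl QP).
Qed.
Lemma trZ a A : tr (a *: A) = a * tr A.
Proof.
have [n [e eP]] := onb_exists; rewrite !(trE eP) mulr_sumr.
by apply: eq_bigr => i _; rewrite scale_lfunE (ipZl QP).
Qed.
Lemma tr0 : tr 0 = 0.
Proof. by rewrite -[0]/(0%R) -(scale0r (0 : 'End(V))) trZ mul0r. Qed.
Lemma trN A : tr (- A) = - tr A.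
Proof. by rewrite -scaleN1r trZ mulN1r. Qed.
Lemma trB A B : tr (A - B) = tr A - tr B.
Proof. by rewrite trD trN. Qed.
Lemma tr_compC3 A B X : tr (A \o B \o X)%VF = tr (X \o A \o B)%VF.
Proof. by rewrite tr_comp comp_lfunA. Qed.
Lemma tr_sympart A B : adj B = B -> tr (sympart Q A \o B)%VF = tr (A \o B)%VF.
Proof.
move=> sB; rewrite /sympart -comp_lfunZl trZ comp_lfunDl trD.
have -> : tr (adj A \o B)%VF = tr (A \o B)%VF.
  by rewrite -tr_adj (adj_comp QP) (adjK QP) sB tr_comp.
by rewrite -mulr2n -[RHS]mul1r -[tr (A \o B)%VF *+ 2]mulr_natl mulrA mulVf ?pnatr_eq0.
Qed.

(** The Frobenius inner product on endomorphisms. *)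
Definition fro A B : R := tr (adj A \o B)%VF.

Lemma froE n (e : 'I_n -> V) A B : onb Q e -> fro A B = \sum_i Q (A (e i)) (B (e i)).
Proof.
move=> eP; rewrite /fro (trE eP); apply: eq_bigr => i _.
by rewrite comp_lfunE -(adjEr QP) (ip_sym QP).
Qed.

Lemma fro_inner_product : inner_product fro.
Proof.
have [n [e eP]] := onb_exists; split.
- move=> a A B X; rewrite !(froE _ _ eP) mulr_sumr -big_split /=.
  by apply: eq_bigr => i _; rewrite add_lfunE scale_lfunE (ip_linear QP).
- move=> A B; rewrite !(froE _ _ eP).
  by apply: eq_bigr => i _; rewrite (ip_sym QP).
- move=> A A0; rewrite (froE _ _ eP) lt_def sumr_ge0 ?andbT; last first.
    by move=> i _; apply: ip_ge0.
  apply: contraNneq A0 => /eqP; rewrite psumr_eq0 => [/allP A0|i _]; last exact: ip_ge0.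
  apply/eqP/lfunP => x; rewrite (onb_expand eP x) linear_sum zero_lfunE big1 // => i _.
  have /implyP/(_ isT)/eqP/(ip_eq0 QP) Ae := A0 i (mem_index_enum i).
  by rewrite linearZ /= Ae scaler0.
Qed.

Lemma orthoproj_adj U X : orthoproj U X -> adj X = X.
Proof. by case=> s _ _; apply/esym/(adj_uniq QP). Qed.
Lemma orthoproj_idem U X : orthoproj U X -> (X \o X)%VF = X.
Proof. by case=> _ u i; apply/lfunP => x; rewrite comp_lfunE i. Qed.
Lemma orthoproj_ker U X x : orthoproj U X -> (forall y, y \in U -> Q x y = 0) -> X x = 0.
Proof.
case=> s u i h; apply: (ip_eq0 QP); rewrite s h // i // u.
Qed.
Lemma orthoproj_perp U X x y : orthoproj U X -> y \in U -> Q (x - X x) y = 0.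
Proof. by case=> s u i yU; rewrite (ipBl QP) s i // subrr. Qed.

(** The missing vectors form an orthonormal basis of the kernel of the orthogonal projection onto
    [U]. *)
Lemma extend_onb U n (u : 'I_n -> V) :
  (forall i j, Q (u i) (u j) = (i == j)%:R) -> (forall i, u i \in U) ->
  (forall x, x \in U -> x = \sum_i Q x (u i) *: u i) ->
  exists m (e : 'I_(n + m) -> V), [/\ onb Q e, forall i, e (lshift m i) = u i &
      forall i x, x \in U -> Q x (e (rshift n i)) = 0].
Proof.
move=> u1 u2 u3; have [X XP] := orthoproj_exists U; have [Xs Xu Xi] := XP.
have [m [w [w1 w2 w3]]] := orthonormal_basis (lker X).
have uw x i : x \in U -> Q x (w i) = 0.
  move=> xU; have := w2 i; rewrite memv_ker => /eqP Xw.
  by rewrite -(Xi x) // Xs Xw (ip0r QP).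
pose e (i : 'I_(n + m)) := match fintype.split i with inl j => u j | inr j => w j end.
have el j : e (lshift m j) = u j by rewrite /e -[lshift m j]/(unsplit (inl j)) unsplitK.
have er j : e (rshift n j) = w j by rewrite /e -[rshift n j]/(unsplit (inr j)) unsplitK.
exists m, e; split=> //; last by move=> i x xU; rewrite er uw.
split.
  move=> i j; rewrite -(fintype.splitK i) -(fintype.splitK j).
  case: (fintype.split i) => i'; case: (fintype.split j) => j' /=; rewrite ?el ?er.
  - by rewrite u1 (inj_eq (@lshift_inj _ _)).
  - by rewrite uw // eq_lrshift.
  - by rewrite (ip_sym QP) uw // eq_rlshift.
  - by rewrite w1 (inj_eq (@rshift_inj _ _)).
move=> x; rewrite big_split_ord /=.
rewrite (eq_bigr (fun i => Q (X x) (u i) *: u i)); last first.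
  by move=> i _; rewrite el Xs Xi.
rewrite -u3 // [X in _ + X](eq_bigr (fun i => Q (x - X x) (w i) *: w i)); last first.
  by move=> i _; rewrite er (ipBl QP) (uw (X x)) // subr0.
have <- : x - X x = \sum_i Q (x - X x) (w i) *: w i.
  by apply: w3; rewrite memv_ker linearB /= (Xi (X x)) // subrr.
by rewrite addrC subrK.
Qed.

Lemma adapted_onb U : exists n m (e : 'I_(n + m) -> V),
  [/\ onb Q e, forall i, e (lshift m i) \in U &
      forall i x, x \in U -> Q x (e (rshift n i)) = 0].
Proof.
have [n [u [u1 u2 u3]]] := orthonormal_basis U.
have [m [e [eP el er]]] := extend_onb u1 u2 u3.
by exists n, m, e; split=> // i; rewrite el.
Qed.

End InnerProduct2.

(** * The action of endomorphisms on bilinear maps *)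

Section BilinearMaps.
Variables (R : realType) (V : vectType R).
Implicit Types (x y z : V) (E : 'End(V)) (mu nu : V -> V -> V).

Record bilin mu : Prop := {
  bilin_l : forall y, linear (fun x => mu x y);
  bilin_r : forall x, linear (mu x) }.

Section Bilin.
Variable mu : V -> V -> V.
Hypothesis muB : bilin mu.
Lemma bilinDl x y z : mu (x + y) z = mu x z + mu y z.
Proof. by have := bilin_l muB z 1 x y; rewrite !scale1r. Qed.
Lemma bilinDr x y z : mu z (x + y) = mu z x + mu z y.
Proof. by have := bilin_r muB z 1 x y; rewrite !scale1r. Qed.
Lemma bilin0l z : mu 0 z = 0.
Proof. by have := bilin_l muB z (-1) 0 0; rewrite scaler0 addr0 scaleN1r addNr. Qed.
Lemma bilin0r z : mu z 0 = 0.
Proof. by have := bilin_r muB z (-1) 0 0; rewrite scaler0 addr0 scaleN1r addNr. Qed.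
Lemma bilinZl a x z : mu (a *: x) z = a *: mu x z.
Proof. by have := bilin_l muB z a x 0; rewrite !addr0 bilin0l addr0. Qed.
Lemma bilinZr a x z : mu z (a *: x) = a *: mu z x.
Proof. by have := bilin_r muB z a x 0; rewrite !addr0 bilin0r addr0. Qed.
Lemma bilinNl x z : mu (- x) z = - mu x z.
Proof. by rewrite -scaleN1r bilinZl scaleN1r. Qed.
Lemma bilinNr x z : mu z (- x) = - mu z x.
Proof. by rewrite -scaleN1r bilinZr scaleN1r. Qed.
Lemma bilinBl x y z : mu (x - y) z = mu x z - mu y z.
Proof. by rewrite bilinDl bilinNl. Qed.
Lemma bilinBr x y z : mu z (x - y) = mu z x - mu z y.
Proof. by rewrite bilinDr bilinNr. Qed.
Lemma bilin_suml I (r : seq I) (P : pred I) (F : I -> V) z :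
  mu (\sum_(i <- r | P i) F i) z = \sum_(i <- r | P i) mu (F i) z.
Proof. exact: (big_morph (mu^~ z) (fun x y => bilinDl x y z) (bilin0l z)). Qed.
Lemma bilin_sumr I (r : seq I) (P : pred I) (F : I -> V) z :
  mu z (\sum_(i <- r | P i) F i) = \sum_(i <- r | P i) mu z (F i).
Proof. exact: (big_morph (mu z) (fun x y => bilinDr x y z) (bilin0r z)). Qed.
End Bilin.

(* The infinitesimal action of [GL(V)] on bilinear maps. *)
Definition act E mu x y : V := E (mu x y) - mu (E x) y - mu x (E y).

Lemma act_deriv E mu : derivation mu E <-> forall x y, act E mu x y = 0.
Proof.
split=> H x y; first by rewrite /act H -addrA -opprD subrr.
by have /eqP := H x y; rewrite /act -addrA -opprD subr_eq0 => /eqP.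
Qed.

End BilinearMaps.

(* Linear identities between vectors are checked after pairing with a test vector. *)
Ltac vec QP := apply: (ip_inj QP) => ?;
  rewrite !(ipDl QP, ipBl QP, ipNl QP, ipZl QP, ip0l QP); ring.

Section BilinearInner.
Variables (R : realType) (V : vectType R) (Q : V -> V -> R).
Hypothesis QP : inner_product Q.
Implicit Types (x y z : V) (E A B : 'End(V)) (mu nu : V -> V -> V).
Local Notation adj := (adjoint Q).
Local Notation tr := (@lftrace R V).

Lemma act_bilin E mu : bilin mu -> bilin (act E mu).
Proof.
move=> muB; split=> [y a x x'|x a y y']; rewrite /act !linearP /=.
  by rewrite !(bilinDl muB) !(bilinZl muB) linearP; vec QP.
by rewrite !(bilinDr muB) !(bilinZr muB) linearP; vec QP.
Qed.

Lemma act_comm A B mu x y : bilin mu ->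
  act A (act B mu) x y - act B (act A mu) x y = act ((A \o B)%VF - (B \o A)%VF) mu x y.
Proof.
move=> muB; rewrite /act. rewrite !add_lfunE !opp_lfunE !comp_lfunE !linearB /=.
by rewrite !(bilinBl muB) !(bilinBr muB) !linearB; vec QP.
Qed.

Section Ndot.
Variables (n : nat) (e : 'I_n -> V).
Hypothesis eP : onb Q e.

Definition ndot mu nu : R := \sum_i \sum_j Q (mu (e i) (e j)) (nu (e i) (e j)).

Lemma eq_ndot mu mu' nu nu' : (forall x y, mu x y = mu' x y) ->
  (forall x y, nu x y = nu' x y) -> ndot mu nu = ndot mu' nu'.
Proof. by move=> m h; apply: eq_bigr => i _; apply: eq_bigr => j _; rewrite m h. Qed.

Lemma ndot_eq0 mu : bilin mu -> ndot mu mu = 0 -> forall x y, mu x y = 0.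
Proof.
move=> muB /eqP; rewrite psumr_eq0 => [/allP h x y|i _]; last first.
  by apply: sumr_ge0 => j _; apply: ip_ge0.
rewrite (onb_expand eP x) (bilin_suml muB) big1 // => i _.
rewrite (bilinZl muB) (onb_expand eP y) (bilin_sumr muB) big1 ?scaler0 // => j _.
have /implyP/(_ isT) := h i (mem_index_enum i).
rewrite psumr_eq0 => [/allP/(_ j (mem_index_enum j))/implyP/(_ isT)/eqP/(ip_eq0 QP) ij0|k _].
  by rewrite (bilinZr muB) ij0 scaler0.
exact: ip_ge0.
Qed.

(** Contraction over an orthonormal basis is contraction with the inverse metric, across which [A]
    passes as its adjoint. *)
Lemma sum_adj (f : V -> V -> R) A :
  (forall y, linear (fun x => f x y : R^o)) -> (forall x, linear (fun y => f x y : R^o)) ->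
  \sum_i f (A (e i)) (e i) = \sum_i f (e i) (adj A (e i)).
Proof.
move=> fl fr.
have sl (c : 'I_n -> R) y : f (\sum_i c i *: e i) y = \sum_i c i * f (e i) y.
  have f0 : f 0 y = 0 by have := fl y (-1) 0 0; rewrite scaler0 addr0 scaleN1r addNr.
  elim/big_rec2: _ => [|i a b _ <-]; first exact: f0.
  exact: fl.
have sr (c : 'I_n -> R) x : f x (\sum_i c i *: e i) = \sum_i c i * f x (e i).
  have f0 : f x 0 = 0 by have := fr x (-1) 0 0; rewrite scaler0 addr0 scaleN1r addNr.
  elim/big_rec2: _ => [|i a b _ <-]; first exact: f0.
  exact: fr.
transitivity (\sum_i \sum_j Q (A (e i)) (e j) * f (e j) (e i)).
  by apply: eq_bigr => i _; rewrite {1}(onb_expand eP (A (e i))) sl.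
rewrite exchange_big; apply: eq_bigr => j _ /=.
rewrite (onb_expand eP (adj A (e j))) sr.
by apply: eq_bigr => i _; rewrite (adjE QP) (ip_sym QP).
Qed.

Lemma ndot_act E mu nu : bilin mu -> bilin nu ->
  ndot (act E mu) nu = ndot mu (act (adj E) nu).
Proof.
move=> muB nuB.
pose a f := \sum_i \sum_j f (e i) (e j) : R.
have aB f g h : a (fun x y => f x y - g x y - h x y) = a f - a g - a h.
  rewrite /a -!sumrB; apply: eq_bigr => i _; rewrite -!sumrB; exact: eq_bigr.
have -> : ndot (act E mu) nu = a (fun x y => Q (E (mu x y)) (nu x y))
    - a (fun x y => Q (mu (E x) y) (nu x y)) - a (fun x y => Q (mu x (E y)) (nu x y)).
  rewrite -aB; apply: eq_bigr => i _; apply: eq_bigr => j _.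
  by rewrite /act !(ipBl QP).
have -> : ndot mu (act (adj E) nu) = a (fun x y => Q (mu x y) (adj E (nu x y)))
    - a (fun x y => Q (mu x y) (nu (adj E x) y)) - a (fun x y => Q (mu x y) (nu x (adj E y))).
  rewrite -aB; apply: eq_bigr => i _; apply: eq_bigr => j _.
  by rewrite /act !(ipBr QP).
congr (_ - _ - _).
- by apply: eq_bigr => i _; apply: eq_bigr => j _; rewrite (adjE QP).
- pose f x x' := \sum_j Q (mu x (e j)) (nu x' (e j)).
  apply: (@sum_adj f) => [x' b x y|x b y y'].
    rewrite -[RHS]/(b * f x x' + f y x') /f mulr_sumr -big_split; apply: eq_bigr => j _ /=.
    by rewrite (bilinDl muB) (bilinZl muB) (ipDl QP) (ipZl QP).
  rewrite -[RHS]/(b * f x y + f x y') /f mulr_sumr -big_split; apply: eq_bigr => j _ /=.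
  by rewrite (bilinDl nuB) (bilinZl nuB) (ipDr QP) (ipZr QP).
- apply: eq_bigr => i _; apply: (@sum_adj (fun y y' => Q (mu (e i) y) (nu (e i) y'))).
    by move=> y' b x y; rewrite (bilinDr muB) (bilinZr muB) (ip_linear QP).
  by move=> x b y y'; rewrite (bilinDr nuB) (bilinZr nuB) (ipDr QP) (ipZr QP).
Qed.

(** The source of the rigidity arguments: once the left side is known to vanish, [E] annihilates
    [mu] exactly when its adjoint does. It holds because [act] is a representation in which adjoints
    act as adjoints. *)
Lemma ndot_act_comm E mu : bilin mu ->
  ndot (act ((E \o adj E)%VF - (adj E \o E)%VF) mu) mu =
  ndot (act (adj E) mu) (act (adj E) mu) - ndot (act E mu) (act E mu).
Proof.
move=> muB.
have E1 : forall x y, act ((E \o adj E)%VF - (adj E \o E)%VF) mu x y =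
   act E (act (adj E) mu) x y - act (adj E) (act E mu) x y.
  by move=> x y; rewrite act_comm.
rewrite (eq_ndot E1 (fun x y => erefl _)).
have -> : ndot (fun x y => act E (act (adj E) mu) x y - act (adj E) (act E mu) x y) mu
  = ndot (act E (act (adj E) mu)) mu - ndot (act (adj E) (act E mu)) mu.
  rewrite /ndot -sumrB; apply: eq_bigr => i _; rewrite -sumrB; apply: eq_bigr => j _.
  by rewrite (ipBl QP).
by rewrite !ndot_act ?(adjK QP) //; apply: act_bilin.
Qed.

Lemma normal_derivation E mu : bilin mu ->
  (E \o adj E = adj E \o E)%VF -> derivation mu E -> derivation mu (adj E).
Proof.
move=> muB nE /act_deriv dE; apply/act_deriv.
apply: ndot_eq0; first exact: act_bilin.
have := ndot_act_comm E muB; rewrite nE subrr.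
rewrite (_ : ndot (act E mu) (act E mu) = 0) ?subr0; last first.
  by rewrite /ndot big1 // => i _; rewrite big1 // => j _; rewrite dE (ip0l QP).
move=> <-; rewrite /ndot big1 // => i _; rewrite big1 // => j _.
by rewrite /act !zero_lfunE (bilin0l muB) (bilin0r muB) !subr0 (ip0l QP).
Qed.

(** The moment map for the change-of-basis action on skew brackets, as a bilinear form. The
    normalization is the one in which it enters the Ricci curvature. *)
Definition mom mu x y : R :=
  - 2^-1 * (\sum_i Q (mu x (e i)) (mu y (e i))) +
  4^-1 * (\sum_i \sum_j Q (mu (e i) (e j)) x * Q (mu (e i) (e j)) y).

(** The two terms with [E] inside an argument of the bracket coincide by skew symmetry, so the
    weights of the outer and inner terms are 1 and -2, four times the coefficients 1/4 and -1/2 of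
    [mom]. *)
Lemma mom_act mu (M E : 'End(V)) : bilin mu -> (forall x y, mu x y = - mu y x) ->
  adj M = M -> (forall x y, mom mu x y = Q (M x) y) ->
  ndot (act E mu) mu = 4 * tr (M \o E)%VF.
Proof.
move=> muB muA sM momM.
have -> : tr (M \o E)%VF = \sum_l mom mu (e l) (E (e l)).
  rewrite (trE QP eP); apply: eq_bigr => l _.
  by rewrite comp_lfunE momM [LHS](adjE QP) sM (ip_sym QP).
rewrite /mom big_split /= -!mulr_sumr mulrDr !mulrA mulrN divff ?pnatr_eq0 // mul1r.
have -> : 4 / 2 = 2 :> R by lra.
have e2 : \sum_l \sum_i \sum_j Q (mu (e i) (e j)) (e l) * Q (mu (e i) (e j)) (E (e l))
  = \sum_i \sum_j Q (E (mu (e i) (e j))) (mu (e i) (e j)).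
  rewrite exchange_big; apply: eq_bigr => i _ /=.
  rewrite exchange_big; apply: eq_bigr => j _ /=.
  rewrite (adjE QP) (onb_parseval QP eP); apply: eq_bigr => l _.
  by rewrite -[in RHS](adjEr QP) /=; congr (_ * _); rewrite (adjEr QP) (adjK QP).
rewrite e2.
pose a f := \sum_i \sum_j f (e i) (e j) : R.
have -> : ndot (act E mu) mu = a (fun x y => Q (E (mu x y)) (mu x y))
    - a (fun x y => Q (mu (E x) y) (mu x y)) - a (fun x y => Q (mu x (E y)) (mu x y)).
  rewrite /a -!sumrB; apply: eq_bigr => i _; rewrite -!sumrB; apply: eq_bigr => j _.
  by rewrite /act !(ipBl QP).
have -> : a (fun x y => Q (mu x (E y)) (mu x y)) = a (fun x y => Q (mu (E x) y) (mu x y)).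
  rewrite /a exchange_big; apply: eq_bigr => i _; apply: eq_bigr => j _.
  by rewrite muA (muA (e j) (e i)) (ipNl QP) (ipNr QP) opprK.
have <- : a (fun x y => Q (mu (E x) y) (mu x y)) =
  \sum_l \sum_i Q (mu (e l) (e i)) (mu (E (e l)) (e i)).
  by apply: eq_bigr => i _; apply: eq_bigr => j _; rewrite (ip_sym QP).
rewrite -/(a (fun x y => Q (E (mu x y)) (mu x y))).
move: (a _) (a _) => u v; ring.
Qed.

Lemma ndot_act_diag E mu (phi : 'I_n -> R) : bilin mu ->
  (forall i, E (e i) = phi i *: e i) -> adj E = E ->
  ndot (act E mu) mu =
  \sum_i \sum_j \sum_k (phi k - phi i - phi j) * Q (mu (e i) (e j)) (e k) ^+ 2.
Proof.
move=> muB Ee sE; apply: eq_bigr => i _; apply: eq_bigr => j _.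
rewrite /act !Ee (bilinZl muB) (bilinZr muB) !(ipBl QP) !(ipZl QP).
rewrite (onb_parseval QP eP) [Q (mu _ _) (mu _ _)](onb_parseval QP eP).
rewrite !mulr_sumr -!sumrB; apply: eq_bigr => k _.
by rewrite (adjE QP) sE Ee (ipZr QP); ring.
Qed.

End Ndot.

End BilinearInner.

(** * The Ricci form of a reductive homogeneous space *)

Lemma eq_sum_sym (R : realType) n (f g : 'I_n -> 'I_n -> R) :
  (forall i j, f i j + f j i = g i j + g j i) ->
  \sum_i \sum_j f i j = \sum_i \sum_j g i j.
Proof.
move=> fg; have h (u : 'I_n -> 'I_n -> R) :
    (\sum_i \sum_j u i j) *+ 2 = \sum_i \sum_j (u i j + u j i).
  rewrite mulr2n {2}exchange_big -big_split; apply: eq_bigr => i _ /=.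
  by rewrite -big_split.
have : (\sum_i \sum_j f i j) *+ 2 = (\sum_i \sum_j g i j) *+ 2.
  by rewrite !h; apply: eq_bigr => i _; apply: eq_bigr => j _.
by move/eqP; rewrite eqrMn2r //= => /eqP.
Qed.

Section LeviCivita.
Variables (R : realType) (W : vectType R) (Q : W -> W -> R).
Hypothesis QP : inner_product Q.
Variables (pb : W -> W -> W) (nab : 'Hom(W, 'End(W))).
Hypothesis pbA : forall x y, pb x y = - pb y x.
Hypothesis nabM : forall x y z, Q (nab x y) z + Q y (nab x z) = 0.
Hypothesis nabT : forall x y, nab x y - nab y x = pb x y.
Variables (n : nat) (e : 'I_n -> W).
Hypothesis eP : onb Q e.

Lemma koszul x y z :
  Q (nab x y) z = 2^-1 * (Q (pb x y) z + Q (pb z y) x + Q (pb z x) y).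
Proof.
rewrite -!nabT !(ipBl QP).
have := nabM y z x; have := nabM z y x; have := nabM x z y.
rewrite !(ip_sym QP _ (nab _ _)); lra.
Qed.

(** The left side is the Ricci form at [y] without the isotropy term of [curvature]. Only skew
    symmetry is asked of [pb], because the p-component of a Lie bracket may violate the Jacobi
    identity. *)
Lemma levi_civita_ricci (h y : W) :
  (forall x, Q h x = \sum_i Q (pb x (e i)) (e i)) ->
  \sum_i (Q (nab (e i) (nab y y)) (e i) - Q (nab y (nab (e i) y)) (e i)
          - Q (nab (pb (e i) y) y) (e i)) =
  - Q (pb h y) y - 2^-1 * (\sum_i Q (pb y (e i)) (pb y (e i)))
  - 2^-1 * (\sum_i \sum_j Q (pb y (e i)) (e j) * Q (pb y (e j)) (e i))
  + 4^-1 * (\sum_i \sum_j Q (pb (e i) (e j)) y ^+ 2).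
Proof.
move=> hP.
have pbxx x : pb x x = 0.
  by apply/eqP; have /eqP := pbA x x; rewrite -addr_eq0 -mulr2n -scaler_nat scaler_eq0 pnatr_eq0.
rewrite !sumrB.
have -> : \sum_i Q (nab (e i) (nab y y)) (e i) = - Q (pb h y) y.
  have -> : \sum_i Q (nab (e i) (nab y y)) (e i) = - Q h (nab y y).
    rewrite hP -sumrN; apply: eq_bigr => i _.
    by rewrite koszul pbxx (ip0l QP) (pbA _ (nab y y)) (ipNl QP); field.
  by rewrite (ip_sym QP) koszul pbxx (ip0l QP); congr (- _); field.
pose p i j := Q (pb y (e i)) (e j); pose q i j := Q (pb (e i) (e j)) y.
have qA i j : q i j = - q j i by rewrite /q pbA (ipNl QP).
have nE i j : Q (nab (e i) y) (e j) = - (2^-1 * (p i j + p j i + q i j)).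
  rewrite koszul /p /q (pbA (e i) y) (pbA (e j) y) (pbA (e j) (e i)) !(ipNl QP); ring.
have mE i j : Q (nab y (e i)) (e j) = Q (nab (e i) y) (e j) + p i j.
  by rewrite /p -nabT (ipBl QP); ring.
have -> : \sum_i Q (nab y (nab (e i) y)) (e i) = - \sum_i \sum_j
   (Q (nab (e i) y) (e j) * (Q (nab (e i) y) (e j) + p i j)).
  rewrite -sumrN; apply: eq_bigr => i _.
  have -> : Q (nab y (nab (e i) y)) (e i) = - Q (nab (e i) y) (nab y (e i)).
    by apply/eqP; rewrite -addr_eq0 nabM.
  by rewrite (onb_parseval QP eP); congr (- _); apply: eq_bigr => j _; rewrite mE.
have -> : \sum_i Q (nab (pb (e i) y) y) (e i) = - \sum_i \sum_j
   (p i j * Q (nab (e j) y) (e i)).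
  rewrite -sumrN; apply: eq_bigr => i _.
  rewrite pbA linearN opp_lfunE (ipNl QP) {1}(onb_expand eP (pb y (e i))).
  rewrite linear_sum sum_lfunE (ip_suml QP); congr (- _); apply: eq_bigr => j _.
  by rewrite linearZ /= scale_lfunE (ipZl QP).
have -> : \sum_i Q (pb y (e i)) (pb y (e i)) = \sum_i \sum_j p i j * p i j.
  by apply: eq_bigr => i _; rewrite (onb_parseval QP eP).
rewrite -/(\sum_i \sum_j p i j * p j i).
rewrite !opprK -[X in X + _ + _ = _]addr0 -!addrA; congr (_ + _); rewrite add0r.
rewrite !mulr_sumr -!sumrN -!big_split /=.
under eq_bigr do rewrite -big_split /=.
under [RHS]eq_bigr do rewrite !mulr_sumr -!sumrN -!big_split /=.
(* The summands agree only after symmetrization: the product of the skew [q] with the symmetric part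
   of [p] is odd under exchange of the indices. *)
apply: eq_sum_sym => i j; rewrite -/(p i j) -/(p j i) -/(q i j) -/(q j i) !nE (qA j i).
by field.
Qed.
End LeviCivita.

Section RicciFormula.
Variables (R : realType) (V : vectType R) (Q : V -> V -> R).
Hypothesis QP : inner_product Q.

Lemma restr_inner_product U : inner_product (restr_form Q (U := U)).
Proof.
split=> [a x y z|x y|x x0]; rewrite /restr_form.
- by rewrite linearP (ip_linear QP).
- exact: (ip_sym QP).
- by apply: (ip_gt0 QP); rewrite -[0]/(vsval (0 : subvs_of U)) (inj_eq val_inj).
Qed.

Lemma restr_onb U n (u : 'I_n -> subvs_of U) X : onb (restr_form Q (U := U)) u ->
  orthoproj Q U X -> forall x, X x = \sum_i Q x (vsval (u i)) *: vsval (u i).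
Proof.
move=> [_ uE] [Xs Xu Xi] x.
have := congr1 vsval (uE (vsproj U (X x))).
rewrite vsprojK // => ->; rewrite linear_sum; apply: eq_bigr => i _.
rewrite linearZ /= /restr_form vsprojK // Xs Xi //; exact: subvsP.
Qed.

(** Moves contractions between a subspace, where the curvature lives, and the whole space, where
    [mom] of [pmu] is computed, at the price of inserting the projection. *)
Lemma sum_proj_onb U m (e : 'I_m -> V) n (u : 'I_n -> subvs_of U) X (f : V -> V -> R) :
  onb Q e -> onb (restr_form Q (U := U)) u -> orthoproj Q U X ->
  (forall y, linear (fun x => f x y : R^o)) -> (forall x, linear (fun y => f x y : R^o)) ->
  \sum_i f (X (e i)) (X (e i)) = \sum_i f (vsval (u i)) (vsval (u i)).
Proof.
move=> eP uP XP fl fr; have XE := restr_onb uP XP.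
have sl (c : 'I_n -> R) (w : 'I_n -> V) y : f (\sum_i c i *: w i) y = \sum_i c i * f (w i) y.
  have f0 : f 0 y = 0 by have := fl y (-1) 0 0; rewrite scaler0 addr0 scaleN1r addNr.
  elim/big_rec2: _ => [|i a b _ <-]; first exact: f0.
  exact: fl.
have sr (c : 'I_n -> R) (w : 'I_n -> V) x : f x (\sum_i c i *: w i) = \sum_i c i * f x (w i).
  have f0 : f x 0 = 0 by have := fr x (-1) 0 0; rewrite scaler0 addr0 scaleN1r addNr.
  elim/big_rec2: _ => [|i a b _ <-]; first exact: f0.
  exact: fr.
transitivity (\sum_i \sum_j \sum_k
   Q (vsval (u j)) (e i) * Q (vsval (u k)) (e i) * f (vsval (u j)) (vsval (u k))).
  apply: eq_bigr => i _; rewrite XE sl; apply: eq_bigr => j _.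
  rewrite sr mulr_sumr; apply: eq_bigr => k _.
  by rewrite mulrA !(ip_sym QP (e i)).
rewrite exchange_big; apply: eq_bigr => j _ /=.
rewrite exchange_big (bigD1 j) //= -mulr_suml -(onb_parseval QP eP).
have uu i : Q (vsval (u j)) (vsval (u i)) = (j == i)%:R by case: uP => /(_ j i).
rewrite uu eqxx mul1r big1 ?addr0 // => k kj.
by rewrite -mulr_suml -(onb_parseval QP eP) uu eq_sym (negbTE kj) mul0r.
Qed.
End RicciFormula.

Lemma dot_inner_product (R : realType) (V : vectType R) (ip : {dot V for idfun}) :
  inner_product ip.
Proof.
split=> [a x y z|x y|x]; first exact: linearPl.
  by rewrite hermC expr0 mul1r.
exact: neq0_dnorm_gt0.
Qed.

(** * Lie brackets, derivations and the Killing form *)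

Section LieBracket.
Variables (R : realType) (V : vectType R) (br : {bilinear V -> V -> V}).
Variables (Q : V -> V -> R).
Hypothesis QP : inner_product Q.
Hypothesis brL : lie_bracket br.
Local Notation tr := (@lftrace R V).

Lemma br_bilin : bilin br.
Proof. by split=> [y a x x'|x a y y']; [apply: linearPl | apply: linearPr]. Qed.

Lemma brxx x : br x x = 0. Proof. by case: brL. Qed.
Lemma brC x y : br x y = - br y x.
Proof.
apply/eqP; rewrite -addr_eq0; apply/eqP.
by have := brxx (x + y); rewrite linearDl !linearDr !brxx addr0 add0r.
Qed.
Lemma jacobi x y z : br x (br y z) = br (br x y) z + br y (br x z).
Proof.
have := brL.2 x y z; rewrite (brC z (br x y)) (brC z x) linearNr => /eqP.
by rewrite -addrA -opprD subr_eq0 addrC => /eqP.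
Qed.

Lemma adE x y : ad br x y = br x y.
Proof. by rewrite /ad linfun_linear //; apply: bilin_r br_bilin x. Qed.

Lemma ad_deriv x : derivation br (ad br x).
Proof. by move=> y z; rewrite !adE jacobi. Qed.

Lemma ad_linear a x y : ad br (a *: x + y) = a *: ad br x + ad br y.
Proof.
by apply/lfunP => z; rewrite add_lfunE scale_lfunE !adE (bilin_l br_bilin).
Qed.

Lemma ad_br x y : ad br (br x y) = ((ad br x \o ad br y)%VF - (ad br y \o ad br x)%VF).
Proof.
apply/lfunP => z; rewrite add_lfunE opp_lfunE !comp_lfunE !adE jacobi.
by rewrite addrK.
Qed.

Lemma deriv_ad (D : 'End(V)) x : derivation br D ->
  ad br (D x) = ((D \o ad br x)%VF - (ad br x \o D)%VF).
Proof.
move=> dD; apply/lfunP => z; rewrite add_lfunE opp_lfunE !comp_lfunE !adE dD.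
by rewrite addrK.
Qed.

Lemma killingC x y : killing br x y = killing br y x.
Proof. exact: (tr_comp QP). Qed.

Lemma killing_linear a x y z : killing br (a *: x + y) z = a * killing br x z + killing br y z.
Proof. by rewrite /killing ad_linear comp_lfunDl (trD QP) -comp_lfunZl (trZ QP). Qed.

Lemma killing0 v : killing br 0 v = 0.
Proof.
by have := killing_linear (-1) 0 0 v; rewrite scaler0 addr0 mulN1r addNr.
Qed.

Lemma killing_deriv (D : 'End(V)) x y : derivation br D ->
  killing br (D x) y = - killing br x (D y).
Proof.
move=> dD; rewrite /killing !deriv_ad // comp_lfunBl comp_lfunBr !(trB QP).
by rewrite !comp_lfunA (tr_compC3 QP (ad br x) (ad br y) D); ring.
Qed.

Lemma killing_inv x y z : killing br (br x y) z = killing br x (br y z).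
Proof.
have k0 v : killing br 0 v = 0.
  by have := killing_linear (-1) 0 0 v; rewrite scaler0 addr0 mulN1r addNr.
have kN u v : killing br (- u) v = - killing br u v.
  by have := killing_linear (-1) u 0 v; rewrite !addr0 scaleN1r mulN1r k0 addr0.
by rewrite brC kN -(adE y x) killing_deriv ?opprK ?adE //; apply: ad_deriv.
Qed.

Lemma tr_ad_br x y : tr (ad br (br x y)) = 0.
Proof. by rewrite ad_br (trB QP) (tr_comp QP) subrr. Qed.

Lemma tr_ad_deriv (D : 'End(V)) x : derivation br D -> tr (ad br (D x)) = 0.
Proof. by move=> dD; rewrite deriv_ad // (trB QP) (tr_comp QP) subrr. Qed.

Lemma bilin_killing : (forall y, linear (fun x => killing br x y : R^o)) /\
  (forall x, linear (fun y => killing br x y : R^o)).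
Proof.
split=> [y a x x'|x a y y']; first exact: killing_linear.
by rewrite !(killingC x) killing_linear.
Qed.

(** The kernel of [T] is the radical of the Killing form, which thereby becomes available as a
    subspace. *)
Lemma killing_operator : exists T : 'End(V),
  adjoint Q T = T /\ forall x y, killing br x y = Q (T x) y.
Proof.
have [n [e eP]] := onb_exists QP.
have L : linear (fun x => \sum_i killing br x (e i) *: e i).
  move=> a x y; rewrite scaler_sumr -big_split /=; apply: eq_bigr => i _.
  by rewrite killing_linear scalerDl scalerA.
pose T : 'End(V) := linfun (fun x => \sum_i killing br x (e i) *: e i).
have kE x y : killing br x y = Q (T x) y.
  rewrite /T (linfun_linear L) (ip_suml QP) killingC {1}(onb_expand eP y).
  have sl (c : 'I_n -> R) z : killing br (\sum_i c i *: e i) z = \sum_i c i * killing br (e i) z.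
    have f0 : killing br 0 z = 0.
      by have := bilin_killing.1 z (-1) 0 0; rewrite scaler0 addr0 scaleN1r addNr.
    elim/big_rec2: _ => [|i a b _ <-]; first exact: f0.
    exact: killing_linear.
  rewrite sl; apply: eq_bigr => i _.
  by rewrite (ipZl QP) killingC mulrC (ip_sym QP).
exists T; split=> //; apply/esym/(adj_uniq QP) => x y.
by rewrite -kE killingC kE (ip_sym QP).
Qed.
End LieBracket.

(** * The Ricci formula in terms of the bracket of p *)

Section MetricReductive.
Variables (R : realType) (V : vectType R) (br : {bilinear V -> V -> V}).
Variables (k p : {vspace V}) (ip : {dot V for idfun}).
Hypothesis mr : metric_reductive br k p ip.
Local Notation tr := (@lftrace R V).
Let QP := dot_inner_product ip.
Let brL := mr_lie mr.
Variable P : 'End(V).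
Hypothesis PP : orthoproj ip p P.
Local Notation K := (\1%VF - P).

Lemma P_in x : P x \in p. Proof. by case: PP => _ /(_ x). Qed.
Lemma P_id x : x \in p -> P x = x. Proof. by case: PP => _ _ /(_ x). Qed.
Lemma P_sym x y : ip (P x) y = ip x (P y). Proof. by case: PP => /(_ x y). Qed.
Lemma P_k z : z \in k -> P z = 0.
Proof. by move=> zk; apply: (orthoproj_ker QP PP) => y yp; apply: (mr_orthogonal mr). Qed.
Lemma K_in x : x - P x \in k.
Proof.
have : x \in (k + p)%VS by rewrite (mr_sum mr) memvf.
by case/memv_addP => z zk [y yp ->]; rewrite linearD /= P_k // P_id // add0r addrK.
Qed.
Lemma decomp x : exists z y, [/\ z \in k, y \in p & x = z + y].
Proof. by exists (x - P x), (P x); rewrite K_in P_in subrK. Qed.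

Lemma daddv_pi_pk x : daddv_pi p k x = P x.
Proof.
have dk : (p :&: k = 0)%VS by rewrite capvC (mr_direct mr).
have [z [y [zk yp ->]]] := decomp x.
rewrite !linearD /= (daddv_pi_id dk yp) (P_id yp) (P_k zk) add0r.
rewrite -[RHS]add0r; congr (_ + _).
have := daddv_pi_add dk (_ : z \in (p + k)%VS).
move=> /(_ (subvP (addvSr p k) z zk)); rewrite (daddv_pi_id _ zk) ?(mr_direct mr) //.
by move=> /(canRL (addrK _)) ->; rewrite subrr.
Qed.

Lemma daddv_pi_kp x : daddv_pi k p x = x - P x.
Proof.
have dk : (p :&: k = 0)%VS by rewrite capvC (mr_direct mr).
have := daddv_pi_add dk (_ : x \in (p + k)%VS).
rewrite addvC (mr_sum mr) => /(_ (memvf x)); rewrite daddv_pi_pk addrC.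
by move=> /(canRL (addrK _)).
Qed.

Lemma p_bracketE x y : vsval (p_bracket br k (p := p) x y) = P (br (vsval x) (vsval y)).
Proof. by rewrite /p_bracket vsprojK ?daddv_pi_pk // P_in. Qed.

Lemma ad_k_skew z : z \in k -> adjoint ip (ad br z) = - ad br z.
Proof.
move=> zk; apply/esym/(adj_uniq QP) => x y; rewrite opp_lfunE (ipNr QP) !adE.
by apply/eqP; rewrite -addr_eq0 (mr_invariant mr).
Qed.

(** The bracket of p extended by zero to the whole Lie algebra, so that endomorphisms of the latter
    act on it directly. *)
Definition pmu x y := P (br (P x) (P y)).

Lemma pmu_bilin : bilin pmu.
Proof.
split=> [y a x x'|x a y y']; rewrite /pmu !linearP //=.
by rewrite (bilin_l (br_bilin br)) linearP.
Qed.
Lemma pmuC x y : pmu x y = - pmu y x.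
Proof. by rewrite /pmu (brC brL) linearN. Qed.

Local Notation ipp := (restr_form ip (U := p)).

(** The Levi-Civita computation produces the trace of the square of y acting through the p-bracket.
    The Killing form has in addition the paths from p through k back to p, counted twice; half of
    that excess is the isotropy term of the curvature. *)
Lemma ricci_formula (Ric : 'End(subvs_of p)) H n (e : 'I_n -> V) y :
  is_ricci_operator br k ipp Ric -> mean_curvature_vector br p ip H -> onb ip e ->
  ip (vsval (Ric y)) (vsval y) =
  mom ip e pmu (vsval y) (vsval y) - 2^-1 * killing br (vsval y) (vsval y)
  - ip (br H (vsval y)) (vsval y).
Proof.
move=> [nab [[nabM nabT] rcE]] [Hp HE] eP.
have QP' := restr_inner_product QP p.
have [m [u uP]] := onb_exists QP'.
have -> : ip (vsval (Ric y)) (vsval y) = ipp (Ric y) y by [].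
rewrite rcE (trE QP' uP).
pose pb := p_bracket br k (p := p).
have pbL a x x' z : pb (a *: x + x') z = a *: pb x z + pb x' z.
  by apply: subvs_inj; rewrite linearP /= !p_bracketE linearP (bilin_l (br_bilin br)) linearP.
have Lc : linear (fun x => curvature br k nab x y y).
  move=> a x x'; rewrite /curvature -/pb pbL !linearP (bilin_l (br_bilin br)) !linearP /=.
  rewrite (bilin_l (br_bilin br)) !(add_lfunE, scale_lfunE) !linearP /=.
  by vec QP'.
under eq_bigr do rewrite (linfun_linear Lc).
have pbC x z : pb x z = - pb z x.
  by apply: subvs_inj; rewrite linearN /= !p_bracketE (brC brL) linearN.
pose h := vsproj p H; pose Y := vsval y.
pose bl (f : V -> V -> R) : Prop := (forall y, linear (fun x => f x y : R^o)) /\ (forall x, linear (fun y => f x y : R^o)).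
have spu (f : V -> V -> R) : bl f ->
    \sum_i f (P (e i)) (P (e i)) = \sum_i f (vsval (u i)) (vsval (u i)).
  by move=> [fl fr]; apply: (sum_proj_onb QP eP uP PP).
have blT (T S : 'End(V)) : bl (fun a b => ip (T a) (S b)).
  by split=> c a x x'; rewrite linearP ?(ip_linear QP) // (ipDr QP) (ipZr QP).
have trP (T : 'End(V)) : tr (T \o P)%VF = \sum_i ip (T (vsval (u i))) (vsval (u i)).
  have -> : tr (T \o P)%VF = \sum_i ip (T (P (e i))) (\1%VF (P (e i))).
    rewrite -[in LHS](orthoproj_idem PP) comp_lfunA (tr_comp QP) (trE QP eP).
    by apply: eq_bigr => i _; rewrite !comp_lfunE P_sym id_lfunE.
  by rewrite (spu _ (blT T \1%VF)); apply: eq_bigr => i _; rewrite id_lfunE.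
have hE x : ipp h x = \sum_i ipp (pb x (u i)) (u i).
  rewrite /restr_form /h vsprojK // HE.
  (* For x in p, [ad x] maps k into p, so its trace comes from the p block alone. *)
  have -> : tr (ad br (vsval x)) = tr (ad br (vsval x) \o P)%VF.
    rewrite -[LHS](congr1 tr (comp_lfun1r _)) -{1}(subrK P \1%VF) comp_lfunDr (trD QP).
    rewrite [X in X + _](_ : _ = 0) ?add0r //.
    have KK : (K \o K)%VF = K.
      rewrite comp_lfunBl comp_lfun1l comp_lfunBr comp_lfun1r (orthoproj_idem PP).
      by rewrite subrr subr0.
    rewrite -KK comp_lfunA (tr_comp QP) comp_lfunA.
    have -> : (K \o ad br (vsval x) \o K)%VF = 0.
      apply/lfunP => z; rewrite !comp_lfunE zero_lfunE adE add_lfunE opp_lfunE id_lfunE.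
      rewrite (P_id (x := br _ _)) ?subrr // (brC brL) memvN.
      by rewrite (mr_reductive mr) ?subvsP // add_lfunE opp_lfunE id_lfunE K_in.
    exact: (tr0 QP).
  rewrite trP; apply: eq_bigr => i _.
  by rewrite p_bracketE P_sym P_id ?adE ?subvsP.
have KU i : vsval (vsproj p (br (daddv_pi k p (br (vsval (u i)) Y)) Y)) =
            br (K (br (vsval (u i)) Y)) Y.
  rewrite vsprojK ?daddv_pi_kp ?add_lfunE ?opp_lfunE ?id_lfunE //.
  by apply: (mr_reductive mr); [exact: K_in | exact: subvsP].
have := levi_civita_ricci QP' pbC nabM nabT uP y hE.
set S1 := (X in X = _ -> _) => S1E.
have -> : \sum_i ipp (curvature br k nab (u i) y y) (u i) =
  S1 - \sum_i ip (br (K (br (vsval (u i)) Y)) Y) (vsval (u i)).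
  rewrite /S1 -sumrB; apply: eq_bigr => i _; rewrite /curvature.
  by rewrite !(ipBl QP') [X in _ - X]/restr_form KU.
rewrite S1E {S1 S1E}.
have YP : P Y = Y by rewrite P_id // subvsP.
have uPi i : P (vsval (u i)) = vsval (u i) by rewrite P_id // subvsP.
have -> : ipp (pb h y) y = ip (br H Y) Y.
  by rewrite /restr_form p_bracketE vsprojK // P_sym -/Y YP.
pose T := ad br Y.
have f2 : \sum_i ip (pmu Y (e i)) (pmu Y (e i)) = \sum_i ipp (pb y (u i)) (pb y (u i)).
  have := spu _ (blT (P \o T)%VF (P \o T)%VF).
  rewrite (eq_bigr (fun i => ip (pmu Y (e i)) (pmu Y (e i)))) => [->|i _].
    by apply: eq_bigr => i _; rewrite /restr_form !p_bracketE !comp_lfunE adE.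
  by rewrite /pmu YP !comp_lfunE adE.
have f2' : \sum_i \sum_j ip (pmu (e i) (e j)) Y * ip (pmu (e i) (e j)) Y =
   \sum_i \sum_j ipp (pb (u i) (u j)) y ^+ 2.
  pose F a b := ip (br a b) Y.
  have FP a b : ip (pmu a b) Y = F (P a) (P b) by rewrite /pmu P_sym YP.
  have Fl b : linear (fun a => F a b : R^o).
    by move=> c a a'; rewrite /F (bilin_l (br_bilin br)) (ip_linear QP).
  have Fr b : linear (fun a => F b a : R^o).
    by move=> c a a'; rewrite /F (bilin_r (br_bilin br)) (ip_linear QP).
  transitivity (\sum_i \sum_j F (P (e i)) (vsval (u j)) * F (P (e i)) (vsval (u j))).
    apply: eq_bigr => i _; under eq_bigr do rewrite FP.
    apply: (spu (fun a b => F (P (e i)) a * F (P (e i)) b)).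
    by split=> b c a a'; rewrite Fr -[RHS]/(c * _ + _) -[c *: _]/(c * _); ring.
  rewrite exchange_big /=; under [RHS]eq_bigr do under eq_bigr do rewrite /restr_form p_bracketE P_sym YP.
  rewrite [RHS]exchange_big; apply: eq_bigr => j _ /=.
  rewrite (spu (fun a b => F a (vsval (u j)) * F b (vsval (u j)))) //.
  by split=> b c a a'; rewrite Fl -[RHS]/(c * _ + _) -[c *: _]/(c * _); ring.
have f3 : killing br Y Y = \sum_i \sum_j ipp (pb y (u i)) (u j) * ipp (pb y (u j)) (u i)
   + 2 * \sum_i ip (br Y (K (br Y (vsval (u i))))) (vsval (u i)).
  have -> : \sum_i ip (br Y (K (br Y (vsval (u i))))) (vsval (u i)) = tr (T \o K \o T \o P)%VF.
    by rewrite trP; apply: eq_bigr => i _; rewrite !comp_lfunE /T !adE.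
  have -> : \sum_i \sum_j ipp (pb y (u i)) (u j) * ipp (pb y (u j)) (u i) =
      tr (T \o P \o T \o P)%VF.
    rewrite trP; apply: eq_bigr => i _.
    rewrite !comp_lfunE (restr_onb uP PP (T _)) linear_sum (ip_suml QP).
    apply: eq_bigr => j _; rewrite linearZ (ipZl QP) /restr_form !p_bracketE !P_sym !uPi.
    by rewrite /T /= !adE.
  (* [ad Y] maps k into p, so its k block is zero. Expanding tr (K T K T) = 0 with K = 1 - P
     expresses tr (T T) through the remaining blocks. *)
  have KTK : (K \o T \o K)%VF = 0.
    apply/lfunP => z; rewrite !comp_lfunE zero_lfunE /T adE add_lfunE opp_lfunE id_lfunE.
    rewrite (P_id (x := br _ _)) ?subrr // (brC brL) memvN.
    by rewrite (mr_reductive mr) ?subvsP // add_lfunE opp_lfunE id_lfunE K_in.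
  have e1 : tr (K \o T \o K \o T)%VF = 0 by rewrite KTK comp_lfun0l (tr0 QP).
  move: e1; rewrite !(comp_lfunBl, comp_lfunBr, comp_lfun1l, comp_lfun1r, comp_lfunA) !(trB QP).
  have -> : tr (P \o T \o T)%VF = tr (T \o T \o P)%VF by rewrite (tr_compC3 QP T T P).
  have -> : tr (T \o P \o T)%VF = tr (T \o T \o P)%VF by rewrite (tr_compC3 QP T P T).
  have -> : tr (P \o T \o P \o T)%VF = tr (T \o P \o T \o P)%VF.
    by rewrite (tr_comp QP) !comp_lfunA.
  rewrite /killing -/T; lra.
rewrite f3 /mom f2 f2'.
have -> : \sum_i ip (br (K (br (vsval (u i)) Y)) Y) (vsval (u i)) =
  \sum_i ip (br Y (K (br Y (vsval (u i))))) (vsval (u i)).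
  apply: eq_bigr => i _; rewrite (brC brL) (brC brL (vsval (u i)) Y) linearN linearNr opprK //.
rewrite -/Y; field => //.
Qed.
End MetricReductive.

(** * The hyperbolic part of an endomorphism *)

(** The Chinese remainder theorem for the moduli (X - a)^M with constant residues: evaluated at an
    operator, [P] is the scalar [v a] on vectors killed by the M-th power of the operator minus
    a. *)
Lemma hermite_interpolation (F : fieldType) (S : seq F) (v : F -> F) (M : nat) :
  uniq S -> exists P : {poly F}, forall a, a \in S -> ('X - a%:P) ^+ M %| P - (v a)%:P.
Proof.
elim: S => [|b S IH] /=; first by exists 0.
move=> /andP[bS /IH[P PP]].
pose W := \prod_(a <- S) ('X - a%:P) ^+ M.
have cW : coprimep W (('X - b%:P) ^+ M).
  rewrite /W; elim: (S) bS => [|a s IHs]; first by rewrite big_nil coprime1p.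
  rewrite inE negb_or => /andP[ba bs]; rewrite big_cons coprimepMl IHs // andbT.
  by rewrite coprimep_expl // coprimep_expr // coprimep_XsubC root_XsubC.
have [[s t] /= st] := Bezout_eq1_coprimepP _ _ cW.
exists (P + ((v b)%:P - P) * s * W) => a; rewrite inE => /orP[/eqP ->|aS].
  have -> : P + ((v b)%:P - P) * s * W - (v b)%:P =
            (P - (v b)%:P) * t * ('X - b%:P) ^+ M.
    rewrite -[RHS]mulrA (_ : t * _ = 1 - s * W); last by apply/eqP; rewrite eq_sym subr_eq addrC st.
    by move: (v b)%:P => w; ring.
  exact: dvdp_mull.
rewrite addrAC dvdp_addl ?PP //.
rewrite dvdp_mull // /W; elim: (S) aS => // c s' IHs; rewrite inE big_cons.
by move=> /orP[/eqP ->|/IHs]; [apply: dvdp_mulr | apply: dvdp_mull].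
Qed.

Section TrigPoly.
Variables (F : comNzRingType) (n' : nat).
Local Notation n := n'.+1.

Lemma trig_mulmx (A B : 'M[F]_n) : is_trig_mx A -> is_trig_mx B ->
  is_trig_mx (A *m B) /\ forall i, (A *m B) i i = A i i * B i i.
Proof.
move=> /is_trig_mxP tA /is_trig_mxP tB; split.
  apply/is_trig_mxP => i j ij; rewrite mxE big1 // => l _.
  case: (ltnP i l) => [il|li]; first by rewrite tA // mul0r.
  by rewrite tB ?mulr0 // (leq_ltn_trans li).
move=> i; rewrite mxE (bigD1 i) //= big1 ?addr0 // => l li.
case: (ltnP i l) => [il|il]; first by rewrite tA // mul0r.
by rewrite tB ?mulr0 // ltn_neqAle li.
Qed.

Lemma trig_horner (A : 'M[F]_n) (q : {poly F}) : is_trig_mx A ->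
  is_trig_mx (horner_mx A q) /\ forall i, horner_mx A q i i = q.[A i i].
Proof.
move=> tA; elim/poly_ind: q => [|q c [tq dq]].
  rewrite rmorph0; split; first by apply/is_trig_mxP => i j _; rewrite mxE.
  by move=> i; rewrite mxE horner0.
have [tm dm] := trig_mulmx tq tA.
rewrite rmorphD rmorphM /= horner_mx_X horner_mx_C; split.
  apply/is_trig_mxP => i j ij; rewrite mxE [X in X + _](is_trig_mxP tm) // add0r.
  by rewrite mxE -val_eqE ltn_eqF ?mulr0n.
by move=> i; rewrite mxE dm dq [X in _ + X]mxE eqxx mulr1n !hornerE.
Qed.
End TrigPoly.

Section HyperbolicMatrix.
Variables (R : rcfType) (n' : nat).
Local Notation n := n'.+1.
Local Notation C := R[i].
Local Notation toC := (real_complex R).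

(** [u] lists the eigenvalues with multiplicity, read off the diagonal of a Schur form; the second
    clause is Cayley-Hamilton. *)
Lemma complex_trigonal (A : 'M[C]_n) : exists u : 'I_n -> C,
  (forall q : {poly C}, \tr (horner_mx A q) = \sum_i q.[u i]) /\
  horner_mx A (\prod_i ('X - (u i)%:P)) = 0.
Proof.
have [P Pu tP] := Schur A (ltn0Sn n').
have PU : P \in unitmx by apply: unitarymx_unit.
pose U := P *m A *m invmx P.
have tU : is_trig_mx U by move: tP; rewrite /= /similar_to conjumx.
exists (fun i => U i i); split=> [q|].
  have [_ d] := trig_horner q tU.
  have -> : \tr (horner_mx A q) = \tr (horner_mx U q).
    by rewrite /U horner_mx_uconj // mxtrace_mulC mulmxA mulVmx // mul1mx.
  by apply: eq_bigr => i _; rewrite d.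
have cU : char_poly U = \prod_i ('X - (U i i)%:P) by apply: char_poly_trig.
rewrite -cU (_ : A = invmx P *m U *m P).
  by rewrite horner_mx_uconjC // Cayley_Hamilton mulmx0 mul0mx.
by rewrite /U !mulmxA mulVmx // mul1mx -mulmxA mulVmx // mulmx1.
Qed.

Lemma dvdp_horner_root (F : fieldType) (a b : F) (P : {poly F}) M :
  (0 < M)%N -> ('X - a%:P) ^+ M %| P - b%:P -> P.[a] = b.
Proof.
case: M => // M _ /dvdpP[q /(congr1 (fun r => r.[a]))].
by rewrite !hornerE subrr expr0n mulr0 => /eqP; rewrite subr_eq0 => /eqP.
Qed.

(* Applied to the eigenvalues of [A], the polynomial [P] turns [A] into its hyperbolic part. *)
Lemma real_part_polynomial (S : seq C) (M : nat) : uniq S ->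
  (forall a, a \in S -> conjc a \in S) -> exists P : {poly R},
  forall a, a \in S -> ('X - a%:P) ^+ M %| map_poly toC P - (toC (complex.Re a))%:P.
Proof.
move=> uS cS; have [P0 P0P] := hermite_interpolation (fun a => toC (complex.Re a)) M uS.
(* The conjugate polynomial satisfies the same congruences, since [S] is stable under conjugation
   and real parts are unchanged by it. The average of both has real coefficients. *)
pose Q := map_poly (@conjc R) P0.
exists (map_poly (@complex.Re R : C -> R) P0) => a aS.
have QP : ('X - a%:P) ^+ M %| Q - (toC (complex.Re a))%:P.
  have [q qE] := dvdpP _ _ (P0P _ (cS _ aS)).
  have -> : Q - (toC (complex.Re a))%:P = map_poly (@conjc R) q * ('X - a%:P) ^+ M.
    have := congr1 (map_poly (@conjc R)) qE.
    rewrite rmorphB /= map_polyC /= rmorphM rmorphXn rmorphB /= map_polyX map_polyC /= conjcK.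
    by case: (a) => x y /=; rewrite oppr0.
  exact: dvdp_mull.
have -> : map_poly toC (map_poly (@complex.Re R : C -> R) P0) - (toC (complex.Re a))%:P =
    (2^-1)%:P * ((P0 - (toC (complex.Re a))%:P) + (Q - (toC (complex.Re a))%:P)).
  apply/polyP => i; rewrite coefB coefCM coefD !coefB.
  rewrite [(map_poly toC _)`_i]coef_map /= coef_map_id0 // coef_map /= !coefC.
  have -> : toC (complex.Re P0`_i) = (P0`_i + conjc P0`_i) / 2 by rewrite ReJ_add.
  by case: (i == 0)%N; field.
by rewrite dvdp_mull // dvdp_add ?P0P.
Qed.

Local Notation mC := (map_mx toC).

(** The complex bilinear extension of [mu]. *)
Definition cbil (mu : 'rV[R]_n -> 'rV[R]_n -> 'rV[R]_n) (x y : 'rV[C]_n) : 'rV[C]_n :=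
  \sum_i \sum_j (x 0 i * y 0 j) *: mC (mu (delta_mx 0 i) (delta_mx 0 j)).

Section Cbil.
Variable mu : 'rV[R]_n -> 'rV[R]_n -> 'rV[R]_n.
Hypothesis mul : forall y, linear (fun x => mu x y).
Hypothesis mur : forall x, linear (mu x).

Lemma cbil_l y : linear (fun x => cbil mu x y).
Proof.
move=> a x x'; rewrite /cbil scaler_sumr -big_split; apply: eq_bigr => i _ /=.
rewrite scaler_sumr -big_split; apply: eq_bigr => j _ /=.
by rewrite !mxE mulrDl scalerDl scalerA mulrA.
Qed.
Lemma cbil_r x : linear (cbil mu x).
Proof.
move=> a y y'; rewrite /cbil scaler_sumr -big_split; apply: eq_bigr => i _ /=.
rewrite scaler_sumr -big_split; apply: eq_bigr => j _ /=.
by rewrite !mxE mulrDr scalerDl scalerA mulrCA.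
Qed.

Lemma cbil_map x y : cbil mu (mC x) (mC y) = mC (mu x y).
Proof.
have mu0l z : mu 0 z = 0 by have := mul z (-1) 0 0; rewrite scaler0 addr0 scaleN1r addNr.
have mu0r z : mu z 0 = 0 by have := mur z (-1) 0 0; rewrite scaler0 addr0 scaleN1r addNr.
have sl (c : 'I_n -> R) z : mu (\sum_i c i *: delta_mx 0 i) z = \sum_i c i *: mu (delta_mx 0 i) z.
  by elim/big_rec2: _ => [|i a b _ <-]; [exact: mu0l | exact: mul].
have sr (c : 'I_n -> R) z : mu z (\sum_i c i *: delta_mx 0 i) = \sum_i c i *: mu z (delta_mx 0 i).
  by elim/big_rec2: _ => [|i a b _ <-]; [exact: mu0r | exact: mur].
rewrite {2}(row_sum_delta x) sl raddf_sum; apply: eq_bigr => i _ /=.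
rewrite map_mxZ {2}(row_sum_delta y) sr raddf_sum scaler_sumr; apply: eq_bigr => j _ /=.
by rewrite map_mxZ scalerA !mxE.
Qed.

Lemma cbil_deriv (A : 'M[R]_n) :
  (forall x y, mu x y *m A = mu (x *m A) y + mu x (y *m A)) ->
  forall x y, cbil mu x y *m mC A = cbil mu (x *m mC A) y + cbil mu x (y *m mC A).
Proof.
move=> dA.
have c0l z : cbil mu 0 z = 0 by have := cbil_l z (-1) 0 0; rewrite scaler0 addr0 scaleN1r addNr.
have c0r z : cbil mu z 0 = 0 by have := cbil_r z (-1) 0 0; rewrite scaler0 addr0 scaleN1r addNr.
have sl (c : 'I_n -> C) (w : 'I_n -> 'rV[C]_n) z :
   cbil mu (\sum_i c i *: w i) z = \sum_i c i *: cbil mu (w i) z.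
  by elim/big_rec2: _ => [|i a b _ <-]; [exact: c0l | exact: cbil_l].
have sr (c : 'I_n -> C) (w : 'I_n -> 'rV[C]_n) z :
   cbil mu z (\sum_i c i *: w i) = \sum_i c i *: cbil mu z (w i).
  by elim/big_rec2: _ => [|i a b _ <-]; [exact: c0r | exact: cbil_r].
have dE i : delta_mx 0 i = mC (delta_mx 0 i) :> 'rV[C]_n by rewrite map_delta_mx.
move=> x y; rewrite (row_sum_delta x) (row_sum_delta y).
rewrite sl !mulmx_suml.
under [X in _ = cbil mu X _ + _]eq_bigr do rewrite -scalemxAl.
rewrite !sl -big_split; apply: eq_bigr => i _ /=.
rewrite -scalemxAl -scalerDr !sr !mulmx_suml; congr (_ *: _).
under [X in _ = _ + cbil mu _ X]eq_bigr do rewrite -scalemxAl.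
rewrite sr -big_split; apply: eq_bigr => j _ /=.
rewrite -scalemxAl -scalerDr; congr (_ *: _).
by rewrite !dE !cbil_map -!map_mxM !cbil_map dA map_mxD.
Qed.

(** By the Leibniz rule, A - (l + v) applied to a product is the sum of the products with (A - l) x
    and with (A - v) y. Each application lowers one of the two exponents, so a + b of them
    suffice. *)
Lemma cbil_geigen (A : 'M[R]_n) (l v : C) :
  (forall x y, mu x y *m A = mu (x *m A) y + mu x (y *m A)) ->
  forall N a b x y, (a + b <= N)%N -> x *m (mC A - l%:M) ^+ a = 0 -> y *m (mC A - v%:M) ^+ b = 0 ->
  cbil mu x y *m (mC A - (l + v)%:M) ^+ N = 0.
Proof.
move=> /cbil_deriv dA.
have c0l z : cbil mu 0 z = 0 by have := cbil_l z (-1) 0 0; rewrite scaler0 addr0 scaleN1r addNr.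
have c0r z : cbil mu z 0 = 0 by have := cbil_r z (-1) 0 0; rewrite scaler0 addr0 scaleN1r addNr.
elim=> [|N IH] [|a] [|b] x y //= ab; rewrite ?expr0 ?mulmx1.
- by move=> -> _; rewrite c0l.
- by move=> -> _; rewrite c0l mul0mx.
- by move=> -> _; rewrite c0l mul0mx.
- by move=> _ ->; rewrite c0r mul0mx.
move=> xa yb; rewrite exprS -mulmxE mulmxA.
have -> : cbil mu x y *m (mC A - (l + v)%:M) =
  cbil mu (x *m (mC A - l%:M)) y + cbil mu x (y *m (mC A - v%:M)).
  rewrite !mulmxBr !mul_mx_scalar dA.
  have -> : cbil mu (x *m mC A - l *: x) y = cbil mu (x *m mC A) y - l *: cbil mu x y.
    by rewrite addrC -scaleNr cbil_l scaleNr addrC.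
  have -> : cbil mu x (y *m mC A - v *: y) = cbil mu x (y *m mC A) - v *: cbil mu x y.
    by rewrite addrC -scaleNr cbil_r scaleNr addrC.
  by rewrite scalerDl opprD addrACA.
have ab1 : (a + b.+1 <= N)%N by move: ab; rewrite addSn ltnS.
have ab2 : (a.+1 + b <= N)%N by move: ab; rewrite addnS ltnS.
rewrite mulmxDl (IH _ _ _ _ ab1) ?(IH _ _ _ _ ab2) ?addr0 //.
all: by rewrite -mulmxA mulmxE -exprS.
Qed.
End Cbil.

(** [B] is a real polynomial in [A] acting as Re a on the generalized eigenspace of a. Eigenvalues
    add under products when [A] is a derivation, and Re is additive, so [B] is a derivation as
    well. *)
Theorem hyperbolic_matrix (A : 'M[R]_n) : exists B : 'M[R]_n,
  [/\ A *m B = B *m A,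
      diagonalizable B,
      \tr B = \tr A /\ \tr (B *m A) = \tr (B *m B),
      (\tr (B *m A) = 0 -> \tr (A *m A) = 0 -> A ^+ n = 0) &
      forall mu : 'rV[R]_n -> 'rV[R]_n -> 'rV[R]_n,
        (forall y, linear (fun x => mu x y)) -> (forall x, linear (mu x)) ->
        (forall x y, mu x y *m A = mu (x *m A) y + mu x (y *m A)) ->
        (forall x y, mu x y *m B = mu (x *m B) y + mu x (y *m B))].
Proof.
have [u [trA chA]] := complex_trigonal (mC A).
pose T := [seq u i | i <- enum 'I_n].
(* Products of generalized eigenvectors belong to sums of eigenvalues. Interpolating at these too
   avoids asking whether such a sum is an eigenvalue. *)
pose T2 := T ++ [seq a + b | a <- T, b <- T].
pose S := undup (T2 ++ map (@conjc R) T2).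
have uS : uniq S by apply: undup_uniq.
have cS a : a \in S -> conjc a \in S.
  rewrite !mem_undup ![_ \in T2 ++ _]mem_cat => /orP[aT|/mapP[b bT ->]].
    by rewrite (map_f (@conjc R) aT) orbT.
  by rewrite conjcK bT.
have uT i : u i \in T by apply: map_f; rewrite mem_enum.
have TS a : a \in T -> a \in S by move=> aT; rewrite mem_undup !mem_cat aT.
have TTS a b : a \in T -> b \in T -> a + b \in S.
  by move=> aT bT; rewrite mem_undup !mem_cat allpairs_f ?orbT.
(* Generalized eigenvectors have order at most n, hence their products order at most 2n. *)
pose M := (n + n)%N.
have [P PP] := real_part_polynomial M uS cS.
pose PC := map_poly toC P.
have BC : mC (horner_mx A P) = horner_mx (mC A) PC by rewrite map_horner_mx.
have Pu i : PC.[u i] = toC (complex.Re (u i)).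
  by apply: (@dvdp_horner_root _ _ _ _ M); rewrite ?addn_gt0 // PP // TS.
have trR (q : {poly R}) : toC (\tr (horner_mx A q)) = \sum_i (map_poly toC q).[u i].
  by rewrite -trA -map_horner_mx trace_map_mx.
have RtrR (q : {poly R}) : \tr (horner_mx A q) = \sum_i complex.Re (map_poly toC q).[u i].
  by rewrite -(raddf_sum (@complex.Re R : Rcomplex R -> R)) -trR.
have trAE : \tr A = \sum_i complex.Re (u i).
  by rewrite -{1}(horner_mx_X A) RtrR; apply: eq_bigr => i _; rewrite map_polyX hornerX.
have trB : \tr (horner_mx A P) = \sum_i complex.Re (u i).
  by rewrite RtrR; apply: eq_bigr => i _; rewrite -/PC Pu.
have trBA : \tr (horner_mx A P *m A) = \sum_i complex.Re (u i) ^+ 2.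
  rewrite -{2}(horner_mx_X A) mulmxE -rmorphM RtrR; apply: eq_bigr => i _ /=.
  rewrite rmorphM /= map_polyX hornerM hornerX -/PC Pu.
  by case: (u i) => x y /=; rewrite mul0r subr0 expr2.
have trBB : \tr (horner_mx A P *m horner_mx A P) = \sum_i complex.Re (u i) ^+ 2.
  rewrite mulmxE -rmorphM RtrR; apply: eq_bigr => i _ /=.
  by rewrite rmorphM /= hornerM -/PC Pu /= mul0r subr0 expr2.
have trAA : \tr (A *m A) = \sum_i (complex.Re (u i) ^+ 2 - complex.Im (u i) ^+ 2).
  rewrite -{1 2}(horner_mx_X A) mulmxE -rmorphM RtrR; apply: eq_bigr => i _ /=.
  rewrite rmorphM /= map_polyX hornerM hornerX.
  by case: (u i) => x y /=; rewrite !expr2.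
have comAB : A *m horner_mx A P = horner_mx A P *m A by apply/comm_mx_horner/comm_mx_refl.
pose T1 := undup T; have uT1 : uniq T1 by apply: undup_uniq.
have T1T i : (i < size T1)%N -> T1`_i \in T by move=> iT; rewrite -mem_undup mem_nth.
have dec (x : 'rV[C]_n) : exists w : 'I_(size T1) -> 'rV[C]_n,
    x = \sum_i w i /\ forall i, w i *m (mC A - (T1`_i)%:M) ^+ n = 0.
  have cp : {in predT &, forall i j : 'I_(size T1), j != i ->
      coprimep (('X - (T1`_i)%:P) ^+ n) (('X - (T1`_j)%:P) ^+ n)}.
    move=> i j _ _ ij; rewrite coprimep_expl // coprimep_expr // coprimep_XsubC root_XsubC.
    by rewrite nth_uniq.
  have K1 := kermxpoly_prod (mC A) cp.
  have : (x <= \sum_(i < size T1) kermxpoly (mC A) (('X - (T1`_i)%:P) ^+ n))%MS.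
    rewrite -K1 kermxpoly_min ?submx1 //; apply/mxminpoly_minP.
    have /dvdpP[q ->] : \prod_i ('X - (u i)%:P) %| \prod_(i < size T1) ('X - (T1`_i)%:P) ^+ n.
      rewrite prodrXl -[X in (_ %| _ ^+ X)]card_ord -prodr_const.
      elim/big_rec2: _ => [|i p q _ pq]; first exact: dvdpp.
      apply: dvdp_mul => //; have uiS : u i \in T1 by rewrite mem_undup.
      have idx : (index (u i) T1 < size T1)%N by rewrite index_mem.
      by rewrite (bigD1 (Ordinal idx)) //= nth_index // dvdp_mulr.
    by rewrite rmorphM /= chA mulr0.
  case/sub_sumsmxP => v ->; exists (fun i => v i *m kermxpoly (mC A) (('X - (T1`_i)%:P) ^+ n)).
  split=> // i; rewrite -mulmxA -[kermxpoly _ _]/(geigenspace (mC A) T1`_i).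
  by rewrite geigenspaceE mulmx_ker mulmx0.
have BE a x N : a \in S -> (N <= M)%N -> x *m (mC A - a%:M) ^+ N = 0 ->
    x *m mC (horner_mx A P) = toC (complex.Re a) *: x :> 'rV[C]_n.
  move=> aS NM xa; have /dvdpP[q qE] := PP _ aS.
  rewrite BC -(subrK (toC (complex.Re a))%:P PC) qE mulrC rmorphD rmorphM rmorphXn rmorphB /=.
  rewrite horner_mx_X !horner_mx_C mulmxDr mul_mx_scalar -(subnK NM) addnC exprD -!mulmxE.
  by rewrite !mulmxA xa !mul0mx add0r.
have BT i w : w *m (mC A - (T1`_i)%:M) ^+ n = 0 -> (i < size T1)%N ->
    w *m mC (horner_mx A P) = toC (complex.Re T1`_i) *: w :> 'rV[C]_n.
  by move=> wn iT; apply: (BE _ _ n) => //; rewrite ?leq_addr // TS // T1T.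
exists (horner_mx A P); split=> //.
- apply/diagonalizableP; exists (undup (map (@complex.Re R) T1)); first exact: undup_uniq.
  apply/mxminpoly_minP; set W := \prod_(r <- _) _.
  have hE (g : 'M[C]_n) (v : 'rV[C]_n) a p : v *m g = a *: v -> v *m horner_mx g p = p.[a] *: v.
    move=> vg; elim/poly_ind: p => [|p c IH]; first by rewrite rmorph0 mulmx0 horner0 scale0r.
    rewrite rmorphD rmorphM /= horner_mx_X horner_mx_C mulmxDr mul_mx_scalar -mulmxE mulmxA IH.
    by rewrite -scalemxAl vg scalerA -scalerDl !hornerE.
  have mC0 : mC (horner_mx (horner_mx A P) W) = 0.
    apply/row_matrixP => i; rewrite row0 rowE; have [w [-> ww]] := dec (delta_mx 0 i).
    rewrite mulmx_suml big1 // => j _; rewrite map_horner_mx (hE _ _ _ _ (BT _ _ (ww j) (ltn_ord j))).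
    rewrite horner_map (_ : W.[_] = 0) ?rmorph0 ?scale0r //.
    apply/eqP; rewrite -[_ == 0]/(root W _) root_prod_XsubC mem_undup map_f // mem_nth //.
  by apply: (@map_mx_inj _ _ toC); rewrite mC0 raddf0.
- by rewrite trB trAE trBA trBB.
(* The first trace is the sum of the squared real parts, the second then minus that of the squared
   imaginary parts. All eigenvalues vanish, and Cayley-Hamilton gives nilpotency. *)
- rewrite trBA trAA => /eqP; rewrite psumr_eq0 => [/allP re0|i _]; last exact: sqr_ge0.
  have re i : complex.Re (u i) = 0.
    by have /implyP/(_ isT) := re0 i (mem_index_enum i); rewrite sqrf_eq0 => /eqP.
  move=> /eqP; under eq_bigr do rewrite re expr0n sub0r.
  rewrite sumrN oppr_eq0 psumr_eq0 => [/allP im0|i _]; last exact: sqr_ge0.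
  have u0 i : u i = 0.
    have /implyP/(_ isT) := im0 i (mem_index_enum i); rewrite sqrf_eq0 => /eqP im.
    by apply/eqP; rewrite eq_complex re im /= !eqxx.
  apply: (@map_mx_inj _ _ toC); rewrite raddf0 /= -[RHS]chA.
  under eq_bigr do rewrite u0 subr0.
  by rewrite prodr_const card_ord !rmorphXn /= horner_mx_X.
move=> mu mul mur dA x y.
suff H (x' y' : 'rV[C]_n) : cbil mu x' y' *m mC (horner_mx A P) =
   cbil mu (x' *m mC (horner_mx A P)) y' + cbil mu x' (y' *m mC (horner_mx A P)).
  apply: (@map_mx_inj _ _ toC); rewrite map_mxM map_mxD -!(cbil_map mul mur) H.
  by rewrite !map_mxM.
have c0l z : cbil mu 0 z = 0 by have := cbil_l mu z (-1) 0 0; rewrite scaler0 addr0 scaleN1r addNr.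
have c0r z : cbil mu z 0 = 0 by have := cbil_r mu z (-1) 0 0; rewrite scaler0 addr0 scaleN1r addNr.
have [v [-> vv]] := dec x'; have [w [-> ww]] := dec y'.
have sl m (c : 'I_m -> 'rV[C]_n) z : cbil mu (\sum_i c i) z = \sum_i cbil mu (c i) z.
  elim/big_rec2: _ => [|i a b _ <-]; first exact: c0l.
  by have := cbil_l mu z 1 (c i) b; rewrite !scale1r.
have sr m (c : 'I_m -> 'rV[C]_n) z : cbil mu z (\sum_i c i) = \sum_i cbil mu z (c i).
  elim/big_rec2: _ => [|i a b _ <-]; first exact: c0r.
  by have := cbil_r mu z 1 (c i) b; rewrite !scale1r.
rewrite [(\sum_i v i) *m _]mulmx_suml !sl mulmx_suml -big_split; apply: eq_bigr => i _ /=.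
rewrite [(\sum_i w i) *m _]mulmx_suml !sr mulmx_suml -big_split; apply: eq_bigr => j _ /=.
rewrite (BT _ _ (vv i)) // (BT _ _ (ww j)) //.
have := cbil_l mu (w j) (toC (complex.Re T1`_i)) (v i) 0; rewrite addr0 c0l addr0 => ->.
have := cbil_r mu (v i) (toC (complex.Re T1`_j)) (w j) 0; rewrite addr0 c0r addr0 => ->.
rewrite -scalerDl -rmorphD -raddfD.
apply: (BE _ _ M) => //; first by apply: TTS; apply: T1T.
exact: (cbil_geigen mul mur dA (leqnn _) (vv i) (ww j)).
Qed.
End HyperbolicMatrix.

(** Includes dimension zero, where matrices form no nontrivial ring; nilpotency is therefore phrased
    with iterates instead of powers. *)
Lemma hyperbolic_matrix_eigenbasis (R : rcfType) n (A : 'M[R]_n) : exists B : 'M[R]_n,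
  [/\ A *m B = B *m A,
      (exists P d, P \in unitmx /\ P *m B = diag_mx d *m P),
      \tr B = \tr A /\ \tr (B *m A) = \tr (B *m B),
      (\tr (B *m A) = 0 -> \tr (A *m A) = 0 ->
        forall x : 'rV_n, iter n (mulmxr A) x = 0) &
      forall mu : 'rV[R]_n -> 'rV[R]_n -> 'rV[R]_n,
        (forall y, linear (fun x => mu x y)) -> (forall x, linear (mu x)) ->
        (forall x y, mu x y *m A = mu (x *m A) y + mu x (y *m A)) ->
        (forall x y, mu x y *m B = mu (x *m B) y + mu x (y *m B))].
Proof.
case: n A => [|n] A.
  exists 0; split.
  - by apply/matrixP => -[].
  - by exists 1%:M, 0; rewrite unitmx1; split=> //; apply/matrixP => -[].
  - by rewrite /mxtrace !big_ord0.
  - by move=> _ _ x; rewrite thinmx0.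
  - by move=> mu _ _ _ x y; rewrite [LHS]thinmx0 [RHS]thinmx0.
have [B [cAB [P Pu /diagonalizable_forPex[d Pd]] trB nil der]] := hyperbolic_matrix A.
exists B; split=> //; first by exists P, d; split=> //; apply/(simmxP Pu).
move=> t1 t2 x; have Ap m : iter m (mulmxr A) x = x *m A ^+ m.
  by elim: m => [|m IH]; rewrite ?expr0 ?mulmx1 // iterS IH exprSr -mulmxE mulmxA.
by rewrite Ap nil // mulmx0.
Qed.

Import passmx.

(** [G] is the real diagonalizable summand in the decomposition of [T] into commuting hyperbolic,
    elliptic and nilpotent parts, with eigenbasis [b] and eigenvalues [r]. *)
Theorem hyperbolic_part (R : realType) (V : vectType R) (T : 'End(V)) :
  exists (G : 'End(V)) (b : (\dim {:V}).-tuple V) (r : 'I_(\dim {:V}) -> R),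
  [/\ (T \o G = G \o T)%VF,
      basis_of {:V} b /\ (forall i : 'I_(\dim {:V}), G b`_i = r i *: b`_i),
      lftrace G = lftrace T /\ lftrace (G \o T)%VF = lftrace (G \o G)%VF,
      (lftrace (G \o T)%VF = 0 -> lftrace (T \o T)%VF = 0 ->
         exists N, forall x, iter N T x = 0) &
      forall mu, bilin mu -> derivation mu T -> derivation mu G].
Proof.
pose e := vbasis {:V}; have eB : basis_of {:V} e by apply: vbasisP.
have trM (X : 'End(V)) : lftrace X = \tr (mxof e e X).
  by apply: eq_bigr => i _; rewrite !mxE /= vecof_delta.
(* Matrices act on row vectors, so composition is reversed. *)
have MM X Y : mxof e e (X \o Y)%VF = mxof e e Y *m mxof e e X.
  apply/row_matrixP => i; rewrite !rowE mulmxA !mul_mxof // rVofK //.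
  by rewrite comp_lfunE.
have [B [cB [P [d [Pu Pd]]] [t1 t2] nil der]] := hyperbolic_matrix_eigenbasis (mxof e e T).
pose G := hommx e e B.
have GB : mxof e e G = B by apply: hommxK.
exists G, [tuple vecof e (row i P) | i < \dim {:V}], (fun i => d 0 i); split.
- by apply: (can_inj (mxofK eB eB)); rewrite !MM GB cB.
- have nthE (i : 'I_(\dim {:V})) : [tuple vecof e (row i0 P) | i0 < \dim {:V}]`_i = vecof e (row i P).
    by rewrite -tnth_nth tnth_mktuple.
  split.
    rewrite basisEfree size_tuple leqnn subvf !andbT.
    apply/freeP => c cb i; have : \row_i c i *m P = 0.
      apply: (can_inj (vecofK eB)); rewrite linear0 -[RHS]cb mulmx_sum_row linear_sum.
      by apply: eq_bigr => j _; rewrite linearZ /= mxE nthE.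
    move/(congr1 (mulmxr (invmx P))); rewrite /= mulmxK // mul0mx => /rowP/(_ i).
    by rewrite !mxE.
  move=> i; rewrite nthE (hom_vecof e eB) GB -row_mul Pd.
  by rewrite row_mul row_diag_mx -scalemxAl -rowE linearZ.
- by rewrite !trM !MM GB t1 cB t2.
- rewrite !trM !MM GB cB => h1 h2; exists (\dim {:V}) => x.
  apply: (can_inj (rVofK eB)); rewrite linear0 -(nil h1 h2 (rVof e x)).
  have it m : rVof e (iter m T x) = iter m (mulmxr (mxof e e T)) (rVof e x).
    by elim: m => //= m IH; rewrite -IH (rVof_app e eB).
  exact: it.
move=> mu muB dT x y.
pose mu' u v := rVof e (mu (vecof e u) (vecof e v)).
have := der mu'.
move=> /(_ _ _ _ (rVof e x) (rVof e y)) => D.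
apply: (can_inj (rVofK eB)); rewrite linearD /= !(rVof_app e eB) GB.
have := D; rewrite /mu' !rVofK // -GB -!(rVof_app e eB) // !rVofK //; apply.
- by move=> z a u v; rewrite !linearP /= (bilin_l muB) !linearP.
- by move=> z a u v; rewrite !linearP /= (bilin_r muB) !linearP.
- by move=> u v; rewrite -!(rVof_app e eB) // dT linearD -!(hom_vecof e eB).
Qed.

(** * Optimal filtrations of an algebra *)

Section Existence.
Variables (R : realType) (d : nat).
Implicit Types (S : {set 'I_d * 'I_d * 'I_d}) (f : 'I_d -> R).

(** Up to a constant, the squared distance from [f] to the vector (1,...,1); its minimizer on a
    closed convex cone is a nearest-point projection. *)
Definition cost f : R := \sum_i f i ^+ 2 - 2 * \sum_i f i.

(** [S] stands for the index triples of the nonzero structure constants in a given basis. *)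
Definition in_cone S f := forall i j k, (i, j, k) \in S -> f i + f j <= f k.

Lemma cost_le0_bound f i : cost f <= 0 -> `|f i| <= d%:R + 1.
Proof.
move=> f0.
have cE : cost f = \sum_i ((f i - 1) ^+ 2) - d%:R.
  rewrite /cost mulr_sumr -[in d%:R](card_ord d) -sumr_const -!sumrB.
  by apply: eq_bigr => j _; ring.
have : (f i - 1) ^+ 2 <= d%:R.
  move: f0; rewrite cE subr_le0 => /(le_trans _) -> //.
  by rewrite (bigD1 i) //= lerDl sumr_ge0 // => j _; apply: sqr_ge0.
have d1 : 1 <= d%:R :> R by rewrite ler1n (leq_ltn_trans _ (ltn_ord i)).
move=> h; have : `|f i - 1| <= d%:R.
  rewrite -ler_sqr ?nnegrE ?normr_ge0 ?ler0n // real_normK ?num_real //.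
  by apply: (le_trans h); rewrite expr2 ler_peMl // (le_trans _ d1).
move=> h2; rewrite -[f i](subrK 1) (le_trans (ler_normD _ _)) // normr1 lerD //.
Qed.

(** The zero weight has cost 0, so only weights of nonpositive cost compete, and these form a
    compact set. *)
Lemma cone_min S : exists f, in_cone S f /\ forall f', in_cone S f' -> cost f <= cost f'.
Proof.
pose K : set 'rV[R]_d := [set x | in_cone S (x 0) /\ cost (x 0) <= 0]%classic.
have K0 : (K !=set0)%classic.
  exists 0; split=> [i j k _|]; first by rewrite !mxE addr0.
  by rewrite /cost !big1 ?mulr0 ?subr0 // => i _; rewrite mxE ?expr0n.
have cf i : continuous (fun x : 'rV[R]_d => x 0 i) by move=> x; apply: coord_continuous.
have cs (g : 'I_d -> 'rV[R]_d -> R) : (forall i, continuous (g i)) ->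
    continuous (fun x => \sum_i g i x).
  move=> cg; elim: (index_enum _) => [|i r IH] x.
    have -> : (fun y : 'rV[R]_d => \sum_(i <- [::]) g i y) = (fun=> 0).
      by apply/funext => y; rewrite big_nil.
    exact: cst_continuous.
  have -> : (fun y : 'rV[R]_d => \sum_(j <- i :: r) g j y) =
            (g i \+ (fun y => \sum_(j <- r) g j y)).
    by apply/funext => y; rewrite big_cons.
  by apply: continuousD; [apply: cg | apply: IH].
have cJ : continuous (fun x : 'rV[R]_d => cost (x 0)).
  have c1 : continuous (fun x : 'rV[R]_d => \sum_i x 0 i ^+ 2).
    by apply: (cs (fun i y => y 0 i ^+ 2)) => i y; apply: (continuousM (cf i y) (cf i y)).
  have c2 : continuous (fun x : 'rV[R]_d => \sum_i x 0 i).
    by apply: (cs (fun i y => y 0 i)) => i; apply: cf.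
  by move=> x; apply: (continuousB (c1 x) (continuousM (@cst_continuous _ _ (2 : R) x) (c2 x))).
have cK : compact K.
  apply: bounded_closed_compact.
    exists (d%:R + 1); split; first exact: num_real.
    move=> M dM x [_ x0]; apply: le_trans (ltW dM).
    have [->|xn0] := eqVneq x 0; first by rewrite normr0 addr_ge0 ?ler0n.
    have /mx_norm_neq0[[i j] xE] : mx_norm x != 0 by rewrite -[mx_norm x]/(`|x|) normr_eq0.
    by rewrite -[`|x|]/(mx_norm x) xE /= (ord1 i) cost_le0_bound.
  have -> : K = ((\bigcap_(t in [set t | t \in S])
      [set x : 'rV[R]_d | x 0 t.1.1 + x 0 t.1.2 - x 0 t.2 <= 0])
      `&` [set x | cost (x 0%R) <= 0])%classic.
    apply/seteqP; split=> x [xC x0]; split=> //.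
      by move=> [[i j] k] /= ijk; rewrite subr_le0; apply: xC.
    by move=> i j k ijk; rewrite -subr_le0; apply: (xC (i, j, k)).
  apply: closedI.
    apply: closed_bigI => t _; apply: (preimage_closed _ (@closed_le _ 0)) => x _.
    by apply: (continuousB (continuousD (cf _ x) (cf _ x)) (cf _ x)).
  by apply: (preimage_closed _ (@closed_le _ 0)) => x _; apply: cJ.
have [x /set_mem[xC x0] xm] := EVT_min_rV K0 cK (continuous_subspaceT cJ).
exists (x 0); split=> // f' f'C.
have [f'0|/ltW f'0] := leP (cost f') 0; last exact: le_trans x0 f'0.
have fE : (\row_i f' i) 0 = f' by apply/funext => i; rewrite mxE.
by have := xm (\row_i f' i); rewrite fE; apply; apply: mem_set; rewrite /K /= fE.
Qed.

End Existence.

(** Ordering by decreasing weight and breaking ties refines the filtration to a full flag. *)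
Lemma rank_exists (R : realType) d (f : 'I_d -> R) : exists rho : 'I_d -> nat,
  injective rho /\ forall i j, (rho i < rho j)%N -> f j <= f i.
Proof.
pose r i j := f j <= f i; pose s := sort r (enum 'I_d).
have ms i : i \in s by rewrite mem_sort mem_enum.
exists (fun i => index i s); split=> [i j ij|i j ij].
  by rewrite -(nth_index i (ms i)) ij nth_index.
have rt : transitive r by move=> y x z xy yz; apply: le_trans yz xy.
have ss : sorted r s by apply: sort_sorted => x y; rewrite /r le_total.
exact: (sorted_ltn_index rt ss i j (ms i) (ms j) ij).
Qed.

Section Filtrations.
Variables (R : realType) (W : vectType R).
Local Notation d := (\dim {:W}).
Implicit Types (a b c : d.-tuple W) (f g : 'I_d -> R) (x y : W).

(** Membership in the step [t] of the decreasing filtration determined by the weighted basis. *)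
Definition filt b f t x := forall i, coord b i x != 0 -> t <= f i.

Lemma filtD b f t x y : filt b f t x -> filt b f t y -> filt b f t (x + y).
Proof.
move=> fx fy i; rewrite linearD /= => h.
have [x0|/fx//] := eqVneq (coord b i x) 0.
by apply: fy; apply: contraNneq h => ->; rewrite x0 addr0.
Qed.
Lemma filtZ b f t r x : filt b f t x -> filt b f t (r *: x).
Proof.
move=> fx i; rewrite linearZ /= => h; apply: fx.
by apply: contraNneq h => ->; rewrite mulr0.
Qed.
Lemma filt_sum b f t I (r : seq I) (P : pred I) (F : I -> W) :
  (forall i, P i -> filt b f t (F i)) -> filt b f t (\sum_(i <- r | P i) F i).
Proof.
move=> FP; elim/big_rec: _ => [i|i x Pi fx]; first by rewrite linear0 eqxx.
exact: filtD (FP _ Pi) fx.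
Qed.
Lemma filt_le b f s t x : s <= t -> filt b f t x -> filt b f s x.
Proof. by move=> st fx i /fx; apply: le_trans. Qed.

Lemma coord_nth b (i j : 'I_d) : basis_of {:W} b -> coord b i b`_j = (i == j)%:R.
Proof. by move=> /basis_free fb; rewrite coord_free // eq_sym. Qed.
Lemma filt_nth b f (i : 'I_d) : basis_of {:W} b -> filt b f (f i) b`_i.
Proof. by move=> bb j; rewrite coord_nth //; have [->|_] := eqVneq j i; rewrite ?eqxx. Qed.

Section Lead.
Variable rho : 'I_d -> nat.
Hypothesis rhoI : injective rho.

(** [k] is the position of [x] in the full flag of [b]: the basis vector of highest rank that occurs
    in [x], hence one of least weight. *)
Definition lead b x k := coord b k x != 0 /\ forall j, (rho k < rho j)%N -> coord b j x = 0.

Lemma lead_exists b x : basis_of {:W} b -> x != 0 -> exists k, lead b x k.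
Proof.
move=> bb x0.
have [i0 i0P] : exists i, coord b i x != 0.
  apply/existsP; apply: contraNT x0; rewrite negb_exists => /forallP x0.
  rewrite (coord_basis bb (memvf x)) big1 // => i _.
  by have := x0 i; rewrite negbK => /eqP ->; rewrite scale0r.
case: (arg_maxnP (P := fun i => coord b i x != 0) rho i0P) => k kP km; exists k; split=> // j kj.
by apply/eqP; apply: contraTT kj => /km; rewrite -leqNgt.
Qed.

Lemma lead_le b (f : 'I_d -> R) x k : (forall i j, (rho i < rho j)%N -> f j <= f i) ->
  lead b x k -> filt b f (f k) x.
Proof.
move=> fr [xk xj] i; apply: contraNT; rewrite -ltNge => fik; apply/eqP/xj.
case: (ltngtP (rho k) (rho i)) => // [/fr|/rhoI ki]; first by rewrite leNgt fik.
by rewrite ki ltxx in fik.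
Qed.

Lemma lead_basis b c (tau : 'I_d -> 'I_d) : basis_of {:W} b -> injective tau ->
  (forall i : 'I_d, lead b c`_i (tau i)) -> basis_of {:W} c.
Proof.
move=> bb tauI cl; rewrite basisEfree size_tuple leqnn subvf !andbT.
apply/freeP => k ck i; apply/eqP; apply/contraT => ki.
case: (arg_maxnP (P := fun i => k i != 0) (fun i => rho (tau i)) ki) => m km mm.
have := congr1 (coord b (tau m)) ck; rewrite linear_sum linear0 (bigD1 m) //= big1 => [|j jm].
  by rewrite linearZ addr0 => /eqP; rewrite mulf_eq0 (negbTE km) /= (negbTE (cl m).1).
rewrite linearZ /=; have [->|kj] := eqVneq (k j) 0; first by rewrite mul0r.
have le_jm : (rho (tau j) <= rho (tau m))%N by apply: mm.
rewrite (cl j).2 ?mulr0 // ltn_neqAle le_jm andbT.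
by apply: contraNneq jm => /rhoI/tauI ->.
Qed.

(** Up to the permutation [tau], the change of basis from [b] to [c] is triangular for the rank
    order, so both weighted bases define one filtration. *)
Lemma lead_filt b c f (tau : 'I_d -> 'I_d) t x : basis_of {:W} b -> injective tau ->
  (forall i j, (rho i < rho j)%N -> f j <= f i) ->
  (forall i : 'I_d, lead b c`_i (tau i)) -> filt b f t x <-> filt c (fun i => f (tau i)) t x.
Proof.
move=> bb tauI fr cl; have bc := lead_basis bb tauI cl.
have xE := coord_basis bc (memvf x); split=> fx; last first.
  rewrite xE; apply: filt_sum => i _.
  have [->|/fx ti] := eqVneq (coord c i x) 0; first by move=> j; rewrite scale0r linear0 eqxx.
  exact/filtZ/(filt_le ti)/lead_le.
move=> i ci; rewrite leNgt; apply/negP => fit.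
(* Among the offending indices the one of highest rank has a leading term that nothing can cancel:
   lower ranks do not reach it, and higher ranks would offend too. *)
pose Pr i := (coord c i x != 0) && (f (tau i) < t).
have Pi : Pr i by rewrite /Pr ci.
case: (arg_maxnP (P := Pr) (fun i => rho (tau i)) Pi) => m /andP[km fm] mm.
suff h : coord b (tau m) x != 0 by have := fx _ h; rewrite leNgt fm.
rewrite xE linear_sum (bigD1 m) //= big1 ?addr0 => [|j jm].
  by rewrite linearZ mulf_neq0 // (cl m).1.
rewrite linearZ /=; have [->|kj] := eqVneq (coord c j x) 0; first by rewrite mul0r.
rewrite (cl j).2 ?mulr0 //; case: (ltngtP (rho (tau j)) (rho (tau m))) => //.
  move=> lt_mj; have ft : f (tau j) < t by apply: le_lt_trans (fr _ _ lt_mj) fm.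
  have le_jm : (rho (tau j) <= rho (tau m))%N by apply: mm; rewrite /Pr kj.
  by rewrite ltnNge le_jm in lt_mj.
by move/rhoI/tauI => jm'; rewrite jm' eqxx in jm.
Qed.

(* Bruhat decomposition: two full flags have a common adapted basis. *)
Lemma common_basis a b : basis_of {:W} a -> basis_of {:W} b ->
  exists c (sigma : 'I_d -> 'I_d),
  [/\ injective sigma, forall i : 'I_d, lead a c`_i i & forall i : 'I_d, lead b c`_i (sigma i)].
Proof.
move=> ba bb.
pose Pr i k := `[< exists x, lead a x i /\ lead b x k >].
have P0 i : exists k, Pr i k.
  have ai : lead a a`_i i.
    split; first by rewrite coord_nth // eqxx oner_eq0.
    by move=> j ij; rewrite coord_nth //; case: eqP ij => // ->; rewrite ltnn.
  have ai0 : a`_i != 0 by apply: contraNneq (ai.1) => ->; rewrite linear0.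
  by have [k bk] := lead_exists bb ai0; exists k; apply/asboolP; exists a`_i.
(* Among the vectors with leading index [i] for [a], one with the lowest possible leading rank for
   [b] is chosen; this minimality makes [sigma] injective. *)
have min i : exists k x, [/\ lead a x i, lead b x k &
    forall y k', lead a y i -> lead b y k' -> (rho k <= rho k')%N].
  have [k0 k0P] := P0 i; case: (arg_minnP (P := Pr i) rho k0P) => k /asboolP[x [ax bx]] km.
  by exists k, x; split=> // y k' ay bk; apply: km; apply/asboolP; exists y.
have /choice[sigma sP] := min; have /choice[x xP] := sP.
have nthE (i : 'I_d) : [tuple x i | i < d]`_i = x i by rewrite -tnth_nth tnth_mktuple.
exists [tuple x i | i < d], sigma; split=> [i j ij|i|i]; rewrite ?nthE; try by case: (xP i).
wlog lt : i j ij / (rho i < rho j)%N.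
  move=> W'; case: (ltngtP (rho i) (rho j)) => [/W'|/W' h|/rhoI//]; first exact.
  exact/esym/h.
have [ai bi mi] := xP i; have [aj bj mj] := xP j; rewrite -ij in bj mj.
(* If two leading indices for [b] agreed, eliminating the common leading coordinate would lower the
   rank for [b] while keeping the leading index [j] for [a]. *)
pose l := coord b (sigma i) (x j) / coord b (sigma i) (x i).
pose y := x j - l *: x i.
have ay : lead a y j.
  split; first by rewrite linearB linearZ /= (ai.2 _ lt) mulr0 subr0 aj.1.
  by move=> k jk; rewrite linearB linearZ /= (ai.2 _ (ltn_trans lt jk)) (aj.2 _ jk) mulr0 subr0.
have y0 : y != 0 by apply: contraNneq (ay.1) => ->; rewrite linear0.
have [k bk] := lead_exists bb y0; have := mj _ _ ay bk.
rewrite leq_eqVlt => /orP[/eqP/rhoI kE|lt2].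
  have := bk.1; rewrite -kE linearB linearZ /= /l divfK ?bi.1 // subrr eqxx //.
by have := bk.1; rewrite linearB linearZ /= (bi.2 _ lt2) (bj.2 _ lt2) mulr0 subr0 eqxx.
Qed.
End Lead.

Section Optimal.
Variable mu : W -> W -> W.
Hypothesis muB : bilin mu.

Definition admissible b f := basis_of {:W} b /\
  forall i j k : 'I_d, coord b k (mu b`_i b`_j) != 0 -> f i + f j <= f k.

Definition optimal b f := admissible b f /\ forall b' f', admissible b' f' -> cost f <= cost f'.

Lemma admissible_filt b f s t x y : admissible b f ->
  filt b f s x -> filt b f t y -> filt b f (s + t) (mu x y).
Proof.
move=> [bb ad] fx fy.
rewrite (coord_basis bb (memvf x)) (bilin_suml muB); apply: filt_sum => i _.
rewrite (bilinZl muB).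
have [->|/fx si] := eqVneq (coord b i x) 0; first by move=> j; rewrite scale0r linear0 eqxx.
apply: filtZ; rewrite (coord_basis bb (memvf y)) (bilin_sumr muB); apply: filt_sum => j _.
rewrite (bilinZr muB).
have [->|/fy tj] := eqVneq (coord b j y) 0; first by move=> k; rewrite scale0r linear0 eqxx.
by apply: filtZ => k /ad; apply: le_trans; apply: lerD.
Qed.

(** Bases are infinitely many, but a basis enters only through the support of its structure
    constants; the minimum is taken over these finitely many supports. *)
Lemma optimal_exists : exists b f, optimal b f.
Proof.
pose supp b := [set t : 'I_d * 'I_d * 'I_d | coord b t.2 (mu b`_t.1.1 b`_t.1.2) != 0].
pose F S := projT1 (cid (@cone_min R d S)).
have FP S : in_cone S (F S) /\ forall f', in_cone S f' -> cost (F S) <= cost f'.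
  exact: projT2 (cid (@cone_min R d S)).
pose Pr S := `[< exists b, basis_of {:W} b /\ supp b = S >].
have P0 : Pr (supp (vbasis {:W})) by apply/asboolP; exists (vbasis {:W}); rewrite vbasisP.
case: (@Order.TotalTheory.arg_minP _ _ _ _ Pr (fun S => cost (F S)) P0) => S /asboolP[b [bb bS]] Sm.
have [FS Fm] := FP S.
exists b, (F S); split; first by split=> // i j k h; apply: FS; rewrite -bS inE.
move=> b' f' [bb' ad']; apply: (@le_trans _ _ (cost (F (supp b')))).
  by apply: Sm; apply/asboolP; exists b'.
by apply: (FP _).2 => i j k; rewrite inE; apply: ad'.
Qed.

(* The mean of two optimal filtrations in a common adapted basis is admissible, and strict
   convexity of [cost] makes them equal. *)
Lemma optimal_aut b f (phi : 'End(W)) t x : optimal b f ->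
  lker phi = 0%VS -> (forall x y, phi (mu x y) = mu (phi x) (phi y)) ->
  filt b f t x -> filt b f t (phi x).
Proof.
move=> [[bb ad] op] kp pm.
have [rho [rhoI fr]] := rank_exists f.
pose b2 := [tuple of map phi b].
have nb2 (i : 'I_d) : b2`_i = phi b`_i by rewrite (nth_map 0) ?size_tuple.
have bb2 : basis_of {:W} b2.
  rewrite basisEfree size_tuple leqnn subvf !andbT.
  apply/freeP => k; under eq_bigr do rewrite nb2 -linearZ.
  rewrite -linear_sum => /eqP; rewrite -memv_ker kp memv0 => /eqP.
  by have /freeP := basis_free bb; apply.
have cb2 i y : coord b2 i (phi y) = coord b i y.
  rewrite {1}(coord_basis bb (memvf y)) linear_sum.
  under eq_bigr do rewrite linearZ /= -nb2.
  by rewrite coord_sum_free // (basis_free bb2).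
have ad2 : admissible b2 f.
  by split=> // i j k; rewrite !nb2 -pm cb2; apply: ad.
have [c [sigma [sI la lb]]] := common_basis rhoI bb bb2.
have bc := lead_basis rhoI bb (@inj_id _) la.
have F1 t' y : filt b f t' y <-> filt c f t' y := lead_filt rhoI t' y bb (@inj_id _) fr la.
have F2 t' y : filt b2 f t' y <-> filt c (fun i => f (sigma i)) t' y :=
  lead_filt rhoI t' y bb2 sI fr lb.
(* The midpoint of the weights of [b] and of its image [b2], both read in the common basis [c]. *)
pose g i := (f i + f (sigma i)) / 2.
have adg : admissible c g.
  split=> // i j k ck; rewrite /g.
  have h1 : f i + f j <= f k.
    apply: ((F1 _ _).1 (admissible_filt (conj bb ad) ((F1 _ _).2 _) ((F1 _ _).2 _))) ck;
      exact: filt_nth.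
  have h2 : f (sigma i) + f (sigma j) <= f (sigma k).
    apply: ((F2 _ _).1 (admissible_filt ad2 ((F2 _ _).2 _) ((F2 _ _).2 _))) ck;
      exact: (filt_nth (fun i => f (sigma i))).
  by lra.
have sB (h : 'I_d -> R) : \sum_i h (sigma i) = \sum_i h i.
  by rewrite [RHS](reindex_inj sI).
(* The parallelogram identity: [sigma] permutes the weights, so both endpoints have the same cost,
   and optimality forces [f] and its permutation to agree. *)
have cg : cost g = cost f - 4^-1 * \sum_i (f i - f (sigma i)) ^+ 2.
  have e1 : \sum_i g i = \sum_i f i.
    rewrite -[RHS](mulfK (_ : 2 != 0 :> R)) ?pnatr_eq0 // mulr_suml.
    by rewrite /g -mulr_suml big_split /= sB; congr (_ / _); rewrite -mulr_suml; ring.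
  have e2 : \sum_i g i ^+ 2 = 2^-1 * (\sum_i f i ^+ 2 + \sum_i f (sigma i) ^+ 2)
        - 4^-1 * \sum_i (f i - f (sigma i)) ^+ 2.
    rewrite !mulrDr !mulr_sumr -big_split -sumrB; apply: eq_bigr => i _ /=.
    by rewrite /g; field.
  by rewrite /cost e1 e2 (sB (fun i => f i ^+ 2)); field.
have fs i : f (sigma i) = f i.
  have : \sum_i (f i - f (sigma i)) ^+ 2 <= 0.
    by have := op _ _ adg; rewrite cg; lra.
  rewrite le_eqVlt ltNge sumr_ge0 ?orbF => [|j _]; last exact: sqr_ge0.
  rewrite psumr_eq0 => [/allP/(_ i (mem_index_enum i))/implyP/(_ isT)|j _]; last exact: sqr_ge0.
  by rewrite sqrf_eq0 subr_eq0 => /eqP ->.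
move=> fx; apply/F1 => i ci; rewrite -fs; move: i ci; apply/F2 => i.
by rewrite cb2; apply: fx.
Qed.
End Optimal.
End Filtrations.

(** * Exponentials of derivations *)

Lemma sum_triangle (Z : zmodType) (F : nat -> nat -> Z) n :
  \sum_(0 <= i < n) \sum_(0 <= j < n - i) F i j =
  \sum_(0 <= k < n) \sum_(0 <= i < k.+1) F i (k - i)%N.
Proof.
elim: n => [|n IH]; first by rewrite !big_geq.
rewrite [RHS]big_nat_recr //= -IH.
rewrite (@eq_big_nat _ _ _ 0 n.+1 _ (fun i => \sum_(0 <= j < n - i) F i j + F i (n - i)%N)).
  by rewrite big_split /= big_nat_recr //= subnn [X in _ + X + _]big_geq ?addr0.
by move=> i; rewrite ltnS => ile; rewrite subSn // big_nat_recr.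
Qed.

(** The pairs of the square that the truncated Cauchy product misses are those with i + j >= n. *)
Lemma sum_square (Z : zmodType) (F : nat -> nat -> Z) n :
  \sum_(0 <= i < n) \sum_(0 <= j < n) F i j - \sum_(0 <= k < n) \sum_(0 <= i < k.+1) F i (k - i)%N =
  \sum_(0 <= i < n) \sum_(n - i <= j < n) F i j.
Proof.
rewrite -sum_triangle -sumrB; apply: eq_bigr => i _.
by rewrite (big_cat_nat (n := n - i)) ?leq_subr //= addrAC subrr add0r.
Qed.

Lemma exp_coeffD (R : realType) (x y : R) k :
  exp_coeff (x + y) k = \sum_(0 <= i < k.+1) exp_coeff x i * exp_coeff y (k - i)%N.
Proof.
rewrite /exp_coeff /= addrC exprDn mulr_suml big_mkord; apply: eq_bigr => i _.
have ik : (i <= k)%N by rewrite -ltnS.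
have h m : (m`!%:R : R) != 0 by rewrite pnatr_eq0 -lt0n fact_gt0.
rewrite -(bin_fact ik) !natrM invfM invfM -mulr_natr.
have b0 : ('C(k, i)%:R : R) != 0 by rewrite pnatr_eq0 -lt0n bin_gt0.
by field; rewrite !h b0.
Qed.

Section ExpDerivation.
Variables (R : realType) (W : vectType R).
Local Notation e := (vbasis {:W}).
Implicit Types (x y : W).

Definition vnorm x : R := \sum_(i < \dim {:W}) `|coord e i x|.

Lemma vnorm_ge0 x : 0 <= vnorm x. Proof. exact: sumr_ge0. Qed.
Lemma vnorm0 : vnorm 0 = 0.
Proof. by rewrite /vnorm big1 // => i _; rewrite linear0 normr0. Qed.
Lemma vnormD x y : vnorm (x + y) <= vnorm x + vnorm y.
Proof. by rewrite -big_split; apply: ler_sum => i _; rewrite linearD ler_normD. Qed.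
Lemma vnormZ a x : vnorm (a *: x) = `|a| * vnorm x.
Proof. by rewrite mulr_sumr; apply: eq_bigr => i _; rewrite linearZ normrM. Qed.
Lemma vnorm_sum I (r : seq I) (P : pred I) (F : I -> W) :
  vnorm (\sum_(i <- r | P i) F i) <= \sum_(i <- r | P i) vnorm (F i).
Proof.
elim/big_rec2: _ => [|i u v _ h]; first by rewrite vnorm0.
exact: le_trans (vnormD _ _) (lerD _ h).
Qed.
Lemma vnorm_eq0 x : vnorm x = 0 -> x = 0.
Proof.
move=> /eqP; rewrite psumr_eq0 // => /allP h.
rewrite (coord_vbasis (memvf x)) big1 // => i _.
by have /implyP/(_ isT) := h i (mem_index_enum i); rewrite normr_eq0 => /eqP ->; rewrite scale0r.
Qed.

Lemma coord_le i x : `|coord e i x| <= vnorm x.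
Proof. by rewrite /vnorm (bigD1 i) //= lerDl sumr_ge0. Qed.

Lemma lfun_bound (U : vectType R) (N : U -> R) (f : W -> U) : linear f ->
  N 0 = 0 -> (forall u v, N (u + v) <= N u + N v) -> (forall a u, N (a *: u) = `|a| * N u) ->
  exists2 C, 0 <= C & forall x, N (f x) <= C * vnorm x.
Proof.
move=> fl N0 ND NZ.
have NN u : N (- u) = N u by rewrite -scaleN1r NZ normrN1 mul1r.
have Nge u : 0 <= N u.
  by have := ND u (- u); rewrite subrr N0 NN; lra.
exists (\sum_(i < \dim {:W}) N (f e`_i)); first exact: sumr_ge0.
move=> x; have fE : f x = \sum_(i < \dim {:W}) coord e i x *: f e`_i.
  rewrite -(linfun_linear fl) {1}(coord_vbasis (memvf x)) linear_sum.
  by apply: eq_bigr => i _; rewrite linearZ /= (linfun_linear fl).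
rewrite fE mulr_suml; apply: (@le_trans _ _ (\sum_(i < \dim {:W}) N (coord e i x *: f e`_i))).
  elim/big_rec2: _ => [|i u v _ h]; first by rewrite N0.
  exact: le_trans (ND _ _) (lerD _ h).
by apply: ler_sum => i _; rewrite NZ mulrC ler_wpM2l // coord_le.
Qed.

Variable (mu : W -> W -> W).
Hypothesis muB : bilin mu.

Lemma bilin_bound : exists2 K, 0 <= K & forall x y, vnorm (mu x y) <= K * vnorm x * vnorm y.
Proof.
have h i : exists C, 0 <= C /\ forall y, vnorm (mu e`_i y) <= C * vnorm y.
  have [C C0 CP] := lfun_bound (bilin_r muB e`_i) vnorm0 vnormD vnormZ.
  by exists C.
have /choice[C CP] := h.
exists (\sum_(i < \dim {:W}) C i); first by apply: sumr_ge0 => i _; case: (CP i).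
move=> x y; rewrite {1}(coord_vbasis (memvf x)) (bilin_suml muB) !mulr_suml.
apply: le_trans (vnorm_sum _ _ _) _; apply: ler_sum => i _.
rewrite (bilinZl muB) vnormZ mulrAC [C i * _ * _]mulrC.
apply: ler_pM => //; [exact: vnorm_ge0 | exact: coord_le | by case: (CP i)].
Qed.

Variable (psi : 'End(W)).
Hypothesis psiD : derivation mu psi.

(** The term psi^k x / k! of the exponential series. With the factorial built in, the Leibniz rule
    has no binomial coefficients. *)
Fixpoint pow_fact k x := if k is k'.+1 then k%:R^-1 *: psi (pow_fact k' x) else x.
Local Notation w := pow_fact.

Lemma pow_fact_linear k : linear (w k).
Proof. by elim: k => //= k IH a x y; rewrite IH linearP scalerDr scalerA mulrC -scalerA. Qed.

Lemma psi_pow_fact k x : psi (w k x) = k.+1%:R *: w k.+1 x.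
Proof. by rewrite /= scalerA divff ?scale1r // pnatr_eq0. Qed.

Lemma leibniz k x y : w k (mu x y) = \sum_(0 <= i < k.+1) mu (w i x) (w (k - i) y).
Proof.
elim: k => [|k IH]; first by rewrite big_nat1.
rewrite [LHS]/= IH linear_sum scaler_sumr.
apply: (scalerI (_ : k.+1%:R != 0 :> R)); first by rewrite pnatr_eq0.
rewrite -scaler_sumr scalerA divff ?pnatr_eq0 // scale1r.
transitivity (\sum_(0 <= i < k.+1) i.+1%:R *: mu (w i.+1 x) (w (k.+1 - i.+1) y) +
   \sum_(0 <= i < k.+1) (k.+1 - i)%:R *: mu (w i x) (w (k.+1 - i) y)).
  rewrite -big_split; apply: eq_big_nat => i /=; rewrite ltnS => ik.
  rewrite psiD !psi_pow_fact (bilinZl muB) (bilinZr muB) subSS.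
  by rewrite (subSn ik) scalerA mulVf ?pnatr_eq0 // scale1r.
rewrite [RHS]scaler_sumr.
(* Both sums are extended to a common range by a term of coefficient zero; the coefficients i and k
   + 1 - i then add up to k + 1. *)
transitivity (\sum_(0 <= i < k.+2) i%:R *: mu (w i x) (w (k.+1 - i) y) +
   \sum_(0 <= i < k.+2) (k.+1 - i)%:R *: mu (w i x) (w (k.+1 - i) y)).
  congr (_ + _); first by rewrite [RHS]big_nat_recl // scale0r add0r.
  by rewrite [RHS]big_nat_recr //= subnn scale0r addr0.
rewrite -big_split; apply: eq_big_nat => i /= ik.
by rewrite -scalerDl -natrD subnKC.
Qed.

Variable a : R.
Hypothesis a0 : 0 <= a.
Hypothesis aP : forall x, vnorm (psi x) <= a * vnorm x.

Lemma pow_fact_bound k x : vnorm (w k x) <= exp_coeff a k * vnorm x.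
Proof.
elim: k => [|k IH]; first by rewrite /exp_coeff /= expr0 fact0 divr1 mul1r.
rewrite /= vnormZ ger0_norm ?invr_ge0 ?ler0n //.
have -> : exp_coeff a k.+1 = k.+1%:R^-1 * (a * exp_coeff a k).
  by rewrite /exp_coeff /= factS natrM invfM exprS; ring.
rewrite -mulrA ler_wpM2l ?invr_ge0 ?ler0n //.
by apply: le_trans (aP _) _; rewrite -mulrA ler_wpM2l.
Qed.

Definition psum n x := \sum_(0 <= k < n) w k x.

Lemma psum_linear n : linear (psum n).
Proof.
move=> b x y; rewrite /psum scaler_sumr -big_split; apply: eq_bigr => k _.
by rewrite pow_fact_linear.
Qed.

Lemma psum_mul n x y : vnorm (mu (psum n x) (psum n y) - psum n (mu x y)) =
  vnorm (\sum_(0 <= i < n) \sum_(n - i <= j < n) mu (w i x) (w j y)).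
Proof.
rewrite -sum_square; congr (vnorm (_ - _)).
  rewrite (bilin_suml muB); apply: eq_bigr => i _; by rewrite (bilin_sumr muB).
by apply: eq_bigr => k _; rewrite leibniz.
Qed.

(** Termwise the failure of multiplicativity is dominated by that of the scalar exponential, whose
    partial sums make the bound tend to exp(a)^2 - exp(2a) = 0. *)
Lemma psum_mul_bound K x y n : 0 <= K ->
  (forall x y, vnorm (mu x y) <= K * vnorm x * vnorm y) ->
  vnorm (mu (psum n x) (psum n y) - psum n (mu x y)) <=
  K * vnorm x * vnorm y * (series (exp_coeff a) n ^+ 2 - series (exp_coeff (a + a)) n).
Proof.
move=> K0 KP; rewrite psum_mul.
have -> : series (exp_coeff a) n ^+ 2 - series (exp_coeff (a + a)) n =
   \sum_(0 <= i < n) \sum_(n - i <= j < n) exp_coeff a i * exp_coeff a j.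
  rewrite -sum_square; congr (_ - _).
    by rewrite /series /= expr2 mulr_suml; apply: eq_bigr => i _; rewrite mulr_sumr.
  by apply: eq_bigr => k _; rewrite exp_coeffD.
apply: le_trans (vnorm_sum _ _ _) _; rewrite mulr_sumr; apply: ler_sum => i _.
apply: le_trans (vnorm_sum _ _ _) _; rewrite mulr_sumr; apply: ler_sum => j _.
apply: le_trans (KP _ _) _.
have -> : K * vnorm x * vnorm y * (exp_coeff a i * exp_coeff a j) =
   K * (exp_coeff a i * vnorm x) * (exp_coeff a j * vnorm y) by ring.
apply: ler_pM; rewrite ?mulr_ge0 ?vnorm_ge0 ?pow_fact_bound //.
by rewrite ler_wpM2l ?pow_fact_bound.
Qed.

Lemma exp_coeff_shift m k : exp_coeff a (m + k) <= a ^+ m * exp_coeff a k.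
Proof.
rewrite /exp_coeff /= exprD -mulrA ler_wpM2l ?exprn_ge0 // ler_wpM2l ?exprn_ge0 //.
by rewrite lef_pV2 ?posrE ?ltr0n ?fact_gt0 // ler_nat leq_fact // leq_addl.
Qed.

Lemma series_exp_le n : series (exp_coeff a) n <= expR a.
Proof.
apply: nondecreasing_cvgn_le; last exact: is_cvg_series_exp_coeff.
by apply: nondecreasing_series => k _ _; apply: exp_coeff_ge0.
Qed.

Lemma psum_tail m n x : (m <= n)%N -> vnorm (psum n x - psum m x) <= a ^+ m * expR a * vnorm x.
Proof.
move=> mn; rewrite /psum (big_cat_nat (n := m)) //= addrAC subrr add0r.
apply: le_trans (vnorm_sum _ _ _) _.
have := series_exp_le (n - m); set S := series _ _ => Sn.
apply: (@le_trans _ _ (a ^+ m * S * vnorm x)); last first.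
  by rewrite ler_wpM2r ?vnorm_ge0 // ler_wpM2l ?exprn_ge0.
rewrite /S /series /= mulrAC mulr_sumr -{1}[m]add0n big_addn; apply: ler_sum => k _.
apply: le_trans (pow_fact_bound _ _) _.
by rewrite mulrAC ler_wpM2r ?vnorm_ge0 // addnC exp_coeff_shift.
Qed.

Local Open Scope classical_set_scope.

Definition vlim (u : nat -> W) y := forall i, coord e i (u n) @[n --> \oo] --> (coord e i y : R).

Lemma vlim_uniq u y z : vlim u y -> vlim u z -> y = z.
Proof.
move=> uy uz; rewrite (coord_vbasis (memvf y)) (coord_vbasis (memvf z)).
apply: eq_bigr => i _; congr (_ *: _).
exact: (cvg_unique (@norm_hausdorff _ R^o) (uy i) (uz i)).
Qed.

Lemma cvg_sum_fin n (u : 'I_n -> nat -> R) l : (forall i, u i m @[m --> \oo] --> l i) ->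
  (\sum_i u i m) @[m --> \oo] --> \sum_i l i.
Proof.
by move=> h; apply: (@cvg_big R _ +%R 0 xpredT (@add_continuous _)) => i _; apply: h.
Qed.

Lemma vlim_mul u v y z : vlim u y -> vlim v z -> vlim (fun n => mu (u n) (v n)) (mu y z).
Proof.
move=> uy vz k.
have E y' z' : coord e k (mu y' z') =
    \sum_(i < \dim {:W}) \sum_(j < \dim {:W}) coord e i y' * coord e j z' * coord e k (mu e`_i e`_j).
  rewrite {1}(coord_vbasis (memvf y')) (bilin_suml muB) linear_sum; apply: eq_bigr => i _.
  rewrite {1}(coord_vbasis (memvf z')) (bilin_sumr muB) linear_sum; apply: eq_bigr => j _.
  by rewrite (bilinZl muB) (bilinZr muB) !linearZ /= mulrA.
rewrite E; under eq_cvg do rewrite E.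
apply: cvg_sum_fin => i; apply: cvg_sum_fin => j; apply: cvgMl; exact: cvgM.
Qed.

Lemma psum_vlim x : exists y, vlim (psum^~ x) y.
Proof.
have h i : exists l : R, coord e i (psum n x) @[n --> \oo] --> l.
  have sE n : coord e i (psum n x) = series (fun k => coord e i (w k x) : R^o) n.
    by rewrite /psum /series /= linear_sum.
  under eq_exists do under eq_cvg do rewrite sE.
  apply/cvg_ex; apply: normed_cvg.
  apply: (@series_le_cvg _ _ (vnorm x *: exp_coeff a)) => [n|n|n|].
  - exact: normr_ge0.
  - by rewrite mulr_ge0 ?vnorm_ge0 ?exp_coeff_ge0.
  - by apply: le_trans (coord_le _ _) _; rewrite -[leRHS]/(vnorm x * _) mulrC pow_fact_bound.
  - exact/is_cvg_seriesZ/is_cvg_series_exp_coeff.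
have /choice[l lP] := h.
exists (\sum_i l i *: e`_i) => i; rewrite coord_sum_free //.
exact: basis_free (vbasisP _).
Qed.

(** The remainder estimate serves twice: m = 1 gives injectivity for small operators, m = 2 the
    first-order expansion. *)
Lemma exp_derivation : exists phi : 'End(W),
  [/\ forall x y, phi (mu x y) = mu (phi x) (phi y) &
      forall x m, vnorm (phi x - psum m x) <= (\dim {:W})%:R * (a ^+ m * expR a * vnorm x)].
Proof.
have /choice[E EP] := psum_vlim.
have EL : linear E.
  move=> b x y; apply: vlim_uniq (EP _) _ => i.
  have lP u v : coord e i (b *: u + v) = b * coord e i u + coord e i v by rewrite linearP.
  rewrite lP; under eq_cvg do rewrite psum_linear lP.
  exact: (cvgD (cvgMl_tmp (a := b) (EP x i)) (EP y i)).
exists (linfun E); split=> [x y|x m]; rewrite !(linfun_linear EL).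
  have [K K0 KP] := bilin_bound.
  apply: vlim_uniq (EP _) _ => i.
  have h : coord e i (mu (psum n x) (psum n y)) @[n --> \oo] --> (coord e i (mu (E x) (E y)) : R).
    by apply: vlim_mul; apply: EP.
  have d0 : (fun n => coord e i (mu (psum n x) (psum n y) - psum n (mu x y))) @ \oo --> (0 : R).
    apply: norm_cvg0.
    apply: (@squeeze_cvgr _ _ _ _ (fun=> 0) (fun n => K * vnorm x * vnorm y *
      (series (exp_coeff a : nat -> R) n ^+ 2 - series (exp_coeff (a + a)) n))).
    + apply: nearW => n; rewrite normr_ge0 /=.
      exact: le_trans (coord_le _ _) (psum_mul_bound _ _ _ K0 KP).
    + exact: cvg_cst.
    + rewrite -[X in _ --> X](mulr0 (K * vnorm x * vnorm y)).
      apply: cvgMr; have <- : expR a * expR a - expR (a + a) = 0 by rewrite expRD subrr.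
      apply: cvgB; last exact: is_cvg_series_exp_coeff.
      by under eq_cvg do rewrite expr2; apply: cvgM; apply: is_cvg_series_exp_coeff.
  have fE n : coord e i (psum n (mu x y)) = coord e i (mu (psum n x) (psum n y)) -
      coord e i (mu (psum n x) (psum n y) - psum n (mu x y)).
    by rewrite -linearB /= opprB addrC subrK.
  under eq_cvg do rewrite fE.
  by rewrite -[coord _ _ _]subr0; apply: (cvgB h d0).
rewrite mulr_natl -[X in _ <= X](_ : \sum_(i < \dim {:W}) a ^+ m * expR a * vnorm x = _); last first.
  by rewrite sumr_const card_ord.
apply: ler_sum => i _.
apply: (@cvgr_to_le _ \oo _ _ (fun n => `|coord e i (psum n x - psum m x)|)).
  apply: cvg_norm; rewrite linearB /=; under eq_cvg do rewrite linearB /=.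
  by apply: cvgB; [apply: EP | apply: cvg_cst].
exists m => // n /= mn; exact: le_trans (coord_le _ _) (psum_tail _ mn).
Qed.
End ExpDerivation.

Lemma derivation_lfun_bound (R : realType) (W : vectType R) (psi : 'End(W)) :
  exists2 C, 0 <= C & forall x, vnorm (psi x) <= C * vnorm x.
Proof.
apply: (lfun_bound _ (@vnorm0 R W) (@vnormD R W) (@vnormZ R W)).
exact: linearP.
Qed.

(* The automorphisms [exp (s psi)] preserve the filtration for all small [s]. *)
Theorem optimal_derivation (R : realType) (W : vectType R) (mu : W -> W -> W) b f
    (psi : 'End(W)) t x :
  bilin mu -> optimal mu b f -> derivation mu psi -> filt b f t x -> filt b f t (psi x).
Proof.
move=> muB op psiD fx i ci; rewrite leNgt; apply/negP => fit.
(* A linear form that vanishes on the step [t] of the filtration but, by assumption, not at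
   [psi x]. *)
pose l := coord b i; have lE y : filt b f t y -> l y = 0.
  by move=> fy; apply/eqP/contraT => /fy; rewrite leNgt fit.
have [C C0 CP] := derivation_lfun_bound psi.
have [L L0 LP] : exists2 L, 0 <= L & forall y, `|l y| <= L * vnorm y.
  apply: (lfun_bound (N := fun u : R^o => `|u|)); first exact: linearP.
  - exact: normr0.
  - exact: ler_normD.
  - by move=> c u; rewrite normrM.
pose M := expR 1 : R; have M0 : 0 <= M by apply: expR_ge0.
pose d := (\dim {:W})%:R : R.
have d0 : 0 <= d by rewrite ler0n.
pose q := d * M * vnorm x * L * C ^+ 2.
(* Since exp (s psi) preserves the step containing [x], the form [l] kills both [x] and its image,
   so s l (psi x) is bounded by the quadratic remainder. The three conditions on [s] allow division,
   bound exp (s C) by e and make the exponential injective. *)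
have key s : 0 < s -> s * C <= 1 -> s * C * d * M < 1 -> `|l (psi x)| <= s * q.
  move=> s0 sC sCd.
  have sPD : derivation mu (s *: psi).
    by move=> y z; rewrite !scale_lfunE psiD scalerDr (bilinZl muB) (bilinZr muB).
  have sB y : vnorm ((s *: psi) y) <= s * C * vnorm y.
    by rewrite scale_lfunE vnormZ gtr0_norm // -mulrA ler_wpM2l // ltW.
  have sC0 : 0 <= s * C by rewrite mulr_ge0 // ltW.
  have [phi [phiM phiB]] := exp_derivation muB sPD sC0 sB.
  have e3 : expR (s * C) <= M by rewrite ler_expR.
  have ker0 : lker phi = 0%VS.
    apply/eqP; rewrite -subv0; apply/subvP => y; rewrite memv_ker memv0 => /eqP y0.
    have := phiB y 1%N; rewrite y0 /psum big_nat1 sub0r -scaleN1r vnormZ normrN1 mul1r expr1.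
    move=> yle; apply/eqP/vnorm_eq0/eqP; rewrite eq_le vnorm_ge0 andbT leNgt; apply/negP => ygt.
    have := yle; rewrite leNgt => /negP; apply.
    apply: (@le_lt_trans _ _ (s * C * d * M * vnorm y)); last by rewrite gtr_pMl.
    rewrite mulrA ler_wpM2r ?vnorm_ge0 // mulrA [d * _]mulrC.
    by rewrite ler_wpM2l // mulr_ge0.
  have /lE lphi := optimal_aut muB op ker0 phiM fx.
  have := phiB x 2; rewrite /psum big_nat_recr // big_nat1 /= invr1 scale1r => h.
  have : `|l (phi x - (x + (s *: psi) x))| <= L * (d * ((s * C) ^+ 2 * expR (s * C) * vnorm x)).
    by apply: le_trans (LP _) _; rewrite ler_wpM2l.
  have -> : l (phi x - (x + (s *: psi) x)) = l (phi x) - (l x + s * l (psi x)).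
    by rewrite /l linearB linearD scale_lfunE linearZ.
  rewrite lphi (lE x fx) !add0r normrN normrM gtr0_norm //.
  move=> h2; rewrite -(ler_pM2l s0); apply: le_trans h2 _.
  have -> : L * (d * ((s * C) ^+ 2 * expR (s * C) * vnorm x)) =
     expR (s * C) * (L * d * vnorm x * (s * C) ^+ 2) by ring.
  have -> : s * (s * q) = M * (L * d * vnorm x * (s * C) ^+ 2) by rewrite /q; ring.
  by apply: ler_wpM2r e3; rewrite !mulr_ge0 ?vnorm_ge0 ?sqr_ge0 ?(ltW s0).
have q0 : 0 <= q by rewrite /q !mulr_ge0 ?sqr_ge0 ?vnorm_ge0.
have lp : 0 < `|l (psi x)| by rewrite normr_gt0.
set v := `|l (psi x)| in key lp.
(* The summands of the denominator yield the two smallness conditions of [key] and the strict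
   inequality s q < v. *)
pose s := (1 + C + C * d * M + q / v)^-1.
have qv : 0 <= q / v by rewrite mulr_ge0 // ltW // invr_gt0.
have Cd : 0 <= C * d * M by rewrite !mulr_ge0.
have D0 : 0 < 1 + C + C * d * M + q / v by lra.
have s0 : 0 < s by rewrite invr_gt0.
have : v <= s * q.
  apply: key => //.
    rewrite mulrC ler_pdivrMr // mul1r; lra.
  by rewrite -!mulrA mulrC ltr_pdivrMr // mul1r !mulrA; lra.
rewrite leNgt => /negP; apply; rewrite mulrC ltr_pdivrMr // mulrC -ltr_pdivrMr //; lra.
Qed.

Lemma span_seqP (K : fieldType) (U : vectType K) (X : seq U) x : x \in <<X>>%VS ->
  exists c : nat -> K, x = \sum_(0 <= i < size X) c i *: X`_i.
Proof.
move=> xX; have := @coord_span _ _ _ (in_tuple X) x xX => xE.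
exists (fun i => if insub i is Some j then coord (in_tuple X) j x else 0).
by rewrite {1}xE big_mkord; apply: eq_bigr => i _; rewrite valK.
Qed.

(** * Numerical consequences of optimality *)

Section OptimalWeights.
Variables (R : realType) (W : vectType R) (mu : W -> W -> W).
Local Notation d := (\dim {:W}).
Hypothesis muB : bilin mu.
Implicit Types (b : d.-tuple W) (f : 'I_d -> R).

(** Admissible weights can be rescaled by nonnegative factors; minimality along the ray of [f] gives
    the equality, and then cost f = - sum f^2 turns minimality into the second clause. *)
Lemma optimal_cost b f : optimal mu b f ->
  \sum_i f i ^+ 2 = \sum_i f i /\
  forall b' g, admissible mu b' g -> 2 * \sum_i g i - \sum_i g i ^+ 2 <= \sum_i f i ^+ 2.
Proof.
move=> [[bb ad] op].
pose A := \sum_i f i ^+ 2; pose B := \sum_i f i.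
have AB : A = B.
  have A0 : 0 <= A by apply: sumr_ge0 => i _; apply: sqr_ge0.
  have sc (t : R) : 0 <= t -> A - 2 * B <= t ^+ 2 * A - 2 * (t * B).
    move=> t0; have -> : t ^+ 2 * A - 2 * (t * B) = cost (fun i => t * f i).
      rewrite /cost -[in RHS]mulr_sumr; congr (_ - _).
      by rewrite /A mulr_sumr; apply: eq_bigr => i _; rewrite exprMn.
    apply: (op b); split=> // i j k h; rewrite -mulrDr ler_wpM2l //; exact: ad h.
  have := sc 0 (lexx 0); have := sc 2 (ler0n R 2); rewrite expr0n /=.
  have [B0|B0] := ltP B 0; first by lra.
  have [A1|A1] := eqVneq A 0; first by rewrite A1; lra.
  have Ap : 0 < A by rewrite lt_def A1.
  (* The minimizer of the quadratic t^2 A - 2 t B. *)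
  have := sc (B / A) (divr_ge0 B0 A0).
  have -> : (B / A) ^+ 2 * A - 2 * (B / A * B) = - (B ^+ 2 / A) by field.
  rewrite lerBlDr -lerBrDl => h _ _.
  have : (A - B) ^+ 2 <= 0.
    have h2 : B ^+ 2 / A <= 2 * B - A by lra.
    rewrite ler_pdivrMr // in h2; nra.
  rewrite le_eqVlt ltNge sqr_ge0 orbF sqrf_eq0 subr_eq0 => /eqP //.
split=> // b' g /op; rewrite /cost -/A -/B AB; lra.
Qed.

(* The positive part of [f] is again admissible, because the filtration consists of ideals. *)
Lemma optimal_ge0 b f : (forall x y, mu x y = - mu y x) -> (forall x, derivation mu (linfun (mu x))) ->
  optimal mu b f ->
  (forall i, 0 <= f i) /\ forall x t y, filt b f t y -> filt b f t (mu x y).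
Proof.
move=> muA muD op; have inv x t y : filt b f t y -> filt b f t (mu x y).
  rewrite -(linfun_linear (bilin_r muB x)); exact: optimal_derivation op (muD x).
split=> //; have [[bb ad] om] := op.
pose g i := Num.max (f i) 0.
have adg : admissible mu b g.
  split=> // i j k h; have h1 := ad _ _ _ h.
  have h2 : f j <= f k by exact: (inv b`_i _ _ (@filt_nth _ _ b f j bb) k h).
  have h3 : f i <= f k.
    by apply: (inv b`_j _ _ (@filt_nth _ _ b f i bb) k); rewrite muA linearN oppr_eq0.
  by rewrite /g; case: (ltP (f i) 0); case: (ltP (f j) 0); case: (ltP (f k) 0); lra.
have := om _ _ adg; rewrite /cost -subr_ge0 => h i; rewrite leNgt; apply/negP => fi.
have : \sum_i ((g i ^+ 2 - 2 * g i) - (f i ^+ 2 - 2 * f i)) < 0.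
  have le0 j : (g j ^+ 2 - 2 * g j) - (f j ^+ 2 - 2 * f j) <= 0.
    rewrite /g; case: (ltP (f j) 0) => h'; nra.
  rewrite (bigD1 i) //= ltr_wnDr ?sumr_le0 //.
  by rewrite /g max_r ?(ltW fi) //; nra.
by rewrite !sumrB -!mulr_sumr ltNge h.
Qed.

Variables (Q : W -> W -> R).
Hypothesis QP : inner_product Q.

(** Each step of the filtration is spanned by a prefix of [b] sorted by decreasing weight, and
    Gram-Schmidt preserves the spans of prefixes. *)
Lemma filt_onb b f : basis_of {:W} b -> exists t : 'I_d -> W, [/\ onb Q t,
  forall i, filt b f (f i) (t i) &
  forall s x i, filt b f s x -> Q x (t i) != 0 -> s <= f i].
Proof.
move=> bb; pose r i j := f j <= f i; pose L := sort r (enum 'I_d).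
have mL i : i \in L by rewrite mem_sort mem_enum.
have sL : size L = d by rewrite size_sort size_enum_ord.
have rt : transitive r by move=> y x z xy yz; apply: le_trans yz xy.
have ss : sorted r L by apply: sort_sorted => x y; rewrite /r le_total.
have lt i j : (index i L < index j L)%N -> f j <= f i.
  exact: (sorted_ltn_index rt ss i j (mL i) (mL j)).
have le i j : (index i L <= index j L)%N -> f j <= f i.
  rewrite leq_eqVlt => /orP[/eqP h|/lt//].
  by rewrite -(nth_index i (mL i)) h nth_index.
have uL : uniq L by rewrite sort_uniq enum_uniq.
pose bs := [seq b`_(nat_of_ord i) | i <- L].
have sbs : size bs = d by rewrite size_map.
have bsE : perm_eq bs b.
  have -> : b = [seq b`_(nat_of_ord i) | i <- enum 'I_d] :> seq W.
    apply: (@eq_from_nth _ 0) => [|i]; first by rewrite size_tuple size_map size_enum_ord.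
    rewrite size_tuple => id; rewrite (nth_map (Ordinal id)) ?size_enum_ord //.
    by rewrite nth_enum_ord.
  by apply: perm_map; rewrite perm_sort.
have fbs : free bs by rewrite (perm_free bsE) (basis_free bb).
have [ts [sts ots tsp]] := gram_schmidt QP fbs.
pose t (i : 'I_d) := ts`_(index i L).
have iL i : (index i L < d)%N by have := mL i; rewrite -index_mem sL.
have nbs i : bs`_(index i L) = b`_(nat_of_ord i).
  by rewrite (nth_map i) ?sL // nth_index.
have tspan : <<ts>>%VS = fullv.
  have := tsp _ (leqnn _); rewrite -{1}sts !take_size => ->.
  by rewrite (eq_span (perm_mem bsE)) (span_basis bb).
have o i j : Q (t i) (t j) = (i == j)%:R.
  rewrite /t ots ?sts ?sbs //; congr (_ %:R : R); congr nat_of_bool.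
  by apply/eqP/eqP => [h|->//]; rewrite -(nth_index i (mL i)) h nth_index.
exists t; split.
- split=> // x; have := @orthonormal_span _ _ _ QP ts x ots; rewrite tspan memvf => /(_ isT) xE.
  have tsE : ts = [seq t i | i <- L].
    apply: (@eq_from_nth _ 0) => [|m]; first by rewrite size_map sL sts.
    rewrite sts sbs => md; rewrite (nth_map (Ordinal md)) ?sL //.
    by rewrite /t index_uniq // sL.
  have LE : perm_eq (index_enum 'I_d) L by rewrite perm_sym perm_sort /index_enum enumT.
  rewrite (perm_big _ LE) /= -(big_map t xpredT (fun v => Q x v *: v)) -tsE.
  by rewrite (big_nth 0) big_mkord.
- move=> i; have : t i \in <<take (index i L).+1 bs>>%VS.
    rewrite -tsp ?sbs // memv_span // /t -(nth_take 0 (ltnSn _)) mem_nth //.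
    by rewrite size_takel // sts sbs iL.
  move=> /span_seqP[c ->]; rewrite size_takel ?sbs // big_mkord.
  apply: filt_sum => m _; apply: filtZ.
  have mi : (m <= index i L)%N by rewrite -ltnS.
  have ms : (m < d)%N by apply: leq_ltn_trans mi (iL i).
  rewrite (nth_take 0) //; pose j := nth i L m.
  have jm : index j L = m by rewrite index_uniq // sL.
  rewrite -jm nbs; apply: filt_le (@filt_nth _ _ b f j bb).
  by apply: le; rewrite jm.
- move=> s x i fx xi; rewrite leNgt; apply: contra xi => fi.
  rewrite (coord_basis bb (memvf x)) (ip_suml QP) big1 // => j _.
  rewrite (ipZl QP); have [->|/fx sj] := eqVneq (coord b j x) 0; first by rewrite mul0r.
  have ji : (index j L < index i L)%N.
    by rewrite ltnNge; apply: contraTN (lt_le_trans fi sj) => /le; rewrite -leNgt.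
  have : b`_j \in <<take (index i L) ts>>%VS.
    rewrite tsp ?sbs 1?ltnW // memv_span // -nbs -(nth_take 0 ji) mem_nth //.
    by rewrite size_takel // sbs ltnW.
  move=> /span_seqP[c ->]; rewrite size_takel; last by rewrite sts sbs ltnW.
  rewrite big_mkord (ip_suml QP) big1 ?mulr0 // => m _; have mi := ltn_ord m.
  rewrite (ipZl QP) (nth_take 0) // ots ?sts ?sbs //; last exact: ltn_trans mi _.
  by rewrite ltn_eqF ?mulr0.
Qed.

(** An operator commuting with [G] preserves the filtration by eigenvalues, so in an orthonormal
    basis adapted to it only eigenvectors of the eigenvalue [r i] contribute to the i-th diagonal
    entry. *)
Lemma eigenbasis_onb (G : 'End(W)) b (r : 'I_d -> R) :
  basis_of {:W} b -> (forall i : 'I_d, G b`_i = r i *: b`_i) ->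
  exists t : 'I_d -> W, onb Q t /\
    forall X i, (X \o G = G \o X)%VF -> Q (X (G (t i))) (t i) = r i * Q (X (t i)) (t i).
Proof.
move=> bb Gb; have [t [tP tf ft]] := filt_onb r bb; exists t; split=> // X i XG.
apply/eqP; rewrite -subr_eq0 -(ipZl QP) -(ipBl QP) -linearZ -linearB /=.
rewrite {1 2}(coord_basis bb (memvf (t i))) linear_sum scaler_sumr -sumrB linear_sum (ip_suml QP).
rewrite big1 // => j _; rewrite linearZ /= Gb !scalerA -scalerBl linearZ /= (ipZl QP).
apply/eqP; rewrite mulf_eq0 orbC; apply/norP => -[/= h1 h2].
have cj : coord b j (t i) != 0.
  by apply: contraNneq h2 => ->; rewrite mul0r mulr0 subrr.
have rj := tf i j cj.
have Xf : filt b r (r j) (X b`_j).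
  move=> k; have : G (X b`_j) = r j *: X b`_j.
    by rewrite -[G _]comp_lfunE -XG comp_lfunE Gb linearZ.
  move/(congr1 (coord b k)); rewrite [in LHS](coord_basis bb (memvf (X b`_j))) linear_sum.
  under eq_bigr do rewrite linearZ /= Gb scalerA.
  rewrite coord_sum_free ?(basis_free bb) // linearZ /= => /eqP.
  by rewrite mulrC -subr_eq0 -mulrBl mulf_eq0 subr_eq0 => /orP[/eqP->//|/eqP ->]; rewrite eqxx.
have rji := ft _ _ _ Xf h1.
have rE : r j = r i by apply/le_anti; rewrite rj rji.
by move: h2; rewrite rE mulrC subrr eqxx.
Qed.

(* The eigenvalues of the hyperbolic part of [E], divided by [kappa], compete with [f]. *)
Lemma weights_lower_bound b f (E : 'End(W)) (kappa : R) : optimal mu b f -> derivation mu E ->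
  0 < kappa -> 2 * kappa * lftrace E - fro Q (sympart Q E) (sympart Q E) <=
  kappa ^+ 2 * \sum_i f i ^+ 2.
Proof.
move=> op dE k0; have [_ comp] := optimal_cost op.
have [G [c [r [TG [cb Gc] [trG trGT] _ der]]]] := hyperbolic_part E.
have dG := der _ muB dE.
have [t [tP tX]] := eigenbasis_onb cb Gc.
have t1 i : Q (t i) (t i) = 1 by case: tP => /(_ i i) ->; rewrite eqxx.
have Gt i : Q (G (t i)) (t i) = r i.
  have := tX \1%VF i; rewrite comp_lfun1l comp_lfun1r !id_lfunE t1 mulr1; exact.
have trE1 : lftrace E = \sum_i r i.
  by rewrite -trG (trE QP tP); apply: eq_bigr => i _.
have sr2 : \sum_i r i ^+ 2 = \sum_i r i * Q (E (t i)) (t i).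
  transitivity (lftrace (G \o G)%VF).
    by rewrite (trE QP tP); apply: eq_bigr => i _; rewrite comp_lfunE tX // Gt.
  rewrite -trGT (tr_comp QP) (trE QP tP).
  by apply: eq_bigr => i _; rewrite comp_lfunE tX // TG.
(* As sum r_i^2 = sum r_i E_ii, the excess of sum E_ii^2 over sum r_i^2 is sum (E_ii - r_i)^2. The
   diagonal entries of [E] are those of its symmetric part, and Cauchy-Schwarz applies. *)
have le2 : \sum_i r i ^+ 2 <= fro Q (sympart Q E) (sympart Q E).
  apply: (@le_trans _ _ (\sum_i Q (E (t i)) (t i) ^+ 2)).
    rewrite -subr_ge0; set A := \sum_i Q (E (t i)) (t i) ^+ 2.
    have -> : A - \sum_i r i ^+ 2 = \sum_i (Q (E (t i)) (t i) - r i) ^+ 2.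
      transitivity (A + \sum_i r i ^+ 2 - 2 * \sum_i r i * Q (E (t i)) (t i)).
        by rewrite -sr2; ring.
      rewrite /A mulr_sumr -big_split -sumrB; apply: eq_bigr => i _ /=; ring.
    by apply: sumr_ge0 => i _; apply: sqr_ge0.
  rewrite (froE QP _ _ tP); apply: ler_sum => i _.
  have := ip_CauchySchwarz QP (sympart Q E (t i)) (t i).
  rewrite t1 mulr1; apply: le_trans; rewrite (sympart_ip QP) (ip_sym QP (t i)).
  by have -> : 2^-1 * (Q (E (t i)) (t i) + Q (E (t i)) (t i)) = Q (E (t i)) (t i) by field.
have k1 : kappa != 0 by rewrite gt_eqF.
(* [G] is a derivation, so its eigenvalues add exactly along nonzero structure constants. *)
have ad : admissible mu c (fun i => r i / kappa).
  split=> // i j k h; rewrite -mulrDl ler_wpM2r ?invr_ge0 ?(ltW k0) //.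
  have : G (mu c`_i c`_j) = (r i + r j) *: mu c`_i c`_j.
    by rewrite dG !Gc (bilinZl muB) (bilinZr muB) scalerDl.
  move/(congr1 (coord c k)); rewrite [in LHS](coord_basis cb (memvf (mu c`_i c`_j))) linear_sum.
  under eq_bigr do rewrite linearZ /= Gc scalerA.
  rewrite coord_sum_free ?(basis_free cb) // linearZ /= => /eqP.
  by rewrite mulrC -subr_eq0 -mulrBl mulf_eq0 subr_eq0 (negbTE h) orbF => /eqP ->.
have := comp _ _ ad; rewrite -(ler_pM2l (exprn_gt0 2 k0)); apply: le_trans.
have -> : \sum_i (r i / kappa) ^+ 2 = (\sum_i r i ^+ 2) / kappa ^+ 2.
  by rewrite mulr_suml; apply: eq_bigr => i _; rewrite exprMn exprVn.
rewrite -mulr_suml -trE1.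
have -> : kappa ^+ 2 * (2 * (lftrace E / kappa) - (\sum_i r i ^+ 2) / kappa ^+ 2) =
  2 * kappa * lftrace E - \sum_i r i ^+ 2 by field.
by rewrite lerD2l lerN2.
Qed.
End OptimalWeights.

(** The optimal filtration is that of the ideal as an algebra in its own right, written in an
    orthonormal basis of the whole space that starts with one of the ideal. *)
Theorem ideal_weights (R : realType) (V : vectType R) (br : {bilinear V -> V -> V})
    (Q : V -> V -> R) (s : {vspace V}) (E : 'End(V)) (kappa : R) :
  inner_product Q -> lie_bracket br -> ideal br s ->
  derivation br E -> (forall x, x \in s -> E x \in s) -> 0 < kappa ->
  exists n m (e : 'I_(n + m) -> V) (f : 'I_n -> R),
  [/\ [/\ onb Q e, forall i, e (lshift m i) \in s &
          forall i x, x \in s -> Q x (e (rshift n i)) = 0],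
      (forall i, 0 <= f i) /\ \sum_i f i ^+ 2 = \sum_i f i,
      forall i j k, Q (br (e (lshift m i)) (e (lshift m j))) (e (lshift m k)) != 0 ->
        f i + f j <= f k,
      forall x j k, Q (br x (e (lshift m j))) (e (lshift m k)) != 0 -> f j <= f k &
      2 * kappa * (\sum_i Q (E (e (lshift m i))) (e (lshift m i))) -
        (\sum_i \sum_j Q (sympart Q E (e (lshift m i))) (e (lshift m j)) ^+ 2) <=
      kappa ^+ 2 * \sum_i f i ^+ 2].
Proof.
move=> QP brL sI dE Es k0.
pose W := subvs_of s; pose mu (x y : W) : W := vsproj s (br (vsval x) (vsval y)).
have muE x y : vsval (mu x y) = br (vsval x) (vsval y).
  by rewrite vsprojK //; apply/sI/subvsP.
have muB : bilin mu.
  split=> [y a x x'|x a y y']; apply: subvs_inj; rewrite linearP /= !muE linearP /=.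
    exact: (bilin_l (br_bilin br)).
  by [].
have QP' := restr_inner_product QP s.
pose res (X : 'End(V)) : 'End(W) := linfun (fun x => vsproj s (X (vsval x))).
have resE (X : 'End(V)) : (forall x, x \in s -> X x \in s) -> forall x, vsval (res X x) = X (vsval x).
  move=> Xs x; rewrite linfun_linear ?vsprojK ?Xs ?subvsP //.
  by move=> a u v; rewrite !linearP.
have resD X : derivation br X -> (forall x, x \in s -> X x \in s) -> derivation mu (res X).
  by move=> dX Xs x y; apply: subvs_inj; rewrite linearD /= resE // !muE dX !resE.
have [b [f op]] := optimal_exists mu; have [[bb adm] _] := op.
have muA x y : mu x y = - mu y x.
  by apply: subvs_inj; rewrite linearN /= !muE (brC brL).
have muD x : derivation mu (linfun (mu x)).
  move=> y z; rewrite !(linfun_linear (bilin_r muB x)).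
  by apply: subvs_inj; rewrite linearD /= !muE jacobi.
have [f0 _] := optimal_ge0 muB muA muD op.
have [sf _] := optimal_cost op.
have lb := weights_lower_bound muB QP' op (resD _ dE Es) k0.
have [t [tP tf ft]] := filt_onb QP' f bb.
have t1 i j : Q (vsval (t i)) (vsval (t j)) = (i == j)%:R by case: tP => /(_ i j).
have t3 x : x \in s -> x = \sum_i Q x (vsval (t i)) *: vsval (t i).
  move=> xs; have := congr1 vsval (onb_expand tP (vsproj s x)).
  rewrite vsprojK // => {1}->; rewrite linear_sum; apply: eq_bigr => i _.
  by rewrite linearZ /= /restr_form vsprojK.
have [m [e [eP el er]]] := extend_onb QP t1 (fun i => subvsP (t i)) t3.
exists (\dim {:W}), m, e, f; split.
- by split=> // i; rewrite el subvsP.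
- by split.
- move=> i j k; rewrite !el -muE.
  exact: (ft _ _ _ (admissible_filt muB (conj bb adm) (tf i) (tf j))).
(* [ad x] with x outside the ideal restricts to a derivation of it, and the optimal filtration is
   invariant under all derivations. *)
- move=> x j k; rewrite !el.
  have adx y : y \in s -> ad br x y \in s by move=> ys; rewrite adE; apply: sI.
  rewrite -adE -resE //; apply: ft; apply: optimal_derivation op _ (tf j) => //.
  by apply: resD => //; apply: ad_deriv.
- apply: le_trans lb; rewrite (trE QP' tP) (froE QP' _ _ tP).
  rewrite le_eqVlt; apply/orP; left; apply/eqP; congr (_ * _ - _).
    by apply: eq_bigr => i _; rewrite !el /restr_form resE.
  apply: eq_bigr => i _; rewrite (onb_parseval QP' tP); apply: eq_bigr => j _.
  rewrite !el !(sympart_ip QP') !(sympart_ip QP) /restr_form !resE //.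
Qed.

(** * The moment operator of an expanding soliton *)

Section KillingOrthogonal.
Variables (R : realType) (V : vectType R) (br : {bilinear V -> V -> V}).
Variables (k p : {vspace V}) (Q : {dot V for idfun}).
Hypothesis mr : metric_reductive br k p Q.
Hypothesis kp : forall z x, z \in k -> x \in p -> killing br z x = 0.
Local Notation tr := (@lftrace R V).
Local Notation B := (killing br).
Let QP := dot_inner_product Q.
Let brL := mr_lie mr.

(** [ad z] is skew, so B(z,z) = -|ad z|^2. If this vanishes, the line of [z] is an ideal inside k,
    which almost-effectiveness excludes. *)
Lemma killing_k_eq0 z : z \in k -> B z z = 0 -> z = 0.
Proof.
move=> zk zz; have f0 : fro Q (ad br z) (ad br z) = 0.
  by rewrite /fro (ad_k_skew mr zk) comp_lfunNl (trN QP) -/(B z z) zz oppr0.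
have a0 := ip_eq0 (fro_inner_product QP) f0.
have L : (<[z]> <= k)%VS by rewrite -memvE.
have I : ideal br <[z]>%VS.
  move=> x y /vlineP[a ->]; rewrite linearZr /= (brC brL) -adE a0 zero_lfunE oppr0 scaler0.
  exact: mem0v.
by have := mr_effective mr I L => z0; have := memv_line z; rewrite z0 memv0 => /eqP.
Qed.

Lemma killing_perp_p x : (forall z, z \in k -> B z x = 0) -> x \in p.
Proof.
move=> xk; have : x \in (k + p)%VS by rewrite (mr_sum mr) memvf.
case/memv_addP => z zk [y yp xE].
suff -> : x = y by [].
rewrite xE [z]killing_k_eq0 ?add0r //.
have := xk z zk; rewrite xE.
have -> : B z (z + y) = B z z + B z y.
  have := (bilin_killing br QP).2 z 1 z y; rewrite !scale1r; exact.
by rewrite (kp zk yp) addr0.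
Qed.

Variable H : V.
Hypothesis HP : mean_curvature_vector br p Q H.

(** tr ad vanishes on brackets, so [H] is orthogonal to them; since [ad z] is skew, [z, H] is then
    orthogonal to everything. *)
Lemma ad_H_k z : z \in k -> br H z = 0.
Proof.
move=> zk; rewrite (brC brL); apply/eqP; rewrite oppr_eq0; apply/eqP/(ip_inj QP) => x.
have := mr_invariant mr H x zk; case: HP => _ ->.
by rewrite (tr_ad_br QP brL) addr0 (ip0l QP).
Qed.

Lemma ad_H_p x : x \in p -> br H x \in p.
Proof.
move=> xp; apply: killing_perp_p => z zk.
by rewrite -(killing_inv QP brL) (brC brL) ad_H_k // oppr0 (killing0 br QP).
Qed.
End KillingOrthogonal.

Section Moment.
Variables (R : realType) (V : vectType R) (br : {bilinear V -> V -> V}).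
Variables (k p : {vspace V}) (Q : {dot V for idfun}).
Hypothesis mr : metric_reductive br k p Q.
Hypothesis kp : forall z x, z \in k -> x \in p -> killing br z x = 0.
Local Notation tr := (@lftrace R V).
Local Notation B := (killing br).
Local Notation adj := (adjoint Q).
Let QP := dot_inner_product Q.
Let brL := mr_lie mr.
Variables (P T : 'End(V)).
Hypothesis PP : orthoproj Q p P.
Hypothesis TP : adj T = T /\ forall x y, B x y = Q (T x) y.
Local Notation mu := (pmu br P).

Let Ts : adj T = T. Proof. by case: TP. Qed.
Let TE x y : B x y = Q (T x) y. Proof. by case: TP. Qed.
Let muB := pmu_bilin br P.

(** The block form diag(0, E_p), shared by D, [ad H], their adjoints and symmetric parts. *)
Definition vertical (E : 'End(V)) : Prop :=
  (forall z, z \in k -> E z = 0) /\ (forall x, x \in p -> E x \in p).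

Lemma verticalE E : vertical E -> (E \o P = E)%VF /\ (P \o E = E)%VF.
Proof.
move=> [Ek Ep]; split; apply/lfunP => x; rewrite comp_lfunE.
  have [z [y [zk yp ->]]] := decomp mr PP x.
  by rewrite !linearD /= (P_k mr PP zk) (P_id PP yp) (Ek z zk) linear0.
have [z [y [zk yp ->]]] := decomp mr PP x.
by rewrite !linearD /= (Ek z zk) linear0 !add0r (P_id PP (Ep y yp)).
Qed.

Lemma verticalP E : (E \o P = E)%VF -> (P \o E = E)%VF -> vertical E.
Proof.
move=> EP PE; split=> [z zk|x xp].
  by rewrite -EP comp_lfunE (P_k mr PP zk) linear0.
by rewrite -PE comp_lfunE; apply: P_in PP _.
Qed.

Lemma vertical_adj E : vertical E -> vertical (adj E).
Proof.
move=> /verticalE[EP PE]; have aP := orthoproj_adj QP PP.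
by apply: verticalP; rewrite -{1}aP -(adj_comp QP) ?EP ?PE.
Qed.

Lemma vertical_lin a E X : vertical E -> vertical X -> vertical (a *: E + X).
Proof.
move=> [Ek Ep] [Xk Xp]; split=> [z zk|x xp]; rewrite add_lfunE scale_lfunE.
  by rewrite Ek // Xk // scaler0 addr0.
by apply: memvD; [apply/memvZ/Ep | apply: Xp].
Qed.

Lemma vertical_sympart E : vertical E -> vertical (sympart Q E).
Proof.
move=> vE; rewrite /sympart -[_ *: _]addr0; apply: vertical_lin.
  by have := vertical_lin 1 vE (vertical_adj vE); rewrite scale1r.
by split=> [z _|x _]; rewrite zero_lfunE ?mem0v.
Qed.

Lemma vertical_deriv_pmu E : vertical E -> derivation br E -> derivation mu E.
Proof.
move=> vE dE x y; have [EP PE] := verticalE vE.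
have Px u : E (P u) = P (E u) by rewrite -!comp_lfunE EP PE.
by rewrite /pmu Px dE !Px linearD.
Qed.

(** A derivation is skew for the Killing form, that is, T E = - E^t T; taking traces, tr (T E) is
    its own negative. *)
Lemma tr_killing_deriv E : derivation br E -> tr (T \o E)%VF = 0.
Proof.
move=> dE; have tE : (T \o E = - (adj E \o T))%VF.
  apply/lfunP => x; apply: (ip_inj QP) => y.
  rewrite opp_lfunE !comp_lfunE (ipNl QP) -TE (killing_deriv QP _ _ dE) TE.
  by rewrite (adjEr QP).
have := tr_adj QP (T \o E)%VF; rewrite (adj_comp QP) Ts tE (trN QP); lra.
Qed.

Variables (E : 'End(V)) (c : R).
Hypothesis vE : vertical E.
Hypothesis dE : derivation br E.
Local Notation F := (sympart Q E).
(* For a soliton, Ricci's formula says that this operator represents the moment form of [mu]. *)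
Definition moment_operator := c *: P + F + 2^-1 *: (P \o T \o P)%VF.
Local Notation M := moment_operator.
Variables (n : nat) (e : 'I_n -> V).
Hypothesis eP : onb Q e.
Hypothesis momE : forall y, y \in p ->
  mom Q e mu y y = c * Q y y + Q (E y) y + 2^-1 * B y y.

Lemma mom_bilin : (forall y, linear (fun x => mom Q e mu x y : R^o)) /\
  (forall x, linear (fun y => mom Q e mu x y : R^o)).
Proof.
have C x y : mom Q e mu x y = mom Q e mu y x.
  rewrite /mom; congr (_ * _ + _ * _); last first.
    by apply: eq_bigr => i _; apply: eq_bigr => j _; rewrite mulrC.
  by apply: eq_bigr => i _; rewrite (ip_sym QP).
have L y : linear (fun x => mom Q e mu x y : R^o).
  move=> a x x'; rewrite -[RHS]/(a * _ + _) /mom.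
  have -> : \sum_i Q (mu (a *: x + x') (e i)) (mu y (e i)) =
     a * (\sum_i Q (mu x (e i)) (mu y (e i))) + \sum_i Q (mu x' (e i)) (mu y (e i)).
    rewrite mulr_sumr -big_split; apply: eq_bigr => i _ /=.
    by rewrite (bilin_l muB) (ip_linear QP).
  have -> : \sum_i \sum_j Q (mu (e i) (e j)) (a *: x + x') * Q (mu (e i) (e j)) y =
     a * (\sum_i \sum_j Q (mu (e i) (e j)) x * Q (mu (e i) (e j)) y) +
     \sum_i \sum_j Q (mu (e i) (e j)) x' * Q (mu (e i) (e j)) y.
    rewrite mulr_sumr -big_split; apply: eq_bigr => i _ /=.
    rewrite mulr_sumr -big_split; apply: eq_bigr => j _ /=.
    by rewrite (ipDr QP) (ipZr QP); ring.
  by ring.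
split=> // x a y y'; rewrite !(C x); exact: L.
Qed.

Lemma M_adj : adj M = M.
Proof.
rewrite /M !(adjD QP) (sympart_adj QP) !(adjZ QP) !(adj_comp QP) (orthoproj_adj QP PP) Ts.
by rewrite comp_lfunA.
Qed.

(** Both forms are symmetric and depend only on p-components, so their agreement on the diagonal of
    p polarizes. *)
Lemma momM x y : mom Q e mu x y = Q (M x) y.
Proof.
have mP z w : mom Q e mu z w = mom Q e mu (P z) (P w).
  have PPx u : P (P u) = P u by rewrite (P_id PP) // (P_in PP).
  rewrite /mom; congr (_ * _ + _ * _).
    by apply: eq_bigr => i _; rewrite /mu !PPx.
  apply: eq_bigr => i _; apply: eq_bigr => j _.
  have h u v w' : Q (mu u v) w' = Q (mu u v) (P w').
    by rewrite -(P_sym PP) /mu PPx.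
  by rewrite h [X in _ * X]h.
have [EP PE] := verticalE vE.
have Mz z : mom Q e mu z z = Q (M z) z.
  rewrite mP momE ?(P_in PP) // TE /M.
  have := sympart_ip QP E z z; move: (F) => S Sip; rewrite !add_lfunE !scale_lfunE !(ipDl QP) !(ipZl QP).
  rewrite !comp_lfunE (P_sym PP (T _)) -(P_sym PP (P z)) (P_id PP) ?(P_in PP) //.
  rewrite -[E (P z)]comp_lfunE EP -(P_sym PP) -[P (E z)]comp_lfunE PE Sip.
  by rewrite (ip_sym QP z); field.
have [bl br'] := mom_bilin.
have mD u v w : mom Q e mu (u + v) w = mom Q e mu u w + mom Q e mu v w.
  by have := bl w 1 u v; rewrite !scale1r.
have mDr u v w : mom Q e mu w (u + v) = mom Q e mu w u + mom Q e mu w v.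
  by have := br' w 1 u v; rewrite !scale1r.
have C : mom Q e mu x y = mom Q e mu y x.
  rewrite /mom; congr (_ * _ + _ * _); last first.
    by apply: eq_bigr => i _; apply: eq_bigr => j _; rewrite mulrC.
  by apply: eq_bigr => i _; rewrite (ip_sym QP).
have := Mz (x + y); rewrite mD !mDr (raddfD M) (ipDl QP) !(ipDr QP) !Mz -C.
have -> : Q (M y) x = Q (M x) y by rewrite (adjE QP) M_adj (ip_sym QP).
lra.
Qed.

Lemma moment_act X : ndot Q e (act X mu) mu = 4 * tr (M \o X)%VF.
Proof. exact: (mom_act QP eP X muB (pmuC mr P) M_adj momM). Qed.

Lemma tr_PTP X : tr (P \o T \o P \o X)%VF = tr (T \o (P \o X \o P))%VF.
Proof.
rewrite -!comp_lfunA (tr_comp QP P) -!comp_lfunA.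
by [].
Qed.

Lemma trM X : tr (M \o X)%VF = c * tr (P \o X)%VF + tr (F \o X)%VF + 2^-1 * tr (T \o (P \o X \o P))%VF.
Proof.
rewrite /M !comp_lfunDl !(trD QP) -!comp_lfunZl !(trZ QP) -tr_PTP.
by [].
Qed.

Lemma trM_deriv X : derivation mu X -> tr (M \o X)%VF = 0.
Proof.
move=> /act_deriv dX; have := moment_act X.
rewrite /ndot big1 => [|i _]; last by rewrite big1 // => j _; rewrite dX (ip0l QP).
lra.
Qed.

Lemma fro_F : fro Q F F = - c * tr E.
Proof.
have := trM_deriv (vertical_deriv_pmu vE dE); have [EP PE] := verticalE vE.
rewrite trM PE EP (tr_killing_deriv dE) mulr0 addr0 /fro (sympart_adj QP).
have -> : tr (F \o F)%VF = tr (F \o E)%VF.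
  by rewrite (tr_sympart QP _ (sympart_adj QP E)) (tr_comp QP).
lra.
Qed.
End Moment.

(** The setting of the structure theory, for E = D + [ad H]. The field [sd_mom] is the soliton
    equation with the Ricci formula inserted and the mean curvature term moved to the right. *)
Record soliton_data (R : realType) (V : vectType R) (br : {bilinear V -> V -> V})
    (k p : {vspace V}) (Q : {dot V for idfun}) (P T E : 'End(V)) (c : R) : Prop := {
  sd_mr : metric_reductive br k p Q;
  sd_kp : forall z x, z \in k -> x \in p -> killing br z x = 0;
  sd_P : orthoproj Q p P;
  sd_T : adjoint Q T = T /\ forall x y, killing br x y = Q (T x) y;
  sd_v : vertical k p E;
  sd_d : derivation br E;
  sd_c : c < 0;
  sd_mom : forall n (e : 'I_n -> V), onb Q e -> forall y, y \in p ->
    mom Q e (pmu br P) y y = c * Q y y + Q (E y) y + 2^-1 * killing br y y }.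

(** * Diagonalization of the symmetric part of E *)

Section Structure.
Variables (R : realType) (V : vectType R) (br : {bilinear V -> V -> V}).
Variables (k p : {vspace V}) (Q : {dot V for idfun}) (P T E : 'End(V)) (c : R).
Hypothesis sd : soliton_data br k p Q P T E c.
Local Notation tr := (@lftrace R V).
Local Notation B := (killing br).
Local Notation adj := (adjoint Q).
Local Notation F := (sympart Q E).
Local Notation mu := (pmu br P).
Local Notation M := (moment_operator Q P T E c).
Let QP := dot_inner_product Q.
Let mr := sd_mr sd.
Let brL := mr_lie mr.
Let kp := sd_kp sd.
Let PP := sd_P sd.
Let TP := sd_T sd.
Let vE := sd_v sd.
Let dE := sd_d sd.
Let muB := pmu_bilin br P.
Let Ts : adj T = T. Proof. by case: TP. Qed.
Let TE x y : B x y = Q (T x) y. Proof. by case: TP. Qed.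
Local Notation s := (lker T).

Lemma radicalP x : x \in s <-> forall y, B x y = 0.
Proof.
rewrite memv_ker; split=> [/eqP x0 y|h]; first by rewrite TE x0 (ip0l QP).
by apply/eqP/(ip_inj QP) => y; rewrite -TE h (ip0l QP).
Qed.

Lemma radical_p x : x \in s -> x \in p.
Proof.
move=> /radicalP xs; apply: (killing_perp_p mr kp) => z _.
by rewrite (killingC br QP) xs.
Qed.

Lemma radical_deriv X x : derivation br X -> x \in s -> X x \in s.
Proof.
move=> dX /radicalP xs; apply/radicalP => y.
by rewrite (killing_deriv QP _ _ dX) xs oppr0.
Qed.

Lemma radical_ideal : ideal br s.
Proof. by move=> x y ys; rewrite -adE; apply: radical_deriv ys; apply: ad_deriv. Qed.

(* On [g / s] the Killing form is non-degenerate and [E] is skew for it. *)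
Lemma tr_quotient X N : derivation br X -> orthoproj Q s N -> tr (N \o X)%VF = tr X.
Proof.
move=> dX NP; have [Ns Nu Ni] := NP.
(* [L] projects onto the orthogonal complement of the radical, where [T] is invertible and [g]
   inverts it. *)
pose L := (\1%VF - N)%VF : 'End(V); pose g := (T^-1)%VF.
have aN := orthoproj_adj QP NP.
have aL : adj L = L by rewrite (adjB QP) (adj1 QP) aN.
have LL : (L \o L = L)%VF.
  apply/lfunP => x; rewrite comp_lfunE !add_lfunE !opp_lfunE !id_lfunE linearB /=.
  by rewrite (Ni (N x)) // subrr subr0.
have TL : (T \o L = T)%VF.
  apply/lfunP => x; rewrite comp_lfunE add_lfunE opp_lfunE id_lfunE linearB /=.
  by have := Nu x; rewrite memv_ker => /eqP ->; rewrite subr0.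
have LT : (L \o T = T)%VF by have := congr1 adj TL; rewrite (adj_comp QP) aL Ts.
have [Y [Ys Yu Yi]] := orthoproj_exists QP (limg T).
have limT y : L y \in limg T.
  have d0 : L y - Y (L y) = 0.
    have h : L y - Y (L y) \in s.
      rewrite memv_ker; apply/eqP/(ip_inj QP) => w; rewrite (adjE QP) Ts (ip0l QP).
      by rewrite (ipBl QP) Ys Yi ?subrr // memv_img ?memvf.
    have YD : Y (L y - Y (L y)) = 0 by rewrite linearB /= (Yi (Y (L y))) // subrr.
    apply: (ip_eq0 QP); rewrite {1}[L y - Y (L y)]addrC (ipDl QP) (ipNl QP) Ys YD (ip0r QP) oppr0 add0r.
    have -> : Q (L y) (L y - Y (L y)) = Q (y - N y) (L y - Y (L y)).
      by rewrite [in LHS]/L add_lfunE opp_lfunE id_lfunE.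
    exact: (orthoproj_perp QP y NP h).
  by move/eqP: d0; rewrite subr_eq0 => /eqP ->.
have TgL : (T \o g \o L = L)%VF.
  by apply/lfunP => x; rewrite !comp_lfunE limg_lfunVK.
have TX : (T \o X = - (adj X \o T))%VF.
  apply/lfunP => x; apply: (ip_inj QP) => y.
  rewrite opp_lfunE !comp_lfunE (ipNl QP) -TE (killing_deriv QP _ _ dX) TE.
  by rewrite (adjEr QP).
(* The radical is invariant under derivations. *)
have LX : (L \o X = L \o X \o L)%VF.
  apply/lfunP => x; rewrite !comp_lfunE; set y := N x.
  have -> : L x = x - y by rewrite add_lfunE opp_lfunE id_lfunE.
  have z0 : L (X y) = 0.
    rewrite add_lfunE opp_lfunE id_lfunE Ni ?subrr //.
    by apply: radical_deriv => //; apply: Nu.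
  by rewrite !linearB /= z0 subr0.
have gT : (L \o g \o T = L)%VF.
  apply/lfunP => x; rewrite !comp_lfunE.
  have /eqP -> : L (g (T x)) == L x; last by [].
  rewrite -subr_eq0 -linearB /= add_lfunE opp_lfunE id_lfunE Ni ?subrr //.
  by rewrite memv_ker linearB /= limg_lfunVK ?subrr // memv_img ?memvf.
have aLX : (adj X \o L = L \o adj X \o L)%VF.
  by have := congr1 adj LX; rewrite !(adj_comp QP) aL comp_lfunA.
suff t0 : tr (L \o X)%VF = 0.
  by move: t0; rewrite comp_lfunBl comp_lfun1l (trB QP) => /eqP; rewrite subr_eq0 => /eqP.
(* Through [g], the relation T X = - X^t T makes the compression of [X] by [L] conjugate to minus
   that of its adjoint, whereas passing to the adjoint preserves the trace. *)
have e1 : tr (L \o X)%VF = - tr (adj X \o L)%VF.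
  rewrite -{1}gT -comp_lfunA TX comp_lfunNr (trN QP) comp_lfunA; congr (- _).
  transitivity (tr ((L \o g \o adj X \o L) \o T)%VF).
    by rewrite -[(_ \o L \o T)%VF]comp_lfunA LT.
  rewrite (tr_comp QP) !comp_lfunA TL -comp_lfunA aLX.
  by rewrite !comp_lfunA TgL.
have := tr_adj QP (L \o X)%VF; rewrite (adj_comp QP) aL; lra.
Qed.

Lemma diag_lfun n (e : 'I_n -> V) (phi : 'I_n -> R) : onb Q e ->
  exists X : 'End(V), (forall i, X (e i) = phi i *: e i) /\ adj X = X.
Proof.
move=> eP; have [e1 _] := eP.
have L : linear (fun x => \sum_i (phi i * Q x (e i)) *: e i).
  move=> a x y; rewrite scaler_sumr -big_split; apply: eq_bigr => i _ /=.
  by rewrite (ip_linear QP) scalerA -scalerDl; congr (_ *: _); ring.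
exists (linfun (fun x => \sum_i (phi i * Q x (e i)) *: e i)); split.
  move=> i; rewrite (linfun_linear L) (bigD1 i) //= big1 => [|j ji].
    by rewrite e1 eqxx mulr1 addr0.
  by rewrite e1 eq_sym (negbTE ji) mulr0 scale0r.
apply/esym/(adj_uniq QP) => x y; rewrite !(linfun_linear L) (ip_suml QP) (ip_sumr QP).
by apply: eq_bigr => i _; rewrite (ipZl QP) (ipZr QP) (ip_sym QP (e i)); ring.
Qed.

Lemma eq_on_onb n (e : 'I_n -> V) (A1 A2 : 'End(V)) : onb Q e ->
  (forall i, A1 (e i) = A2 (e i)) -> A1 = A2.
Proof.
move=> eP h; apply/lfunP => x; rewrite (onb_expand eP x) !linear_sum.
by apply: eq_bigr => i _; rewrite !linearZ /= h.
Qed.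

(* [F] is diagonal with non-negative eigenvalues, and vanishes off [s]. *)
Lemma F_diag : exists n (e : 'I_n -> V) (phi : 'I_n -> R),
  [/\ onb Q e, forall i, F (e i) = phi i *: e i, forall i, 0 <= phi i,
      forall i, 0 < phi i -> e i \in s &
      forall i j l, Q (mu (e i) (e j)) (e l) != 0 -> phi l = phi i + phi j].
Proof.
have k0 : 0 < - c by rewrite oppr_gt0 (sd_c sd).
have Es x : x \in s -> E x \in s by apply: radical_deriv.
have [n [m [e [f [[eP es ep] [f0 f2] fij fj lb]]]]] := ideal_weights QP brL radical_ideal dE Es k0.
(* The candidate spectrum of [F]: -c f on the radical and 0 on its complement. *)
pose phi (i : 'I_(n + m)) := if fintype.split i is inl j then - c * f j else 0.
have phil i : phi (lshift m i) = - c * f i by rewrite /phi -[lshift m i]/(unsplit (inl i)) unsplitK.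
have phir i : phi (rshift n i) = 0 by rewrite /phi -[rshift n i]/(unsplit (inr i)) unsplitK.
have phi0 i : 0 <= phi i.
  by rewrite /phi; case: (fintype.split i) => // j; rewrite mulr_ge0 // ltW.
have phis i : 0 < phi i -> e i \in s.
  by rewrite /phi; case: fintype.splitP => [j iE _|j _]; rewrite ?ltxx // (_ : i = lshift m j) ?es //; apply: val_inj.
have [X [Xe sX]] := diag_lfun phi eP.
have [EP PE] := verticalE mr PP vE.
have [N NP] := orthoproj_exists QP s; have [Ns Nu Ni] := NP.
have Nl i : N (e (lshift m i)) = e (lshift m i) by rewrite Ni.
have Nr i : N (e (rshift n i)) = 0.
  by apply: (orthoproj_ker QP NP) => y ys; rewrite (ip_sym QP) ep.
have trE_s : \sum_i Q (E (e (lshift m i))) (e (lshift m i)) = tr E.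
  rewrite -(tr_quotient dE NP) (trE QP eP) big_split_ord /= [X in _ + X]big1 ?addr0.
    by apply: eq_bigr => i _; rewrite comp_lfunE Ns Nl.
  by move=> i _; rewrite comp_lfunE Ns Nr (ip0r QP).
have fF := fro_F mr PP TP vE dE eP (sd_mom sd eP).
have F2_ge : \sum_i \sum_j Q (F (e (lshift m i))) (e (lshift m j)) ^+ 2 <= fro Q F F.
  rewrite (froE QP _ _ eP) big_split_ord /= -[X in X <= _]addr0; apply: lerD.
    apply: ler_sum => i _; rewrite (onb_parseval QP eP) big_split_ord /= -[X in X <= _]addr0; apply: lerD.
      by apply: ler_sum => j _; rewrite expr2.
    by apply: sumr_ge0 => j _; rewrite -expr2 sqr_ge0.
  by apply: sumr_ge0 => j _; apply: (ip_ge0 QP).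
have XX : fro Q X X = c ^+ 2 * \sum_i f i ^+ 2.
  rewrite (froE QP _ _ eP) big_split_ord /= [X in _ + X]big1 ?addr0 => [|i _]; last first.
    by rewrite Xe phir scale0r (ip0l QP).
  rewrite mulr_sumr; apply: eq_bigr => i _; rewrite Xe phil (ipZl QP) (ipZr QP).
  by case: eP => -> _; rewrite eqxx mulr1; ring.
(* The weight bound at kappa = -c reads 2 |F|^2 minus the norm squared of the s block of F <= |X|^2,
   because -c tr E = |F|^2. *)
have FF_le : fro Q F F <= fro Q X X.
  by move: lb; rewrite trE_s XX sqrrN; lra.
have trX : tr X = - c * \sum_i f i ^+ 2.
  rewrite f2 (trE QP eP) big_split_ord /= [X in _ + X]big1 ?addr0 => [|i _]; last first.
    by rewrite Xe phir scale0r (ip0l QP).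
  rewrite mulr_sumr; apply: eq_bigr => i _; rewrite Xe phil (ipZl QP).
  by case: eP => -> _; rewrite eqxx mulr1.
have TX : (T \o X = 0)%VF.
  apply: (eq_on_onb eP) => i.
  rewrite comp_lfunE Xe linearZ zero_lfunE /=; have := phi0 i; rewrite le_eqVlt => /orP[/eqP <-|/phis].
    by rewrite scale0r.
  by rewrite memv_ker => /eqP ->; rewrite scaler0.
have PX : (P \o X = X)%VF.
  apply: (eq_on_onb eP) => i.
  rewrite comp_lfunE Xe linearZ /=; have := phi0 i; rewrite le_eqVlt => /orP[/eqP <-|/phis].
    by rewrite !scale0r.
  by move/radical_p => ep'; rewrite (P_id PP).
have XP : (X \o P = X)%VF by have := congr1 adj PX; rewrite (adj_comp QP) sX (orthoproj_adj QP PP).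
have trMX : tr (M \o X)%VF = c * tr X + fro Q F X.
  by rewrite trM PX XP TX (tr0 QP) mulr0 addr0 /fro (sympart_adj QP).
have sP x : x \in s -> P x = x by move/radical_p => xp; rewrite (P_id PP).
(* The weights are superadditive on all structure constants, mixed ones included: the radical is an
   ideal, and bracketing with outside elements, of weight 0, does not lower weights. *)
have case_ge i j l : Q (mu (e i) (e j)) (e l) != 0 -> phi i + phi j <= phi l.
  have el x a : Q (P x) (e (lshift m a)) = Q x (e (lshift m a)) by rewrite (P_sym PP) sP.
  case: (split_ordP i) => a ->; case: (split_ordP j) => b ->; case: (split_ordP l) => d ->;
    rewrite ?phil ?phir ?add0r ?addr0.
  - rewrite /pmu el !sP // => h; rewrite -mulrDr ler_wpM2l ?(ltW k0) //; exact: fij h.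
  - by rewrite /pmu !sP ?ep ?eqxx //; apply: radical_ideal.
  - rewrite /pmu el (brC brL) (sP _ (es a)) (ipNl QP) oppr_eq0 => h.
    by rewrite ler_wpM2l ?(ltW k0) //; apply: fj h.
  - rewrite /pmu (brC brL) linearN /= (sP _ (es a)) (ipNl QP) oppr_eq0.
    by rewrite (sP (br _ _)) ?ep ?eqxx //; apply: radical_ideal.
  - rewrite /pmu el (sP _ (es b)) => h.
    by rewrite ler_wpM2l ?(ltW k0) //; apply: fj h.
  - rewrite /pmu (sP _ (es b)).
    by rewrite (sP (br _ _)) ?ep ?eqxx //; apply: radical_ideal.
  - by move=> _; rewrite mulr_ge0 // ltW.
  - by [].
have mD := ndot_act_diag QP eP muB Xe sX.
have mX := moment_act mr PP TP vE eP (sd_mom sd eP) X.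
have term_ge0 i j l : 0 <= (phi l - phi i - phi j) * Q (mu (e i) (e j)) (e l) ^+ 2.
  have [->|/case_ge h] := eqVneq (Q (mu (e i) (e j)) (e l)) 0; first by rewrite expr0n mulr0.
  by rewrite mulr_ge0 ?sqr_ge0 //; lra.
have nd0 : 0 <= ndot Q e (act X mu) mu.
  by rewrite mD; apply: sumr_ge0 => i _; apply: sumr_ge0 => j _; apply: sumr_ge0 => l _.
(* |F - X|^2 = |F|^2 - 2 <F, X> + |X|^2, with |F|^2 <= |X|^2 <= <F, X>. *)
have FX0 : F - X = 0.
  apply: (ip_eq0 (fro_inner_product QP)); apply/le_anti; rewrite (ip_ge0 (fro_inner_product QP)) andbT.
  rewrite (ipBl (fro_inner_product QP)) !(ipBr (fro_inner_product QP)).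
  rewrite (ip_sym (fro_inner_product QP) X F).
  have : fro Q X X <= fro Q F X.
    rewrite mX trMX trX in nd0; rewrite XX; nra.
  by lra.
have FX : F = X by apply/eqP; rewrite -subr_eq0 FX0.
(* With F = X the pairing of X.mu with mu is zero although all its terms are nonnegative, so
   superadditivity is an equality. *)
have M0 : ndot Q e (act X mu) mu = 0.
  have : fro Q F X = fro Q X X by rewrite FX.
  by rewrite mX trMX trX XX => ->; ring.
exists (n + m)%N, e, phi; split=> //; first by rewrite FX.
move=> i j l h; move/eqP: M0; rewrite mD psumr_eq0 => [/allP/(_ i (mem_index_enum i))|i' _]; last first.
  by apply: sumr_ge0 => j' _; apply: sumr_ge0 => l' _.
rewrite psumr_eq0 => [/allP/(_ j (mem_index_enum j))|j' _]; last first.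
  by apply: sumr_ge0 => l' _.
rewrite psumr_eq0 => [/allP/(_ l (mem_index_enum l))|l' _] //.
by rewrite mulf_eq0 sqrf_eq0 (negbTE h) orbF => /eqP; lra.
Qed.

End Structure.

Lemma lower_central_sub (R : realType) (V : vectType R) (br : {bilinear V -> V -> V})
    (a : {vspace V}) (U : nat -> {vspace V}) m :
  (a <= U 0%N)%VS -> (forall i x y, x \in a -> y \in U i -> br x y \in U i.+1) ->
  (lower_central br a m <= U m)%VS.
Proof.
move=> a0 aU; elim: m => // m IH; rewrite /lower_central iterS -/(lower_central br a m).
apply/span_subvP => _ /allpairsP[[x y] /= [xa ya ->]].
by apply: aU; [apply: vbasis_mem | apply: (subvP IH); apply: vbasis_mem].
Qed.

(** * F as a derivation, and its image *)

Section Structure.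
Variables (R : realType) (V : vectType R) (br : {bilinear V -> V -> V}).
Variables (k p : {vspace V}) (Q : {dot V for idfun}) (P T E : 'End(V)) (c : R).
Hypothesis sd : soliton_data br k p Q P T E c.
Local Notation B := (killing br).
Local Notation adj := (adjoint Q).
Local Notation F := (sympart Q E).
Local Notation mu := (pmu br P).
Let QP := dot_inner_product Q.
Let mr := sd_mr sd.
Let brL := mr_lie mr.
Let PP := sd_P sd.
Let vE := sd_v sd.
Let dE := sd_d sd.
Let muB := pmu_bilin br P.
Let bB := br_bilin br.
Let vF : vertical k p F := vertical_sympart mr PP vE.
Let Fs : adj F = F := sympart_adj QP E.

Lemma F_radical x : F x \in lker T.
Proof.
have [n [e [phi [eP Fe f0 fs _]]]] := F_diag sd.
rewrite (onb_expand eP x) linear_sum; apply: memv_suml => i _; rewrite linearZ /=.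
apply: memvZ; rewrite Fe; have := f0 i; rewrite le_eqVlt => /orP[/eqP <-|/fs h].
  by rewrite scale0r mem0v.
exact: memvZ.
Qed.

Lemma F_deriv_pmu : derivation mu F.
Proof.
have [n [e [phi [eP Fe f0 fs fd]]]] := F_diag sd.
apply/act_deriv; apply: (ndot_eq0 QP eP (act_bilin QP F muB)).
rewrite /ndot big1 // => i _; rewrite big1 // => j _.
rewrite (onb_parseval QP eP) big1 // => l _.
suff -> : Q (act F mu (e i) (e j)) (e l) = 0 by rewrite mulr0.
rewrite /act !Fe (bilinZl muB) (bilinZr muB) !(ipBl QP) !(ipZl QP) (adjE QP) Fs Fe (ipZr QP).
have [->|/fd ->] := eqVneq (Q (mu (e i) (e j)) (e l)) 0; first by rewrite !mulr0 !subr0.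
ring.
Qed.

Lemma deriv_comm_ad_k X z x : derivation br X -> vertical k p X -> z \in k -> X (br z x) = br z (X x).
Proof. by move=> dX [Xk _] zk; rewrite dX Xk // linear0l add0r. Qed.

(** A vertical derivation commutes with [ad z]; as [ad z] is skew, so does its adjoint. *)
Lemma sympart_comm_ad_k X z x : derivation br X -> vertical k p X -> z \in k ->
  sympart Q X (br z x) = br z (sympart Q X x).
Proof.
move=> dX vX zk; have c1 : (X \o ad br z = ad br z \o X)%VF.
  by apply/lfunP => y; rewrite !comp_lfunE !adE deriv_comm_ad_k.
have c2 : (adj X \o ad br z = ad br z \o adj X)%VF.
  have := congr1 adj c1; rewrite !(adj_comp QP) (ad_k_skew mr zk) comp_lfunNl comp_lfunNr => /eqP.
  by rewrite eqr_opp => /eqP.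
have c2x : adj X (br z x) = br z (adj X x) by rewrite -!adE -!comp_lfunE c2.
by rewrite /sympart !scale_lfunE !add_lfunE c2x deriv_comm_ad_k // linearZr linearDr.
Qed.

(** A derivation of the p-bracket controls only p-components. The last hypothesis says that the
    right side of the Leibniz rule has no k-component, and the left side has none because [X] maps
    into p. *)
Lemma deriv_of_pmu X : vertical k p X -> derivation mu X ->
  (forall z x, z \in k -> X (br z x) = br z (X x)) ->
  (forall x y, x \in p -> y \in p -> br (X x) y + br x (X y) \in p) -> derivation br X.
Proof.
move=> [Xk Xp] dX Xz Xw x y.
have [z [x' [zk xp ->]]] := decomp mr PP x; have [w [y' [wk yp ->]]] := decomp mr PP y.
have e1 : X (br x' y') = br (X x') y' + br x' (X y').
  have -> : X (br x' y') = X (P (br x' y')).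
    rewrite -[in LHS](subrK (P (br x' y')) (br x' y')) linearD /=.
    by rewrite (Xk _ (K_in mr PP _)) add0r.
  have := dX x' y'; rewrite /pmu (P_id PP xp) (P_id PP yp) (P_id PP (Xp _ xp)) (P_id PP (Xp _ yp)) => ->.
  by rewrite -linearD /= (P_id PP) // Xw.
have ew : X (br x' w) = br (X x') w.
  by rewrite (brC brL x' w) linearN /= (Xz w x' wk) -(brC brL).
rewrite !(raddfD X) /= (Xk z zk) (Xk w wk) !add0r !(bilinDl bB) !(bilinDr bB) !(raddfD X) /=.
rewrite (Xz z w zk) (Xk w wk) (bilin0r bB) add0r (Xz z y' zk) e1 ew.
by vec QP.
Qed.

Lemma F_deriv : derivation br F.
Proof.
apply: deriv_of_pmu vF F_deriv_pmu _ _ => [z x zk|x y xp yp].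
  exact: sympart_comm_ad_k.
apply: (radical_p sd); apply: memvD.
  by rewrite (brC brL) memvN; apply/(radical_ideal sd)/F_radical.
exact/(radical_ideal sd)/F_radical.
Qed.

(** [F] grades the algebra by its nonnegative eigenvalues, and its image is the part of positive
    degree. Each bracket with it raises the degree by at least the smallest positive eigenvalue. *)
Lemma im_F : ideal br (limg F) /\ nilpotent br (limg F).
Proof.
have [n [e [phi [eP Fe f0 fs _]]]] := F_diag sd.
(* The default 1 is taken when [F] has no positive eigenvalue. *)
have [l0 l0p lmin] : exists2 l0, 0 < l0 & forall i, 0 < phi i -> l0 <= phi i.
  case: (pickP (fun i => 0 < phi i)) => [i ip|h]; last first.
    by exists 1 => // i; rewrite h.
  case: (@arg_minP _ _ _ i (fun i => 0 < phi i) phi ip) => j jp jm.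
  by exists (phi j).
have [e1 _] := eP.
have grade i j l : Q (br (e i) (e j)) (e l) != 0 -> phi l = phi i + phi j.
  move=> h; have := F_deriv (e i) (e j); rewrite !Fe linearZl linearZr /= => /(congr1 (Q^~ (e l))).
  rewrite (adjE QP) Fs Fe (ipZr QP) (ipDl QP) !(ipZl QP) -mulrDl => /eqP.
  by rewrite -subr_eq0 -mulrBl mulf_eq0 (negbTE h) orbF subr_eq0 => /eqP.
(* The factor m + 1 makes [U 0] the whole image of [F], where the lower central series starts. *)
pose I m := [seq e i | i <- enum 'I_n & m.+1%:R * l0 <= phi i].
pose U m := <<I m>>%VS.
have UP m x : (forall i, Q x (e i) != 0 -> m.+1%:R * l0 <= phi i) -> x \in U m.
  move=> h; rewrite (onb_expand eP x); apply: memv_suml => i _.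
  have [->|/h hi] := eqVneq (Q x (e i)) 0; first by rewrite scale0r mem0v.
  by apply/memvZ/memv_span/map_f; rewrite mem_filter hi mem_enum.
have imU0 x : x \in limg F -> x \in U 0%N.
  move=> /memv_imgP[y _ ->]; apply: UP => i; rewrite mul1r (adjE QP) Fs Fe (ipZr QP) mulf_eq0 negb_or.
  by case/andP => fi _; apply: lmin; rewrite lt_def fi f0.
have brU m x y i : y \in U m -> (forall j, Q x (e j) != 0 -> i <= phi j) ->
    forall l, Q (br x y) (e l) != 0 -> i + m.+1%:R * l0 <= phi l.
  move=> ym xi l; apply: contraNT; rewrite -ltNge => lt.
  have [cf ->] := span_seqP ym; apply/eqP; rewrite big_mkord linear_sumr (ip_suml QP) big1 // => a _.
  rewrite linearZr /= (ipZl QP); have : (I m)`_a \in I m by rewrite mem_nth.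
  case/mapP => j; rewrite mem_filter => /andP[mj _] ->.
  rewrite (onb_expand eP x) linear_sumlz (ip_suml QP) big1 ?mulr0 // => b _.
  rewrite linearZl_LR /= (ipZl QP); have [->|/xi xb] := eqVneq (Q x (e b)) 0; first by rewrite mul0r.
  apply/eqP; rewrite mulf_eq0 orbC; apply/orP; left; apply/contraT => /grade pl.
  by move: lt; rewrite pl ltNge lerD.
have U0im x : x \in U 0%N -> x \in limg F.
  move=> /span_seqP[cf ->]; rewrite big_mkord; apply: memv_suml => a _; apply: memvZ.
  have : (I 0%N)`_a \in I 0%N by rewrite mem_nth.
  case/mapP => j; rewrite mem_filter mul1r => /andP[mj _] ->.
  have pj : phi j != 0 by rewrite gt_eqF // (lt_le_trans l0p).
  by apply/memv_imgP; exists ((phi j)^-1 *: e j); rewrite ?memvf // linearZ /= Fe scalerA mulVf // scale1r.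
split.
  move=> x y /imU0 yU; apply: U0im; apply: UP => l h.
  have := brU 0%N x y 0 yU _ l h; rewrite add0r; apply=> j _; exact: f0.
pose bd := \sum_i phi i.
have bdP i : phi i <= bd by rewrite /bd (bigD1 i) //= lerDl sumr_ge0.
(* [bd] exceeds every eigenvalue, so for this [m] no generator of [U m] is left. *)
pose m := Num.bound (bd / l0).
exists m; apply/eqP; rewrite -subv0; apply: (@subv_trans _ _ (U m)).
  apply: (lower_central_sub (U := U)); first by apply/subvP => x /imU0.
  move=> i x y /imU0 xU yU; apply: UP => l h.
  have := brU i x y l0 yU _ l h.
  have -> : l0 + i.+1%:R * l0 = i.+2%:R * l0 by rewrite [in RHS]mulrSr mulrDl mul1r addrC.
  apply=> j; have [cf ->] := span_seqP xU; apply: contraNT; rewrite -ltNge => lt; apply/eqP.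
  rewrite big_mkord (ip_suml QP) big1 // => a _; rewrite (ipZl QP).
  have : (I 0%N)`_a \in I 0%N by rewrite mem_nth.
  case/mapP => b; rewrite mem_filter mul1r => /andP[mb _] ->.
  rewrite e1; have [bj|_] := eqVneq b j; last by rewrite mulr0.
  by move: lt; rewrite -bj ltNge mb.
apply/span_subvP => v /mapP[j]; rewrite mem_filter => /andP[mj _] _.
have : m.+1%:R * l0 <= bd by apply: le_trans mj (bdP j).
rewrite -ler_pdivlMr // leNgt => /negP[].
have b0 : 0 <= bd / l0 by rewrite divr_ge0 ?sumr_ge0 // ltW.
by apply: lt_trans (archi_boundP b0) _; rewrite ltr_nat.
Qed.
End Structure.

(** * The nilradical is the image of F *)

Lemma normal_nilpotent (R : realType) (V : vectType R) (Q : V -> V -> R) (A : 'End(V)) m :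
  inner_product Q -> normal Q A -> (forall x, iter m A x = 0) -> A = 0.
Proof.
move=> QP nA; case: m => [|m] Am; first by apply/lfunP => x; rewrite zero_lfunE; apply: (Am (A x)).
have ker x : A (A x) = 0 -> A x = 0.
  move=> AAx; apply: (ip_eq0 QP); rewrite (adjE QP).
  have -> : adjoint Q A (A x) = 0; last exact: (ip0r QP).
  apply: (ip_eq0 QP); rewrite -(adjE QP) -comp_lfunE nA comp_lfunE AAx.
  by rewrite linear0 (ip0l QP).
elim: m Am => [|m IH] Am; first by apply/lfunP => x; rewrite zero_lfunE; apply: Am.
by apply: IH => x; rewrite iterS; apply: ker; rewrite -!iterS.
Qed.

Lemma tr_square_zero (R : realType) (V : vectType R) (Q : V -> V -> R) (A : 'End(V)) :
  inner_product Q -> (forall x, A (A x) = 0) -> lftrace A = 0.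
Proof.
move=> QP AA; have [n [m [e [eP el er]]]] := adapted_onb QP (lker A).
rewrite (trE QP eP) big1 // => i _; case: (split_ordP i) => j ->.
  by have := el j; rewrite memv_ker => /eqP ->; rewrite (ip0l QP).
by apply: er; rewrite memv_ker AA.
Qed.

Definition lcomm (R : realType) (V : vectType R) (A B : 'End(V)) : 'End(V) :=
  (A \o B)%VF - (B \o A)%VF.

Lemma lcommE (R : realType) (V : vectType R) (A B : 'End(V)) x : lcomm A B x = A (B x) - B (A x).
Proof. by rewrite add_lfunE opp_lfunE !comp_lfunE. Qed.

Lemma lcomm_lin (R : realType) (V : vectType R) (A : 'End(V)) : linear (lcomm A).
Proof.
move=> b X Y; rewrite /lcomm comp_lfunDl comp_lfunDr -comp_lfunZl -comp_lfunZr scalerBr.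
by rewrite opprD addrACA.
Qed.

Lemma lcomm_lin_l (R : realType) (V : vectType R) (X : 'End(V)) : linear (fun A => lcomm A X).
Proof.
move=> b A B; rewrite /lcomm comp_lfunDl comp_lfunDr -comp_lfunZl -comp_lfunZr scalerBr.
by rewrite opprD addrACA.
Qed.

Section LowerCentral.
Variables (R : realType) (V : vectType R) (br : {bilinear V -> V -> V}).
Hypothesis brL : lie_bracket br.

Lemma bracket_spaceP (a b : {vspace V}) x y : x \in a -> y \in b -> br x y \in bracket_space br a b.
Proof.
move=> xa yb; rewrite (coord_vbasis xa) linear_sumlz; apply: memv_suml => i _.
rewrite linearZl_LR; apply: memvZ; rewrite (coord_vbasis yb) linear_sumr; apply: memv_suml => j _.
rewrite linearZr; apply/memvZ/memv_span/allpairsP; exists ((vbasis a)`_i, (vbasis b)`_j).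
by split; rewrite ?mem_nth ?size_tuple.
Qed.

Lemma ad_nilpotent (a : {vspace V}) x : ideal br a -> nilpotent br a -> x \in a -> exists m, forall y, iter m (br x) y = 0.
Proof.
move=> aI [m am] xa; exists m.+1 => y; apply/eqP; rewrite -memv0 -am {am}.
elim: m => [|m IH]; first by rewrite /= (brC brL) memvN; apply: aI.
by rewrite iterS; apply: bracket_spaceP.
Qed.

(** Any nonzero vector in the last nonzero term of the lower central series is central. *)
Lemma nilpotent_center (a n0 : {vspace V}) : nilpotent br a -> (n0 <= a)%VS -> n0 != 0%VS ->
  (forall x y, x \in n0 -> y \in n0 -> br x y \in n0) ->
  exists x, [/\ x != 0, x \in n0 & forall y, y \in n0 -> br y x = 0].
Proof.
move=> [m am] n0a n00 n0n0.
have W0 : lower_central br n0 m = 0%VS.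
  apply/eqP; rewrite -subv0 -am; elim: m {am} => // m IH.
  apply/span_subvP => _ /allpairsP[[x y] /= [xa ya ->]].
  apply: bracket_spaceP; first by apply: (subvP n0a); apply: vbasis_mem.
  by apply: (subvP IH); apply: vbasis_mem.
have sub j : (lower_central br n0 j <= n0)%VS.
  elim: j => // j IH; apply/span_subvP => _ /allpairsP[[x y] /= [xa ya ->]].
  apply: n0n0; first exact: vbasis_mem.
  by apply: (subvP IH); apply: vbasis_mem.
elim: m {am} W0 => [|m IH] W0; first by move: n00; rewrite -[n0]/(lower_central br n0 0) W0 eqxx.
have [/IH//|Wm] := eqVneq (lower_central br n0 m) 0%VS.
exists (vpick (lower_central br n0 m)); split.
- by rewrite vpick0.
- exact: (subvP (sub m) _ (memv_pick _)).
- move=> y yn; apply/eqP; rewrite -memv0 -W0; apply: bracket_spaceP => //; exact: memv_pick.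
Qed.
End LowerCentral.

(** * The action of ker F on the ideal im F *)

Section Fiber.
Variables (R : realType) (V : vectType R) (br : {bilinear V -> V -> V}).
Variables (k p : {vspace V}) (Q : {dot V for idfun}) (P T E : 'End(V)) (c : R).
Hypothesis sd : soliton_data br k p Q P T E c.
Local Notation tr := (@lftrace R V).
Local Notation adj := (adjoint Q).
Local Notation F := (sympart Q E).
Local Notation mu := (pmu br P).
Local Notation M := (moment_operator Q P T E c).
Local Notation fr X := (fro Q X X).
Local Notation a := (limg F).
Local Notation u := (lker F).
Let QP := dot_inner_product Q.
Let FP := fro_inner_product QP.
Let mr := sd_mr sd.
Let brL := mr_lie mr.
Let PP := sd_P sd.
Let TP := sd_T sd.
Let vE := sd_v sd.
Let dE := sd_d sd.
Let muB := pmu_bilin br P.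
Let bB := br_bilin br.
Let vF : vertical k p F := vertical_sympart mr PP vE.
Let Fs : adj F = F := sympart_adj QP E.
Variable N : 'End(V).
Hypothesis NP : orthoproj Q a N.

Lemma N_im x : x \in a -> N x = x. Proof. by case: NP => _ _ /(_ x). Qed.
Lemma N_in x : N x \in a. Proof. by case: NP => _ /(_ x). Qed.
Lemma N_ker x : x \in u -> N x = 0.
Proof.
rewrite memv_ker => /eqP Fx; apply: (orthoproj_ker QP NP) => y /memv_imgP[z _ ->].
by rewrite -Fs -(adjE QP) Fx (ip0l QP).
Qed.
Lemma N_compl x : x - N x \in u.
Proof.
rewrite memv_ker; apply/eqP/(ip_inj QP) => y; rewrite (adjE QP) Fs (ip0l QP).
by apply: (orthoproj_perp QP _ NP); rewrite memv_img ?memvf.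
Qed.
Lemma N_adj : adj N = N. Proof. exact: (orthoproj_adj QP NP). Qed.
Lemma im_p x : x \in a -> x \in p.
Proof.
move=> /memv_imgP[y _ ->]; exact: (radical_p sd (F_radical sd y)).
Qed.
Lemma im_ideal : ideal br a. Proof. by case: (im_F sd). Qed.
Lemma FN x : F (N x) = F x.
Proof.
have := N_compl x; rewrite memv_ker linearB subr_eq0 => /eqP ->; by [].
Qed.
Lemma NF x : N (F x) = F x. Proof. by rewrite N_im // memv_img ?memvf. Qed.
Lemma F_ad x y : x \in u -> F (br x y) = br x (F y).
Proof. by rewrite memv_ker => /eqP Fx; rewrite (F_deriv sd) Fx linear0l add0r. Qed.
Lemma u_sub x y : x \in u -> y \in u -> br x y \in u.
Proof.
move=> xu; rewrite !memv_ker => /eqP yu; by rewrite F_ad // yu linear0r.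
Qed.
Lemma u_P x : x \in u -> P x \in u.
Proof.
have [FPP PF] := verticalE mr PP vF.
by rewrite !memv_ker -comp_lfunE FPP.
Qed.

(** The restriction of [ad x] to the ideal im F, extended by zero on ker F. *)
Definition fad x : 'End(V) := (ad br x \o N)%VF.

Lemma fadE x y : fad x y = br x (N y). Proof. by rewrite comp_lfunE adE. Qed.
Lemma fad_linear : linear fad.
Proof. by move=> b x y; rewrite /fad ad_linear comp_lfunDl comp_lfunZl. Qed.
Lemma fad_N x : (fad x \o N = fad x)%VF /\ (N \o fad x = fad x)%VF.
Proof.
split; apply/lfunP => y; rewrite !comp_lfunE ?adE; first by rewrite (N_im (N_in y)).
by rewrite N_im //; apply: im_ideal; apply: N_in.
Qed.
Lemma fad_br x y : x \in u -> y \in u -> fad (br x y) = lcomm (fad x) (fad y).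
Proof.
move=> xu yu; apply/lfunP => w; rewrite lcommE !comp_lfunE !adE.
rewrite !(N_im (im_ideal _ (N_in _))).
by rewrite (jacobi brL x y) addrK.
Qed.
Lemma fad_F x : x \in u -> (F \o fad x = fad x \o F)%VF.
Proof.
move=> xu; apply/lfunP => y; rewrite !comp_lfunE !adE F_ad // FN NF //.
Qed.

Lemma act_fiber X x y : (X \o N = X)%VF -> (N \o X = X)%VF -> x \in u ->
  act X mu x y = lcomm X (fad (P x)) y.
Proof.
move=> XN NX xu; have Xu z : z \in u -> X z = 0 by move=> zu; rewrite -XN comp_lfunE N_ker ?linear0.
have Xin z : X z \in a by rewrite -NX comp_lfunE N_in.
have PXz z : P (X z) = X z by rewrite (P_id PP) // im_p.
rewrite /act lcommE !comp_lfunE !adE (Xu x xu) (bilin0l muB) subr0.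
rewrite /pmu PXz (P_id PP (im_p (im_ideal (P x) (Xin y)))) (N_im (Xin y)).
congr (_ - _).
have PNy : P (N y) = N y by rewrite (P_id PP) // im_p // N_in.
have yE : y = (y - N y) + N y by rewrite subrK.
rewrite {1}yE linearD /= PNy (bilinDr bB) linearD /= linearD /= Xu ?add0r; last first.
  by apply/u_P/u_sub; apply: u_P => //; apply: N_compl.
by rewrite (P_id PP) //; apply/im_p/im_ideal/N_in.
Qed.

Section Basis.
Variables (n m : nat) (e : 'I_(n + m) -> V).
Hypothesis eP : onb Q e.
Hypothesis el : forall i, e (lshift m i) \in a.
Hypothesis er : forall i x, x \in a -> Q x (e (rshift n i)) = 0.

Lemma er_u i : e (rshift n i) \in u.
Proof.
rewrite memv_ker; apply/eqP/(ip_inj QP) => y; rewrite (adjE QP) Fs (ip0l QP) (ip_sym QP).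
by apply: er; rewrite memv_img ?memvf.
Qed.

(** Pairs from ker F contribute nothing, and the two orders of a mixed pair contribute equally by
    skew symmetry, whence the factor 2. *)
Lemma ndot_act_fiber X : (X \o N = X)%VF -> (N \o X = X)%VF ->
  ndot Q e (act X mu) (act X mu) =
  \sum_i \sum_j Q (act X mu (e (lshift m i)) (e (lshift m j))) (act X mu (e (lshift m i)) (e (lshift m j))) +
  2 * \sum_i fr (lcomm X (fad (P (e (rshift n i))))).
Proof.
move=> XN NX; rewrite /ndot big_split_ord /=.
pose G i j := Q (act X mu (e i) (e j)) (act X mu (e i) (e j)).
have GC i j : G i j = G j i.
  have aC x y : act X mu x y = - act X mu y x.
    rewrite /act (pmuC mr P x y) (pmuC mr P (X x)) (pmuC mr P x) linearN /=; vec QP.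
  by rewrite /G aC (ipNl QP) (ipNr QP) opprK.
have uE i : \sum_j G (rshift n i) j = fr (lcomm X (fad (P (e (rshift n i))))).
  rewrite (froE QP _ _ eP); apply: eq_bigr => j _.
  by rewrite /G act_fiber // er_u.
have uE' i : \sum_(j < n) G (rshift n i) (lshift m j) = \sum_j G (rshift n i) j.
  rewrite [RHS]big_split_ord /= [X in _ + X]big1 ?addr0 // => j _.
  have Xe : X (e (rshift n j)) = 0 by rewrite -XN comp_lfunE (N_ker (er_u j)) linear0.
  by rewrite /G act_fiber ?er_u // lcommE !fadE Xe (N_ker (er_u j)) ?(raddf0 N) !(bilin0r bB) (raddf0 X) subr0 (ip0l QP).
rewrite -/(G _ _).
under eq_bigr do rewrite big_split_ord /=.
rewrite big_split /= -addrA; congr (_ + _).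
rewrite exchange_big /=.
under eq_bigr do under eq_bigr do rewrite -/(G _ _) GC.
under eq_bigr do rewrite uE' uE.
rewrite mulr2n mulrDl mul1r; congr (_ + _).
by apply: eq_bigr => i _; rewrite -uE.
Qed.

Lemma TN : (T \o N = 0)%VF.
Proof.
apply/lfunP => x; rewrite comp_lfunE zero_lfunE; have /memv_imgP[y _ ->] := N_in x.
by have := F_radical sd y; rewrite memv_ker => /eqP.
Qed.

(** On the image of [F] the Killing term vanishes, a commutator is traceless, and [F] commutes with
    [X]. *)
Lemma trM_fiber_comm X : (X \o N = X)%VF -> (N \o X = X)%VF -> (F \o X = X \o F)%VF ->
  tr (M \o lcomm X (adj X))%VF = 0.
Proof.
move=> XN NX FX; rewrite trM.
have PN : (P \o N = N)%VF by apply/lfunP => x; rewrite comp_lfunE (P_id PP) // im_p // N_in.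
have aN : adj N = N := N_adj; have aX : (N \o adj X = adj X)%VF.
  by have := congr1 adj XN; rewrite (adj_comp QP) aN.
have aX' : (adj X \o N = adj X)%VF by have := congr1 adj NX; rewrite (adj_comp QP) aN.
have NL : (N \o lcomm X (adj X) = lcomm X (adj X))%VF.
  by rewrite comp_lfunBr !comp_lfunA NX aX.
have PL : (P \o lcomm X (adj X) = lcomm X (adj X))%VF by rewrite -NL comp_lfunA PN.
have T0 : (T \o (lcomm X (adj X) \o P) = 0)%VF by rewrite -NL !comp_lfunA TN !comp_lfun0l.
rewrite PL T0 (tr0 QP) mulr0 addr0.
have -> : tr (lcomm X (adj X)) = 0 by rewrite (trB QP) (tr_comp QP) subrr.
rewrite mulr0 add0r comp_lfunBr (trB QP).
have -> : tr (F \o (adj X \o X))%VF = tr (F \o (X \o adj X))%VF.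
  by rewrite comp_lfunA (tr_comp QP) !comp_lfunA FX.
by rewrite subrr.
Qed.

Lemma fro_lcomm A C C' : fro Q (lcomm (adj A) C) C' = fro Q C (lcomm A C').
Proof.
rewrite /fro (adjB QP) !(adj_comp QP) (adjK QP) comp_lfunBl comp_lfunBr !(trB QP).
rewrite !comp_lfunA; congr (_ - _).
by rewrite -[in LHS]comp_lfunA; apply: (tr_comp QP).
Qed.

Lemma fro_adj A : fr (adj A) = fr A.
Proof. by rewrite /fro (adjK QP) (tr_comp QP). Qed.

Lemma adj_lcomm A C : adj (lcomm (adj A) C) = lcomm (adj C) A.
Proof. by rewrite (adjB QP) !(adj_comp QP) (adjK QP). Qed.

Lemma ndot_fad_adj x : x \in u -> ndot Q e (act (adj (fad x)) mu) (act (adj (fad x)) mu) =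
  ndot Q e (act (fad x) mu) (act (fad x) mu).
Proof.
move=> xu; apply/eqP; rewrite -subr_eq0 -(ndot_act_comm QP eP) //.
have [XN NX] := fad_N x.
rewrite (moment_act mr PP TP vE eP (sd_mom sd eP)) -/(lcomm (fad x) (adj (fad x))).
by rewrite trM_fiber_comm ?mulr0 // fad_F.
Qed.

Lemma act_fad_im x y w : y \in a -> w \in a -> act (fad x) mu y w = 0.
Proof.
move=> ya wa; have PI v : v \in a -> P v = v by move=> va; rewrite (P_id PP) // im_p.
have xI v v' : v \in a -> br v' v \in a by apply: im_ideal.
rewrite /act /pmu !fadE !(N_im ya, N_im wa) !(PI _ ya, PI _ wa, PI _ (xI _ _ _), xI) //.
by rewrite !N_im ?xI // (jacobi brL x) -addrA -opprD subrr.
Qed.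

(* [tr (M [X, X^t]) = 0] makes the norms of [act X mu] and [act X^t mu] equal for [X = fad x].
   Summed over an orthonormal basis of [Z = fad z], this bounds the norms of the commutators
   [[(fad y)^t, X]] by those of [[fad y, X]], the norms of their projections to [Z]; so the
   former already lie in [Z]. *)
Lemma fiber_abelian_normal (z : {vspace V}) :
  (z <= u)%VS -> (z <= p)%VS -> (forall x y, y \in u -> x \in z -> br y x \in z) ->
  (forall x y, x \in z -> y \in z -> br x y = 0) ->
  forall x, x \in z -> normal Q (fad x).
Proof.
move=> zu zp zI zz.
pose A i := fad (P (e (rshift n i))).
have Piu i : P (e (rshift n i)) \in u by apply/u_P/er_u.
pose Z := (linfun fad @: z)%VS : {vspace 'End(V)}.
have ZP X : X \in Z <-> exists2 x, x \in z & X = fad x.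
  split=> [/memv_imgP[x xz ->]|[x xz ->]]; first by exists x; rewrite // (linfun_linear fad_linear).
  by apply/memv_imgP; exists x; rewrite // (linfun_linear fad_linear).
have AZ y X : y \in u -> X \in Z -> lcomm (fad y) X \in Z.
  move=> yu /ZP[x xz ->]; apply/ZP; exists (br y x); first exact: zI.
  by rewrite fad_br // (subvP zu).
have [d [B [B1 B2 B3]]] := orthonormal_basis FP Z.
have [pr prP] := orthoproj_exists FP Z; have [prs pri prid] := prP.
have prE X : pr X = \sum_l fro Q X (B l) *: B l.
  by rewrite {1}(B3 _ (pri X)); apply: eq_bigr => l _; rewrite prs prid.
have frpr X : fr (pr X) = \sum_l fro Q X (B l) ^+ 2.
  rewrite {1}prE (ip_suml FP); apply: eq_bigr => l _.
  by rewrite (ipZl FP) -prs prid // (ip_sym FP (B l)) expr2.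
have pyth X : fr X = fr (pr X) + fr (X - pr X).
  have o : fro Q (X - pr X) (pr X) = 0 := orthoproj_perp FP X prP (pri X).
  have XE : X = (X - pr X) + pr X by rewrite subrK.
  move: (X - pr X) o XE => Y o XE; rewrite [in LHS]XE.
  by rewrite (ipDl FP) !(ipDr FP) (ip_sym FP (pr X) Y) o add0r addr0 addrC.
(* In the Frobenius inner product, commutators with an operator and with its adjoint are adjoint.
   Hence on [Z] the compressed map for the adjoint is the transpose of commutation with [fad y], and
   both have the same Hilbert-Schmidt norm; the remaining sum is the part leaving [Z]. *)
have key1 y : y \in u -> \sum_l fr (lcomm (adj (fad y)) (B l)) =
   \sum_l fr (lcomm (fad y) (B l)) + \sum_l fr (lcomm (adj (fad y)) (B l) - pr (lcomm (adj (fad y)) (B l))).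
  move=> yu; rewrite (eq_bigr _ (fun l _ => pyth _)) big_split /=; congr (_ + _).
  under eq_bigr do rewrite frpr.
  rewrite exchange_big /=; apply: eq_bigr => l _.
  have := frpr (lcomm (fad y) (B l)); rewrite (prid _ (AZ y _ yu (B2 l))) => ->.
  apply: eq_bigr => j _.
  by rewrite fro_lcomm (ip_sym FP).
(* Write B l = fad x. [fad x] and its adjoint move [mu] by equal amounts, and [fad x] moves no pair
   in im F, so the mixed part for the adjoint is the smaller one. Taking adjoints of commutators
   exchanges the roles of B l and A i. *)
have key2 l : \sum_i fr (lcomm (adj (A i)) (B l)) <= \sum_i fr (lcomm (A i) (B l)).
  have /ZP[x xz Bx] := B2 l; have xu := subvP zu _ xz.
  have [XN NX] := fad_N x.
  have := ndot_fad_adj xu; rewrite !ndot_act_fiber //; last 2 first.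
  - by have := congr1 adj NX; rewrite (adj_comp QP) N_adj.
  - by have := congr1 adj XN; rewrite (adj_comp QP) N_adj.
  rewrite [X in _ = X + _]big1 ?add0r => [h|i _]; last first.
    by rewrite big1 // => j _; rewrite act_fad_im // (ip0l QP).
  have h' : \sum_i fr (lcomm (adj (fad x)) (A i)) <= \sum_i fr (lcomm (fad x) (A i)).
    rewrite -(ler_pM2l (ltr0Sn R 1)) -[leRHS]h lerDr.
    by apply: sumr_ge0 => i _; apply: sumr_ge0 => j _; apply: (ip_ge0 QP).
  rewrite Bx; apply: le_trans (le_trans _ h') _; rewrite le_eqVlt; apply/orP; left; apply/eqP.
    by apply: eq_bigr => i _; rewrite -fro_adj adj_lcomm.
  apply: eq_bigr => i _; rewrite -[lcomm (A i) _]opprK opprB -/(lcomm _ _).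
  by rewrite (ipNl FP) (ipNr FP) opprK.
have defect0 i l : lcomm (adj (A i)) (B l) \in Z.
  have : \sum_i \sum_l fr (lcomm (adj (A i)) (B l) - pr (lcomm (adj (A i)) (B l))) <= 0.
    have : \sum_l \sum_i fr (lcomm (adj (A i)) (B l)) <= \sum_l \sum_i fr (lcomm (A i) (B l)).
      by apply: ler_sum => l' _.
    rewrite exchange_big [X in _ <= X]exchange_big /=.
    rewrite (eq_bigr _ (fun i _ => key1 _ (Piu i))) big_split /=; lra.
  rewrite le_eqVlt ltNge sumr_ge0 ?orbF => [|i' _]; last first.
    by apply: sumr_ge0 => l' _; apply: (ip_ge0 FP).
  rewrite psumr_eq0 => [/allP/(_ i (mem_index_enum i))/=|i' _]; last first.
    by apply: sumr_ge0 => l' _; apply: (ip_ge0 FP).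
  rewrite psumr_eq0 => [/allP/(_ l (mem_index_enum l))/= /eqP/(ip_eq0 FP)/eqP|l' _]; last exact: (ip_ge0 FP).
  by rewrite subr_eq0 => /eqP ->.
move=> x xz.
have xE : x = \sum_i Q x (e (rshift n i)) *: P (e (rshift n i)).
  have xu := subvP zu _ xz; have Px := P_id PP (subvP zp _ xz).
  rewrite -{1}Px {1}(onb_expand eP x) big_split_ord /= big1 ?add0r => [|i _].
    by rewrite linear_sum; apply: eq_bigr => i _; rewrite linearZ.
  have /memv_imgP[y _ ->] := el i.
  by rewrite -Fs -(adjE QP); move: xu; rewrite memv_ker => /eqP ->; rewrite (ip0l QP) scale0r.
have fadx : fad x = \sum_i Q x (e (rshift n i)) *: A i.
  rewrite {1}xE -(linfun_linear fad_linear) linear_sum; apply: eq_bigr => i _.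
  by rewrite linearZ /= (linfun_linear fad_linear).
have inZ l : lcomm (adj (fad x)) (B l) \in Z.
  rewrite fadx; elim/big_rec: _ => [|i X _ h].
    by rewrite (adj0 QP) /lcomm comp_lfun0l comp_lfun0r subrr mem0v.
  by rewrite (adjD QP) (adjZ QP) lcomm_lin_l; apply: memvD => //; apply/memvZ/defect0.
have fxZ : fad x \in Z by apply/ZP; exists x.
have inZ' : lcomm (adj (fad x)) (fad x) \in Z.
  rewrite {2}(B3 _ fxZ); elim/big_rec: _ => [|i X _ h].
    by rewrite /lcomm comp_lfun0l comp_lfun0r subrr mem0v.
  by rewrite lcomm_lin; apply: memvD => //; apply/memvZ.
have /ZP[w wz wE] := inZ'.
(* The commutator is [fad w] with w in z; its square norm equals <fad x, [fad x, fad w]>, which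
   vanishes because z is abelian. *)
have : lcomm (adj (fad x)) (fad x) = 0.
  apply: (ip_eq0 FP); rewrite {2}wE fro_lcomm -fad_br ?(subvP zu) // zz //.
  by rewrite /fad (_ : ad br 0 = 0) ?comp_lfun0l ?(ip0r FP) //; apply/lfunP => v; rewrite adE linear0l zero_lfunE.
by rewrite /lcomm => /eqP; rewrite subr_eq0 => /eqP.
Qed.
End Basis.
End Fiber.

Section Nilradical.
Variables (R : realType) (V : vectType R) (br : {bilinear V -> V -> V}).
Variables (k p : {vspace V}) (Q : {dot V for idfun}) (P T E : 'End(V)) (c : R).
Hypothesis sd : soliton_data br k p Q P T E c.
Local Notation tr := (@lftrace R V).
Local Notation adj := (adjoint Q).
Local Notation F := (sympart Q E).
Local Notation mu := (pmu br P).
Local Notation M := (moment_operator Q P T E c).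
Local Notation a := (limg F).
Local Notation u := (lker F).
Let QP := dot_inner_product Q.
Let FP := fro_inner_product QP.
Let mr := sd_mr sd.
Let brL := mr_lie mr.
Let PP := sd_P sd.
Let TP := sd_T sd.
Let vE := sd_v sd.
Let muB := pmu_bilin br P.
Let bB := br_bilin br.
Variable n : {vspace V}.
Hypothesis nr : nilradical br n.
Hypothesis np : (n <= p)%VS.

Lemma im_sub_nilradical : (a <= n)%VS.
Proof. by case: nr => _ _; apply; case: (im_F sd). Qed.

(** For [x] in an abelian ideal, ad x ad y maps into the ideal and ad x ad y ad x = 0, so the
    product has square zero and trace zero. *)
Lemma abelian_ideal_radical (z : {vspace V}) x : ideal br z ->
  (forall x y, x \in z -> y \in z -> br x y = 0) -> x \in z -> T x = 0.
Proof.
move=> zI zz xz; apply: (ip_inj QP) => y; case: TP => _ <-; rewrite (ip0l QP).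
apply: (tr_square_zero QP) => w; rewrite !comp_lfunE !adE.
have xin v : br x v \in z by rewrite (brC brL) memvN; apply: zI.
by rewrite (zz x) // zI.
Qed.

(** Otherwise n meets ker F in a nonzero subalgebra with nonzero center z. Elements of z act on im F
    by operators that are normal and nilpotent, hence zero, so z is an abelian ideal of the whole
    algebra. Testing the moment map on the projection Z onto z gives <Z.mu, mu> = 4 c tr Z < 0,
    against the nonnegativity of the left side. *)
Lemma nilradical_ker_F x : x \in n -> F x = 0 -> x = 0.
Proof.
have [nI nN _] := nr => xn Fx.
have [N NP] := orthoproj_exists QP a.
have an := im_sub_nilradical.
pose n0 := (n :&: u)%VS.
have n0P w : w \in n0 = (w \in n) && (w \in u) by rewrite memv_cap.
apply/eqP; apply/contraT => x0.
have n00 : n0 != 0%VS.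
  apply: contraNneq x0 => n00; rewrite -memv0 -n00 n0P xn memv_ker Fx eqxx //.
have n0n0 v w : v \in u -> w \in n0 -> br v w \in n0.
  by move=> vu; rewrite !n0P => /andP[wn wu]; rewrite nI // (u_sub sd).
have [x1 [x10 x1n x1c]] : exists x, [/\ x != 0, x \in n0 & forall y, y \in n0 -> br y x = 0].
  apply: (nilpotent_center nN (capvSl _ _) n00) => v w; rewrite {1}n0P => /andP[_ vu].
  exact: n0n0.
have [N0 N0P] := orthoproj_exists QP n0; have [N0s N0u N0i] := N0P.
have gl : linear (fun w => (ad br w \o N0)%VF).
  by move=> b v w; rewrite ad_linear comp_lfunDl comp_lfunZl.
(* The center of [n0], cut out as the kernel of a linear map in order to be a subspace. *)
pose z := (n0 :&: lker (linfun (fun w => (ad br w \o N0)%VF)))%VS.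
have zP w : w \in z <-> w \in n0 /\ forall v, v \in n0 -> br v w = 0.
  rewrite memv_cap memv_ker (linfun_linear gl); split.
    move=> /andP[wn /eqP h]; split=> // v vn; rewrite (brC brL) -[v]N0i //.
    by rewrite -adE -comp_lfunE h zero_lfunE oppr0.
  move=> [wn h]; rewrite wn; apply/eqP/lfunP => v.
  by rewrite comp_lfunE adE (brC brL) h ?zero_lfunE ?oppr0.
have zn0 w : w \in z -> w \in n0 by move/zP => [].
have zu : (z <= u)%VS by apply/subvP => w /zn0; rewrite n0P => /andP[].
have zn : (z <= n)%VS by apply/subvP => w /zn0; rewrite n0P => /andP[].
have zp := subv_trans zn np.
have zI w v : v \in u -> w \in z -> br v w \in z.
  move=> vu /zP[wn h]; apply/zP; split; first exact: n0n0.
  move=> y yn; rewrite (jacobi brL y v w) (h y yn) linear0r addr0.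
  by apply: h; rewrite (brC brL) memvN n0n0.
have zz v w : v \in z -> w \in z -> br v w = 0 by move=> /zn0 vn /zP[_]; apply.
have [d1 [d2 [e [eP el er]]]] := adapted_onb QP a.
(* [w] lies in the nilradical, so [ad w] is nilpotent, while [fad w] is normal. *)
have fad0 w : w \in z -> fad br N w = 0.
  move=> wz; have nw := fiber_abelian_normal sd NP eP el er zu zp zI zz wz.
  have [m hm] := ad_nilpotent brL nI nN (subvP zn _ wz).
  apply: (normal_nilpotent (m := m.+1) QP nw) => y.
  have it j : iter j.+1 (fad br N w) y = iter j.+1 (br w) (N y).
    elim: j => [|j IH]; first by rewrite /= fadE.
    rewrite iterS IH fadE (N_im NP) // iterS.
    by apply: (im_ideal sd); elim: j {IH} => [|j IH]; rewrite ?iterS; [apply: (N_in NP)|apply: (im_ideal sd)].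
  by rewrite it iterSr hm.
have zg w v : w \in z -> br w v \in z.
  move=> wz; rewrite -(subrK (N v) v) (bilinDr bB) -(fadE br N w v) fad0 // zero_lfunE addr0.
  by rewrite (brC brL) memvN zI // (N_compl NP).
have zid : ideal br z by move=> v w wz; rewrite (brC brL) memvN zg.
have [Z ZP] := orthoproj_exists QP z; have [Zs Zu Zi] := ZP.
have aZ := orthoproj_adj QP ZP.
have PZ : (P \o Z = Z)%VF by apply/lfunP => v; rewrite comp_lfunE (P_id PP) // (subvP zp).
have ZPP : (Z \o P = Z)%VF by have := congr1 adj PZ; rewrite (adj_comp QP) aZ (orthoproj_adj QP PP).
have FZ : (F \o Z = 0)%VF.
  apply/lfunP => v; rewrite comp_lfunE zero_lfunE.
  by have := subvP zu _ (Zu v); rewrite memv_ker => /eqP.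
have TZ : (T \o Z = 0)%VF.
  by apply/lfunP => v; rewrite comp_lfunE zero_lfunE; apply: abelian_ideal_radical zid zz (Zu v).
have trMZ : tr (M \o Z)%VF = c * tr Z.
  by rewrite trM PZ ZPP FZ TZ (tr0 QP); ring.
have trZ : tr Z = fro Q Z Z by rewrite /fro aZ (orthoproj_idem ZP).
have [l1 [l2 [e' [e'P e'l e'r]]]] := adapted_onb QP z.
pose phi (i : 'I_(l1 + l2)) : R := if fintype.split i is inl _ then 1 else 0.
have phil i : phi (lshift l2 i) = 1 by rewrite /phi -[lshift l2 i]/(unsplit (inl i)) unsplitK.
have phir i : phi (rshift l1 i) = 0 by rewrite /phi -[rshift l1 i]/(unsplit (inr i)) unsplitK.
have Ze i : Z (e' i) = phi i *: e' i.
  case: (split_ordP i) => j ->; rewrite ?phil ?phir ?scale1r ?scale0r; first exact: Zi.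
  by apply: (orthoproj_ker QP ZP) => v vz; rewrite (ip_sym QP) e'r.
have Pz w : w \in z -> P w = w by move=> wz; rewrite (P_id PP) // (subvP zp).
have mu_z w v : w \in z -> mu w v \in z by move=> wz; rewrite /pmu (Pz w) // Pz zg.
have mu0 v w : v \in z -> w \in z -> mu v w = 0.
  by move=> vz wz; rewrite /pmu (Pz v vz) (Pz w wz) zz // linear0.
(* Brackets within z vanish, brackets with one argument in z stay in z and have weight 1 - 1 = 0,
   and all others have weight 0 or 1. *)
have ge0 : 0 <= ndot Q e' (act Z mu) mu.
  rewrite (ndot_act_diag QP e'P muB Ze aZ).
  apply: sumr_ge0 => i _; apply: sumr_ge0 => j _; apply: sumr_ge0 => l _.
  have zero x' y' : mu x' y' \in z -> forall l', Q (mu x' y') (e' (rshift l1 l')) = 0.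
    by move=> h l'; apply: e'r.
  case: (split_ordP i) => i' ->; case: (split_ordP j) => j' ->; case: (split_ordP l) => l' ->;
    rewrite ?phil ?phir ?subr0 ?subrr ?mul0r ?sub0r ?mul1r ?sqr_ge0 //.
  - by rewrite mu0 // (ip0l QP) expr0n mulr0.
  - by rewrite mu0 // (ip0l QP) expr0n mulr0.
  - by rewrite zero ?mu_z // expr0n mulr0.
  - by rewrite zero ?expr0n ?mulr0 // (pmuC mr) memvN mu_z.
have := moment_act mr PP TP vE e'P (sd_mom sd e'P) Z; rewrite trMZ trZ => h.
have Z0 : Z = 0.
  apply: (ip_eq0 FP); apply/le_anti; rewrite (ip_ge0 FP) andbT.
  have c0 := sd_c sd; rewrite h in ge0.
  rewrite leNgt; apply/negP => f0; have := mulr_gt0 f0 (_ : 0 < - c); rewrite oppr_gt0 => /(_ c0); lra.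
have x1z : x1 \in z by apply/zP.
by have := Zi _ x1z; rewrite Z0 zero_lfunE => /esym/eqP; rewrite (negbTE x10).
Qed.

End Nilradical.

(** * Engel's theorem and Cartan's criterion *)

Lemma coord_inj (K : fieldType) (U : vectType K) (x y : U) :
  (forall i, coord (vbasis {:U}) i x = coord (vbasis {:U}) i y) -> x = y.
Proof.
move=> h; rewrite (coord_vbasis (memvf x)) (coord_vbasis (memvf y)).
by apply: eq_bigr => i _; rewrite h.
Qed.

Definition nilp (R : realType) (V : vectType R) (A : 'End(V)) : Prop :=
  exists m, forall x, iter m A x = 0.

Section LinearCommutator.
Variables (R : realType) (V : vectType R).
Implicit Types (A B X : 'End(V)).

Lemma lcomm_jacobi A B X :
  lcomm A (lcomm B X) - lcomm B (lcomm A X) = lcomm (lcomm A B) X.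
Proof.
rewrite /lcomm !(comp_lfunBl, comp_lfunBr) !comp_lfunA.
set a := (A \o B \o X)%VF; set b := (B \o A \o X)%VF.
set c := (X \o A \o B)%VF; set d := (X \o B \o A)%VF.
set e := (A \o X \o B)%VF; set f := (B \o X \o A)%VF.
by apply: coord_inj => i; rewrite !linearB /=; ring.
Qed.

(* [ad A] is nilpotent when [A] is: its powers are combinations of [A^i X A^j]. *)
Lemma nilp_lcomm A : nilp A -> nilp (linfun (lcomm A)).
Proof.
move=> [m Am]; exists (m + m)%N => X.
pose pw i : 'End(V) := iter i (fun Y => A \o Y)%VF \1%VF.
have pwS i : pw i.+1 = (A \o pw i)%VF by [].
have pwC i : (pw i \o A = A \o pw i)%VF.
  elim: i => [|i IH]; first by rewrite comp_lfun1l comp_lfun1r.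
  by rewrite pwS -comp_lfunA IH comp_lfunA.
have pw0 i : (m <= i)%N -> pw i = 0.
  move=> mi; apply/lfunP => x; rewrite zero_lfunE.
  have pwE j : pw j x = iter j A x by elim: j => [|j IH]; rewrite ?id_lfunE // pwS comp_lfunE IH.
  by rewrite pwE -(subnK mi) addnC iterD Am.
have span j : exists cf : nat -> R, iter j (linfun (lcomm A)) X =
    \sum_(0 <= i < j.+1) cf i *: (pw i \o X \o pw (j - i)%N)%VF.
  elim: j => [|j [cf IH]].
    by exists (fun _ => 1); rewrite big_nat1 scale1r comp_lfun1l comp_lfun1r.
  exists (fun i => (if i is i'.+1 then cf i' else 0) - (if (i <= j)%N then cf i else 0)).
  rewrite iterS IH (linfun_linear (lcomm_lin A)).
  rewrite -(linfun_linear (lcomm_lin A)) linear_sum.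
  under [RHS]eq_bigr do rewrite scalerBl.
  rewrite [RHS]sumrB [X in _ = X - _]big_nat_recl // scale0r add0r.
  rewrite [X in _ = _ - X]big_nat_recr //= ltnn scale0r addr0 -sumrB.
  apply: eq_big_nat => i; rewrite ltnS => /andP[_ ij].
  rewrite linearZ /= (linfun_linear (lcomm_lin A)) ij subSS subSn //.
  rewrite /lcomm -[((_ \o pw (j - i)%N) \o A)%VF]comp_lfunA pwC pwS !comp_lfunA scalerBr.
  by [].
have [cf ->] := span (m + m)%N; rewrite big1_seq // => i _.
have [mi|im] := leqP m i; first by rewrite (pw0 i mi) !comp_lfun0l scaler0.
by rewrite (pw0 (m + m - i)%N) ?comp_lfun0r ?scaler0 // -addnBA ?leq_addr // ltnW.
Qed.
End LinearCommutator.

(** A form relative to two invariant subspaces, standing for the quotient of [W] by [W0]. The space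
    [V] varies in the induction because the statement is also applied to commutators acting on
    endomorphisms. *)
Lemma engel (R : realType) d : forall (V : vectType R) (S : {vspace 'End(V)}) (W W0 : {vspace V}),
  (\dim S <= d)%N -> (forall A, A \in S -> nilp A) ->
  (forall A B, A \in S -> B \in S -> lcomm A B \in S) ->
  (forall A w, A \in S -> w \in W -> A w \in W) ->
  (forall A w, A \in S -> w \in W0 -> A w \in W0) ->
  (W0 <= W)%VS -> W0 != W ->
  exists w, [/\ w \in W, w \notin W0 & forall A, A \in S -> A w \in W0].
Proof.
elim: d => [|d IH] V S W W0 dS nilS lieS SW SW0 W0W neq.
  have [w wW w0] : exists2 w, w \in W & w \notin W0.
    by apply/subvPn; apply: contra neq => h; rewrite eqEsubv W0W h.
  exists w; split=> // A; move: dS; rewrite leqn0 dimv_eq0 => /eqP ->.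
  by rewrite memv0 => /eqP ->; rewrite zero_lfunE mem0v.
have [w0 w0W w00] : exists2 w, w \in W & w \notin W0.
  by apply/subvPn; apply: contra neq => h; rewrite eqEsubv W0W h.
have [S0|S0] := eqVneq S 0%VS.
  by exists w0; split=> // A; rewrite S0 memv0 => /eqP ->; rewrite zero_lfunE mem0v.
(* A proper subalgebra of largest dimension is sought; it has codimension one. *)
pose proper_sub (U : {vspace 'End(V)}) := [/\ (U <= S)%VS, U != S &
  forall A B, A \in U -> B \in U -> lcomm A B \in U].
have [U [[US UneqS Ulie] Umax]] : exists U, proper_sub U /\
    forall U', proper_sub U' -> (\dim U' <= \dim U)%N.
  have p0 : proper_sub 0%VS.
    split; rewrite ?sub0v 1?eq_sym // => A B; rewrite !memv0 => /eqP -> _.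
    by rewrite /lcomm comp_lfun0l comp_lfun0r subrr.
  have bd U : proper_sub U -> (\dim U <= \dim S)%N by move=> [h _ _]; apply: dimvS.
  suff H j U : proper_sub U -> (\dim S - \dim U <= j)%N -> exists U, proper_sub U /\
    forall U', proper_sub U' -> (\dim U' <= \dim U)%N by exact: H p0 (leqnn _).
  elim: j U => [|j IHj] U pU jU.
    exists U; split=> // U' /bd h; apply: leq_trans h _.
    by move: jU; rewrite leqn0 subn_eq0.
  have [mx|] := pselect (forall U', proper_sub U' -> (\dim U' <= \dim U)%N).
    by exists U.
  move=> /existsNP[U' /not_implyP[pU' /negP]]; rewrite -ltnNge => lt.
  apply: (IHj U' pU'); rewrite leq_subLR; move: jU; rewrite leq_subLR => h.
  by apply: leq_trans h _; rewrite -addSnnS leq_add2r.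
have dU : (\dim U <= d)%N.
  rewrite -ltnS; apply: leq_trans dS; rewrite ltnNge; apply: contra UneqS => h.
  by rewrite eqEdim US h.
(* The induction hypothesis for [U] acting by commutators on [S] modulo [U] gives an element outside
   [U] that normalizes [U]. *)
have [Bop [BS BU BUU]] : exists B, [/\ B \in S, B \notin U & forall A, A \in U -> lcomm A B \in U].
  pose adl : 'Hom('End(V), 'End('End(V))) := linfun (fun A => linfun (lcomm A)).
  have adlL : linear (fun A : 'End(V) => linfun (lcomm A)).
    move=> b A B; apply/lfunP => X; rewrite add_lfunE scale_lfunE !(linfun_linear (lcomm_lin _)).
    exact: lcomm_lin_l.
  have adlE A X : adl A X = lcomm A X by rewrite (linfun_linear adlL) (linfun_linear (lcomm_lin _)).
  have [] := IH _ (adl @: U)%VS S U _ _ _ _ _ US UneqS.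
  - by apply: leq_trans dU; rewrite -[X in (_ <= X)%N](limg_ker_dim adl U) leq_addl.
  - move=> _ /memv_imgP[A AU ->]; rewrite (linfun_linear adlL); apply: nilp_lcomm.
    exact/nilS/(subvP US).
  - move=> _ _ /memv_imgP[A AU ->] /memv_imgP[B BU ->]; apply/memv_imgP.
    exists (lcomm A B); first exact: Ulie.
    by apply/lfunP => X; rewrite lcommE !adlE lcomm_jacobi.
  - move=> _ X /memv_imgP[A AU ->] XS; rewrite adlE; apply: lieS => //; exact: (subvP US).
  - move=> _ X /memv_imgP[A AU ->] XU; rewrite adlE; exact: Ulie.
  move=> B [BS BU h]; exists B; split=> // A AU; rewrite -adlE; apply: h; exact: memv_img.
have SE : S = (U + <[Bop]>)%VS.
  apply/eqP; rewrite eqEsubv subv_add US -memvE BS !andbT; apply/contraT => neq'.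
  have : (\dim (U + <[Bop]>) <= \dim U)%N.
    apply: Umax; split; first by rewrite subv_add US -memvE.
      by apply: contraNneq neq' => ->.
    move=> _ _ /memv_addP[A AU [_ /vlineP[b ->] ->]] /memv_addP[A' AU' [_ /vlineP[b' ->] ->]].
    rewrite addrC (lcomm_lin_l _ b Bop A) addrC memvD //.
      rewrite addrC (lcomm_lin A b' Bop A') memvD //; first by rewrite memvZ // (subvP (addvSl _ _)) // BUU.
      by rewrite (subvP (addvSl _ _)) // Ulie.
    rewrite memvZ // addrC (lcomm_lin Bop b' Bop A') /lcomm subrr scaler0 add0r.
    by rewrite -opprB memvN (subvP (addvSl _ _)) // BUU.
  rewrite leqNgt => /negP[]; rewrite ltnNge; apply: contra BU => h.
  have -> : U = (U + <[Bop]>)%VS by apply/eqP; rewrite eqEdim addvSl h.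
  by rewrite memvE addvSr.
have [w1 [w1W w1n Uw1]] : exists w, [/\ w \in W, w \notin W0 & forall A, A \in U -> A w \in W0].
  apply: (IH V U W W0) => //.
  - by move=> A AU; apply/nilS/(subvP US).
  - by move=> A w AU; apply/SW/(subvP US).
  - by move=> A w AU; apply/SW0/(subvP US).
have [m Bm] := nilS _ BS.
(* Since [Bop] normalizes [U], its iterates of [w1] are all mapped into [W0] by [U]; the last
   iterate outside [W0] is mapped there by [Bop] too. *)
have [j [jn jS]] : exists j, iter j Bop w1 \notin W0 /\ iter j.+1 Bop w1 \in W0.
  have : iter m Bop w1 \in W0 by rewrite Bm mem0v.
  elim: m {Bm} => [|m IHm]; first by rewrite /= (negbTE w1n).
  move=> h; have [/IHm//|h'] := boolP (iter m Bop w1 \in W0); by exists m.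
have inv i : iter i Bop w1 \in W /\ forall A, A \in U -> A (iter i Bop w1) \in W0.
  elim: i => [|i [iW iU]] //; rewrite iterS; split; first exact: SW.
  move=> A AU; have -> : A (Bop (iter i Bop w1)) = lcomm A Bop (iter i Bop w1) + Bop (A (iter i Bop w1)).
    by rewrite lcommE subrK.
  by apply: memvD; [apply/iU/BUU | apply: SW0 => //; apply: iU].
have [jW jU] := inv j.
exists (iter j Bop w1); split=> // A; rewrite SE => /memv_addP[A' AU' [_ /vlineP[b ->] ->]].
rewrite add_lfunE scale_lfunE; apply: memvD; first exact: jU.
by apply: memvZ; rewrite -iterS.
Qed.

(** * Ideals of ad-nilpotent elements *)

Section AdNilpotent.
Variables (R : realType) (V : vectType R) (br : {bilinear V -> V -> V}) (Q : V -> V -> R).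
Hypothesis QP : inner_product Q.
Hypothesis brL : lie_bracket br.
Let bB := br_bilin br.

(** Induction on the codimension of an invariant [W0]: Engel enlarges it by a vector sent into [W0],
    and one further bracket brings the larger space back into [W0]. The case W0 = 0 bounds the lower
    central series. *)
Lemma ad_nilpotent_ideal (r : {vspace V}) : ideal br r ->
  (forall x, x \in r -> nilp (ad br x)) -> nilpotent br r.
Proof.
move=> rI rn.
have adL : linear (ad br) by move=> b x y; apply: ad_linear.
pose S := (linfun (ad br) @: r)%VS.
have SP A : A \in S <-> exists2 x, x \in r & A = ad br x.
  split=> [/memv_imgP[x xr ->]|[x xr ->]]; first by exists x; rewrite // (linfun_linear adL).
  by apply/memv_imgP; exists x; rewrite // (linfun_linear adL).
have Sn A : A \in S -> nilp A by case/SP => x xr ->; apply: rn.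
have Sl A B : A \in S -> B \in S -> lcomm A B \in S.
  case/SP => x xr -> /SP[y yr ->]; apply/SP; exists (br x y); first exact: rI.
  by rewrite ad_br.
have key j (W0 : {vspace V}) : (\dim {:V} - \dim W0 <= j)%N ->
    (forall A w, A \in S -> w \in W0 -> A w \in W0) ->
    exists m, (iter m (bracket_space br r) fullv <= W0)%VS.
  elim: j W0 => [|j IH] W0 jW SW0.
    exists 0%N; rewrite leqn0 subn_eq0 in jW.
    by have /eqP -> : W0 == fullv by rewrite eqEdim subvf jW.
  have [->|neq] := eqVneq W0 fullv; first by exists 0%N; rewrite subvf.
  have [w [_ wn Sw]] := engel (leqnn _) Sn Sl (fun A w _ _ => memvf (A w)) SW0 (subvf _) neq.
  pose W1 := (W0 + <[w]>)%VS.
  have SW1 A x : A \in S -> x \in W1 -> A x \in W0.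
    move=> AS /memv_addP[x0 x00 [_ /vlineP[b ->] ->]]; rewrite linearD linearZ /=.
    by apply: memvD; [apply: SW0 | apply/memvZ/Sw].
  have [] := IH W1; last 1 first.
  - move=> m mW; exists m.+1; rewrite iterS; apply/span_subvP => _ /allpairsP[[x y] /= [xr yr ->]].
    rewrite -adE; apply: SW1; first by apply/SP; exists (vbasis r)`_(index x (vbasis r)); rewrite ?nth_index ?vbasis_mem.
    by apply: (subvP mW); apply: vbasis_mem.
  - rewrite leq_subLR; rewrite leq_subLR in jW; apply: leq_trans jW _.
    rewrite addnS -addSn leq_add2r ltnNge; apply: contra wn => h.
    have -> : W0 = W1 by apply/eqP; rewrite eqEdim addvSl h.
    by rewrite memvE addvSr.
  - by move=> A x AS xW; apply: (subvP (addvSl _ _)); apply: SW1.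
have S00 A w : A \in S -> w \in (0%VS : {vspace V}) -> A w \in (0%VS : {vspace V}).
  by move=> _; rewrite !memv0 => /eqP ->; rewrite linear0.
have [m mW] := key _ 0%VS (leqnn _) S00.
exists m; apply/eqP; rewrite -subv0; apply: subv_trans mW.
elim: m => [|m IH]; first by rewrite subvf.
rewrite /lower_central !iterS; apply/span_subvP => _ /allpairsP[[x y] /= [xr yr ->]].
apply: bracket_spaceP; first exact: vbasis_mem.
by apply: (subvP IH); apply: vbasis_mem.
Qed.

Lemma tr_deriv_ad_br G v w : derivation br G ->
  lftrace (G \o ad br (br v w))%VF = killing br (G v) w.
Proof.
move=> dG; rewrite /killing ad_br // (deriv_ad _ dG) comp_lfunBr comp_lfunBl !(trB QP) !comp_lfunA.
by congr (_ - _); apply: (tr_compC3 QP).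
Qed.

(* Cartan: the hyperbolic part [G] of [ad x] is a derivation, so [tr (G o ad x)] is a sum of
   Killing products with elements of [s]; hence [ad x] is nilpotent, and Engel applies. *)
Lemma radical_bracket (s : {vspace V}) : ideal br s -> (forall x y, x \in s -> killing br x y = 0) ->
  ideal br (bracket_space br s fullv) /\ nilpotent br (bracket_space br s fullv).
Proof.
move=> sI s0; set r := bracket_space br s fullv.
have rs : (r <= s)%VS.
  apply/span_subvP => _ /allpairsP[[x y] /= [xr yr ->]].
  by rewrite (brC brL) memvN; apply: sI; apply: vbasis_mem.
have rI : ideal br r.
  move=> w x xr; have [cf ->] := span_seqP xr; rewrite big_mkord (bilin_sumr bB).
  apply: memv_suml => i _; rewrite (bilinZr bB); apply: memvZ; set X := [seq _ | _ <- _, _ <- _].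
  have : X`_i \in X by rewrite mem_nth.
  case/allpairsP => [[y z] /= [ys zs ->]]; rewrite (jacobi brL w y z).
  by apply: memvD; apply: bracket_spaceP; rewrite ?memvf ?sI // vbasis_mem.
split=> //; apply: ad_nilpotent_ideal => // x xr.
have [G [b [t [TG _ [_ trGT] nil der]]]] := hyperbolic_part (ad br x).
have dG := der _ bB (ad_deriv brL x).
apply: nil; last by rewrite -/(killing br x x) s0 // (subvP rs).
rewrite (tr_comp QP); have [cf xE] := span_seqP xr.
rewrite xE big_mkord; elim/big_rec: _ => [|i y _ IH].
  by rewrite (_ : ad br 0 = 0) ?comp_lfun0l ?(tr0 QP) //; apply/lfunP => v; rewrite adE (bilin0l bB) zero_lfunE.
rewrite ad_linear comp_lfunDl -comp_lfunZl (trD QP) (trZ QP) IH addr0; set X := [seq _ | _ <- _, _ <- _].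
have : X`_i \in X by rewrite mem_nth.
case/allpairsP => [[v w] /= [vs ws ->]].
rewrite (tr_comp QP) tr_deriv_ad_br //.
by rewrite (killing_deriv QP _ _ dG) s0 ?oppr0 ?mulr0 // vbasis_mem.
Qed.
End AdNilpotent.

(** * The equivalences *)

Lemma derivation_lin (R : realType) (V : vectType R) (mu : V -> V -> V) (b : R) (A B : 'End(V)) :
  bilin mu -> derivation mu A -> derivation mu B -> derivation mu (b *: A + B).
Proof.
move=> muB dA dB x y; rewrite !add_lfunE !scale_lfunE dA dB.
by rewrite !(bilinDl muB, bilinDr muB, bilinZl muB, bilinZr muB) scalerDr addrACA.
Qed.

Lemma derivation_sympart (R : realType) (V : vectType R) (mu : V -> V -> V) Q (A : 'End(V)) :
  bilin mu -> derivation mu A -> derivation mu (adjoint Q A) -> derivation mu (sympart Q A).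
Proof.
move=> muB dA dB; rewrite /sympart -[_ *: _]addr0.
apply: derivation_lin => //; last by move=> x y; rewrite !zero_lfunE (bilin0l muB) (bilin0r muB) addr0.
by have := derivation_lin 1 muB dA dB; rewrite scale1r.
Qed.

Section Equivalences.
Variables (R : realType) (V : vectType R) (br : {bilinear V -> V -> V}).
Variables (k p h n : {vspace V}) (Q : {dot V for idfun}) (P T D : 'End(V)) (H : V) (c : R).
Local Notation X := (ad br H).
Hypothesis sd : soliton_data br k p Q P T (D + X) c.
Hypothesis vD : vertical k p D.
Hypothesis dD : derivation br D.
Hypothesis HP : mean_curvature_vector br p Q H.
Hypothesis nr : nilradical br n.
Hypothesis hn : (h + n)%VS = p.
Hypothesis hperp : forall x y, x \in h -> y \in n -> Q x y = 0.
Local Notation tr := (@lftrace R V).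
Local Notation adj := (adjoint Q).
Local Notation F := (sympart Q (D + X)).
Local Notation A := (sympart Q X).
Local Notation C := (sympart Q D).
Local Notation mu := (pmu br P).
Local Notation M := (moment_operator Q P T (D + X) c).
Let QP := dot_inner_product Q.
Let FP := fro_inner_product QP.
Let mr := sd_mr sd.
Let brL := mr_lie mr.
Let kp := sd_kp sd.
Let PP := sd_P sd.
Let TP := sd_T sd.
Let vE := sd_v sd.
Let dE := sd_d sd.
Let muB := pmu_bilin br P.
Let bB := br_bilin br.
Let vF : vertical k p F := vertical_sympart mr PP vE.
Let Fs : adj F = F := sympart_adj QP (D + X).
Let dX : derivation br X := ad_deriv brL H.

Lemma vertical_adH : vertical k p X.
Proof.
split=> [z zk|x xp]; rewrite adE; first exact: (ad_H_k mr HP zk).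
exact: (ad_H_p mr kp HP xp).
Qed.
Let vX := vertical_adH.

Lemma FCA : F = C + A. Proof. exact: sympartD. Qed.
Lemma nilradical_sub_p : (n <= p)%VS. Proof. by rewrite -hn addvSr. Qed.
Lemma h_sub_p : (h <= p)%VS. Proof. by rewrite -hn addvSl. Qed.

Lemma F_h x : x \in h -> F x = 0.
Proof.
move=> xh; apply: (ip_inj QP) => y; rewrite (adjE QP) Fs (ip0l QP); apply: hperp => //.
by apply: (subvP (im_sub_nilradical sd nr)); rewrite memv_img ?memvf.
Qed.

Lemma h_F x : x \in p -> F x = 0 -> x \in h.
Proof.
rewrite -hn => /memv_addP[y yh [w wn ->]]; rewrite linearD /= F_h // add0r => Fw.
by rewrite (nilradical_ker_F sd nr nilradical_sub_p wn Fw) addr0.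
Qed.

Lemma H_trace x : Q H x = tr (ad br x). Proof. by case: HP. Qed.
Lemma H_p : H \in p. Proof. by case: HP. Qed.

(** [H] represents tr ad, which vanishes on the image of a derivation. *)
Lemma H_deriv G : derivation br G -> adj G H = 0.
Proof.
move=> dG; apply: (ip_inj QP) => x.
by rewrite (adjE QP) (adjK QP) H_trace (tr_ad_deriv QP _ dG) (ip0l QP).
Qed.

Lemma F_H : F H = 0. Proof. by rewrite -Fs; apply/H_deriv/(F_deriv sd). Qed.

Lemma A_H : A H = 0.
Proof. by rewrite /sympart scale_lfunE add_lfunE H_deriv // adE (brxx brL) addr0 scaler0. Qed.

Lemma F_X : (F \o X = X \o F)%VF.
Proof. by apply/lfunP => x; rewrite !comp_lfunE !adE (F_deriv sd) F_H (bilin0l bB) add0r. Qed.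

Lemma F_adjX : (F \o adj X = adj X \o F)%VF.
Proof. by have := congr1 adj F_X; rewrite !(adj_comp QP) Fs. Qed.

Lemma F_A : (F \o A = A \o F)%VF.
Proof.
move: F_X F_adjX; move: F => G GX GX'.
by rewrite /sympart -comp_lfunZl -comp_lfunZr comp_lfunDl comp_lfunDr GX GX'.
Qed.

Lemma F_C : (F \o C = C \o F)%VF.
Proof.
have -> : C = F - A by rewrite FCA addrK.
by rewrite comp_lfunBl comp_lfunBr F_A.
Qed.

Lemma A_h x : x \in h -> A x \in h.
Proof.
move=> xh; apply: h_F; first by apply: (vertical_sympart mr PP vX).2; apply: (subvP h_sub_p).
by rewrite -comp_lfunE F_A comp_lfunE F_h // linear0.
Qed.

Lemma normal_A_deriv : normal Q X -> derivation br A.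
Proof.
move=> nX; have [m [e eP]] := onb_exists QP.
by apply: derivation_sympart => //; apply: (normal_derivation QP eP bB nX dX).
Qed.

Lemma normal_of_comm : (A \o X = X \o A)%VF -> normal Q X.
Proof.
rewrite /sympart -comp_lfunZl -comp_lfunZr comp_lfunDl comp_lfunDr => /eqP.
rewrite -subr_eq0 -scalerBr scaler_eq0 invr_eq0 pnatr_eq0 /= subr_eq0 => /eqP.
by rewrite /normal => /addrI ->.
Qed.

(** Since A H = 0, the Leibniz rule for mu H y says that [A] commutes with [ad H]. *)
Lemma A_pmu_normal : derivation mu A -> normal Q X.
Proof.
move=> dA; apply: normal_of_comm; apply/lfunP => x; rewrite !comp_lfunE.
have [XP PX] := verticalE mr PP vX.
have muH y : mu H y = X y.
  by rewrite /pmu (P_id PP H_p) -adE -!comp_lfunE -comp_lfunA XP PX.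
by rewrite -!muH dA A_H (bilin0l muB) add0r.
Qed.

Lemma A_deriv_normal : derivation br A -> normal Q X.
Proof. by move=> dA; apply/A_pmu_normal/(vertical_deriv_pmu mr PP _ dA)/(vertical_sympart mr PP). Qed.

Lemma C_deriv : derivation br A -> derivation br C.
Proof.
move=> dA; have -> : C = (-1) *: A + F by rewrite FCA scaleN1r addrC addrK.
by apply: derivation_lin => //; apply: (F_deriv sd).
Qed.

(* The moment form evaluated at [H] and [Y]. *)
Lemma tr_A_ad Y : tr (A \o ad br Y)%VF = - c * tr (ad br Y).
Proof.
have [XP PX] := verticalE mr PP vX.
have [aXP PaX] := verticalE mr PP (vertical_adj mr PP vX).
(* For an element of k both sides vanish: its [ad] is skew while [A] is symmetric, and [H] is
   orthogonal to k. *)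
have kY Y' : Y' \in k -> tr (A \o ad br Y')%VF = - c * tr (ad br Y').
  move=> Yk; rewrite -H_trace (ip_sym QP) (mr_orthogonal mr) ?H_p // mulr0.
  have := tr_adj QP (A \o ad br Y')%VF.
  rewrite (adj_comp QP) (ad_k_skew mr Yk) (sympart_adj QP) comp_lfunNl (trN QP) (tr_comp QP).
  lra.
have pY Y' : Y' \in p -> tr (A \o ad br Y')%VF = - c * tr (ad br Y').
  move=> Yp; have [m [e eP]] := onb_exists QP.
  have := momM mr PP TP vE (sd_mom sd eP) H Y'.
  (* The second sum in [mom] drops out because [H] is orthogonal to all brackets. *)
  have -> : mom Q e mu H Y' = - 2^-1 * tr (adj X \o ad br Y')%VF.
    rewrite /mom [X in _ + 4^-1 * X]big1 => [|i _]; last first.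
      by rewrite big1 // => j _; rewrite /pmu (P_sym PP) (P_id PP H_p) (ip_sym QP) H_trace (tr_ad_br QP brL) mul0r.
    rewrite mulr0 addr0; congr (_ * _).
    rewrite -PaX -comp_lfunA (tr_comp QP) (trE QP eP); apply: eq_bigr => i _.
    rewrite !comp_lfunE adE -(adjEr QP) [RHS](ip_sym QP).
    have -> : mu H (e i) = X (e i) by rewrite /pmu (P_id PP H_p) -adE -!comp_lfunE -comp_lfunA XP PX.
    by rewrite /pmu (P_id PP Yp) -(P_sym PP) -[P (X _)]comp_lfunE PX.
  rewrite /moment_operator 2!add_lfunE F_H addr0 !scale_lfunE !comp_lfunE (P_id PP H_p).
  rewrite (ipDl QP) !(ipZl QP) (P_sym PP) (P_id PP Yp) H_trace.
  case: TP => _ <-; rewrite /killing /sympart -comp_lfunZl (trZ QP) comp_lfunDl (trD QP); lra.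
have [z [y [zk yp ->]]] := decomp mr PP Y.
have adD : ad br (z + y) = ad br z + ad br y by have := ad_linear br 1 z y; rewrite !scale1r.
by rewrite adD comp_lfunDr !(trD QP) kY // pY // mulrDr.
Qed.

(** B(C x, y) = tr (C ad [x, y]) with C = F - A. The [A] part is a multiple of tr ad [x, y] = 0, and
    the [F] part is B(F x, y) = 0. *)
Lemma C_radical x : derivation br C -> T (C x) = 0.
Proof.
move=> dC; apply: (ip_inj QP) => y; rewrite (ip0l QP); case: TP => _ <-.
rewrite -(tr_deriv_ad_br QP brL _ _ dC); have -> : C = F - A by rewrite FCA addrK.
rewrite comp_lfunBl (trB QP) tr_A_ad (tr_ad_br QP brL) mulr0 subr0.
rewrite (tr_deriv_ad_br QP brL _ _ (F_deriv sd)); case: TP => _ ->.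
by have := F_radical sd x; rewrite memv_ker => /eqP ->; rewrite (ip0l QP).
Qed.

(* [Y = C x] lies in the Killing radical, so it commutes with [k + h]; moving [C] around the
   trace gives [|fad Y|^2 = 0], so [Y] is central. *)
Lemma C_h x : derivation br C -> x \in h -> C x = 0.
Proof.
move=> dC xh; set Y := C x.
have [N NP] := orthoproj_exists QP (limg F).
have xu : x \in lker F by rewrite memv_ker F_h.
have Cu y : y \in lker F -> C y \in lker F.
  by rewrite !memv_ker => /eqP Fy; rewrite -comp_lfunE F_C comp_lfunE Fy linear0.
have Yu : Y \in lker F by apply: Cu.
have [rI rN] := radical_bracket QP brL (radical_ideal sd) (fun x y xs => (radicalP sd x).1 xs y).
have rn : (bracket_space br (lker T) fullv <= n)%VS by case: nr => _ _; apply.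
(* The bracket lies in a nilpotent ideal, hence in n, and also in ker F; these intersect
   trivially. *)
have Yc y : y \in lker F -> br Y y = 0.
  move=> yu; apply: (nilradical_ker_F sd nr nilradical_sub_p); last first.
    by apply/eqP; rewrite -memv_ker (u_sub sd).
  by apply: (subvP rn); apply: bracket_spaceP; rewrite ?memvf // memv_ker C_radical.
pose f := fad br N; have [fN Nf] := fad_N sd NP Y.
have [d1 [d2 [e [eP el er]]]] := adapted_onb QP (limg F).
have f0 : f 0 = 0 by apply/lfunP => y; rewrite fadE (bilin0l bB) zero_lfunE.
(* [fad Y] acts trivially on [mu]: it is a derivation on im F and commutes with the action of ker
   F. *)
have nd0 : ndot Q e (act (f Y) mu) (act (f Y) mu) = 0.
  rewrite (ndot_act_fiber sd NP eP er fN Nf) big1 ?add0r => [|i _]; last first.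
    by rewrite big1 // => j _; rewrite (act_fad_im sd NP) // (ip0l QP).
  rewrite big1 ?mulr0 // => i _.
  have eu : P (e (rshift d1 i)) \in lker F by apply/(u_P sd)/(er_u er).
  by rewrite -(fad_br sd NP) // Yc // -/(f 0) f0 (ip0l FP).
have act0 := ndot_eq0 QP eP (act_bilin QP _ muB) (etrans (ndot_fad_adj sd NP eP Yu) nd0).
have aN := N_adj NP.
(* The adjoint of [fad Y] moves [mu] by the same amount, namely zero; this is its mixed component at
   [x]. *)
have comm0 : lcomm (adj (f Y)) (f x) = 0.
  apply/lfunP => y; rewrite zero_lfunE -(act0 x y) (act_fiber sd NP) //; last 2 first.
  - by have := congr1 adj Nf; rewrite (adj_comp QP) aN.
  - by have := congr1 adj fN; rewrite (adj_comp QP) aN.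
  by rewrite (P_id PP) // (subvP h_sub_p).
have CN y : N (C y) = C (N y).
  rewrite -{1}(subrK (N y) y) (raddfD C) (raddfD N) /= (N_ker NP (Cu _ (N_compl NP y))) add0r.
  have /memv_imgP[w _ ->] := N_in NP y.
  have -> : C (F w) = F (C w) by rewrite -!comp_lfunE F_C.
  exact: (NF NP).
have fYE : f Y = lcomm C (f x).
  by apply/lfunP => y; rewrite lcommE !fadE CN dC addrK.
(* [fad Y] is the commutator of [C] with [fad x]. Pairing with [fad Y] and moving [fad x] across
   leaves the adjoint of the commutator in [comm0]. *)
have fY0 : f Y = 0.
  apply: (ip_eq0 FP); rewrite {2}fYE.
  have -> : lcomm C (f x) = - lcomm (f x) C by rewrite /lcomm opprB.
  by rewrite (ipNr FP) -fro_lcomm -(adjK QP (lcomm _ _)) adj_lcomm comm0 (adj0 QP) (ip0l FP) oppr0.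
have YZ y : br Y y = 0.
  rewrite -(subrK (N y) y) (bilinDr bB) Yc ?(N_compl NP) // add0r.
  by rewrite -(fadE br N) -/(f Y) fY0 zero_lfunE.
have YZ' y : br y Y = 0 by rewrite (brC brL) YZ oppr0.
apply: (nilradical_ker_F sd nr nilradical_sub_p); last by apply/eqP; rewrite -memv_ker.
(* [Y] is central, so its line is an abelian ideal and lies in n. *)
have [_ _ nmax] := nr; suff : (<[Y]> <= n)%VS by rewrite -memvE.
apply: nmax.
  by move=> y _ /vlineP[b ->]; rewrite (bilinZr bB) YZ' scaler0 mem0v.
exists 1%N; apply/eqP; rewrite -subv0; apply/span_subvP => _ /allpairsP[[y w] /= [/vbasis_mem/vlineP[b ->] _ ->]].
by rewrite (bilinZl bB) YZ scaler0 mem0v.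
Qed.

(** The moment map is tested on L = [ad H, (ad H)^t]. If the trace vanishes, the adjoint annihilates
    [mu] because [ad H] does. *)
Lemma C_h_deriv : (forall x, x \in h -> C x = 0) -> derivation br C.
Proof.
move=> Ch; apply: C_deriv.
have Ah x : x \in h -> A x = 0.
  move=> xh; have := F_h xh; rewrite FCA add_lfunE Ch // add0r.
  exact.
have [m [e eP]] := onb_exists QP.
have [N NP] := orthoproj_exists QP (limg F).
have [XP PX] := verticalE mr PP vX.
have vaX := vertical_adj mr PP vX; have [aXP PaX] := verticalE mr PP vaX.
pose L := lcomm X (adj X).
have PL : (P \o L = L)%VF by rewrite comp_lfunBr !comp_lfunA PX PaX.
have LP : (L \o P = L)%VF by rewrite comp_lfunBl -!comp_lfunA XP aXP.
have Xin x : x \in h -> X x \in h.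
  move=> xh; apply: h_F; first by apply: vX.2; apply: (subvP h_sub_p).
  by rewrite -comp_lfunE F_X comp_lfunE F_h // linear0.
have aXh x : x \in h -> adj X x = - X x.
  move=> /Ah /eqP; rewrite /sympart scale_lfunE add_lfunE scaler_eq0 invr_eq0 pnatr_eq0 /=.
  by rewrite addrC addr_eq0 => /eqP.
(* On h, (ad H)^t = - ad H, so [L] vanishes there; on im F, [L] commutes with [F] and stays in the
   Killing radical. *)
have TL : (T \o L = 0)%VF.
  apply/lfunP => v; rewrite comp_lfunE zero_lfunE -(subrK (N v) v) linearD linearD /=.
  have -> : L (v - N v) = 0.
    rewrite -LP comp_lfunE; have Pu : P (v - N v) \in lker F by apply/(u_P sd)/(N_compl NP).
    have Ph : P (v - N v) \in h by apply: h_F; [apply: (P_in PP) | apply/eqP; rewrite -memv_ker].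
    by rewrite lcommE !aXh ?Xin // linearN /= opprK addNr.
  rewrite linear0 add0r; have /memv_imgP[w _ ->] := N_in NP v.
  have -> : L (F w) = F (L w).
    by rewrite !lcommE linearB /= -!comp_lfunE !comp_lfunA F_X F_adjX -!comp_lfunA F_X F_adjX.
  by have := F_radical sd (L w); rewrite memv_ker => /eqP.
have trML : tr (M \o L)%VF = 0.
  rewrite trM PL LP TL (tr0 QP) mulr0 addr0 [tr L](trB QP) (tr_comp QP) subrr mulr0 add0r.
  rewrite comp_lfunBr (trB QP).
  have -> : tr (F \o (adj X \o X))%VF = tr (F \o (X \o adj X))%VF.
    by rewrite comp_lfunA (tr_comp QP) !comp_lfunA F_X.
  by rewrite subrr.
have dXm : derivation mu X := vertical_deriv_pmu mr PP vX dX.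
have ndX : ndot Q e (act X mu) (act X mu) = 0.
  move/act_deriv: dXm => d0; rewrite /ndot big1 // => i _; rewrite big1 // => j _.
  by rewrite d0 (ip0l QP).
have nd := ndot_act_comm QP eP X muB.
rewrite (moment_act mr PP TP vE eP (sd_mom sd eP)) trML mulr0 ndX subr0 in nd.
have daX : derivation mu (adj X).
  by apply/act_deriv; apply: (ndot_eq0 QP eP (act_bilin QP _ muB)).
by apply/normal_A_deriv/A_pmu_normal/derivation_sympart.
Qed.

End Equivalences.

(** * Passing from the Lie algebra to p and h *)

Section Blocks.
Variables (R : realType) (V : vectType R) (br : {bilinear V -> V -> V}).
Variables (k p : {vspace V}) (Q : {dot V for idfun}) (P : 'End(V)).
Hypothesis mr : metric_reductive br k p Q.
Hypothesis PP : orthoproj Q p P.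
Local Notation Qp := (restr_form Q (U := p)).
Local Notation adj := (adjoint Q).
Local Notation mu := (pmu br P).
Local Notation brp := (p_bracket br k (p := p)).
Let QP := dot_inner_product Q.
Let QP' := restr_inner_product QP p.

Lemma blockE G x : vertical k p G -> vsval (block p k G x) = G (vsval x).
Proof.
move=> [_ Gp]; rewrite /block linfun_linear => [|a u v]; last by rewrite !linearP.
by rewrite (daddv_pi_pk mr PP) (P_id PP) ?vsprojK // Gp // subvsP.
Qed.

Lemma block_adj G : vertical k p G -> adjoint Qp (block p k G) = block p k (adj G).
Proof.
move=> vG; apply/esym/(adj_uniq QP') => x y; rewrite /restr_form !blockE //.
  exact: (adjE QP).
exact: (vertical_adj mr PP).
Qed.

Lemma block_sympart G : vertical k p G -> sympart Qp (block p k G) = block p k (sympart Q G).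
Proof.
move=> vG; apply/lfunP => x; apply: subvs_inj.
rewrite blockE; last exact: (vertical_sympart mr PP).
rewrite /sympart !scale_lfunE !add_lfunE block_adj // linearZ linearD /= !blockE //.
exact: (vertical_adj mr PP).
Qed.

Lemma block_derivation G : vertical k p G -> derivation brp (block p k G) <-> derivation mu G.
Proof.
move=> vG; have vs x : vsval (vsproj p (P x)) = P x by rewrite vsprojK // (P_in PP).
have [GP PG] := verticalE mr PP vG.
have GPx x : G (P x) = P (G x) by rewrite -!comp_lfunE GP PG.
split=> dG x y; last first.
  apply: subvs_inj; rewrite linearD /= !(p_bracketE mr PP, blockE) //.
  have := dG (vsval x) (vsval y); rewrite /pmu (P_id PP (subvsP x)) (P_id PP (subvsP y)).
  by rewrite (P_id PP (vG.2 _ (subvsP x))) (P_id PP (vG.2 _ (subvsP y))).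
have := congr1 vsval (dG (vsproj p (P x)) (vsproj p (P y))).
by rewrite linearD /= !(p_bracketE mr PP, blockE) // !vs /pmu -!GPx.
Qed.

Lemma block_normal G : vertical k p G -> normal Qp (block p k G) <-> normal Q G.
Proof.
move=> vG; have vaG := vertical_adj mr PP vG.
have [GP PG] := verticalE mr PP vG; have [aGP PaG] := verticalE mr PP vaG.
rewrite /normal block_adj //; split=> nG.
  apply/lfunP => x; rewrite !comp_lfunE.
  have e1 : adj G x = adj G (P x) by rewrite -comp_lfunE aGP.
  have e2 : G x = G (P x) by rewrite -comp_lfunE GP.
  have := congr1 (fun f : 'End(_) => vsval (f (vsproj p (P x)))) nG.
  by rewrite !comp_lfunE !blockE // vsprojK ?(P_in PP) // e1 e2.
by apply/lfunP => x; apply: subvs_inj; rewrite !comp_lfunE !blockE // -!comp_lfunE nG.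
Qed.

Variables (h n : {vspace V}).
Hypothesis hn : (h + n)%VS = p.
Hypothesis hperp : forall x y, x \in h -> y \in n -> Q x y = 0.

(** h is orthogonal to k + n, so the discarded component is invisible to vectors of h. *)
Lemma block_h G x y : x \in h -> y \in h ->
  restr_form Q (block h (k + n) G (vsproj h x)) (vsproj h y) = Q (G x) y.
Proof.
move=> xh yh.
have perp v w : v \in h -> w \in (k + n)%VS -> Q w v = 0.
  move=> vh /memv_addP[z zk [m mn ->]].
  rewrite (ipDl QP) (mr_orthogonal mr) // ?add0r; last by rewrite -hn (subvP (addvSl _ _)).
  by rewrite (ip_sym QP) hperp.
have dir : (h :&: (k + n) = 0)%VS.
  apply/eqP; rewrite -subv0; apply/subvP => v; rewrite memv_cap memv0 => /andP[vh vkn].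
  by apply/eqP/(ip_eq0 QP)/perp.
have full v : v \in (h + (k + n))%VS.
  have : v \in (k + p)%VS by rewrite (mr_sum mr) memvf.
  by rewrite -hn addvA (addvC k) -addvA.
rewrite /restr_form /block linfun_linear => [|a u v]; last by rewrite !linearP.
rewrite !vsprojK ?memv_pi // -[in RHS](daddv_pi_add dir (full (G x))) (ipDl QP).
by rewrite [X in _ + X]perp ?addr0 // memv_pi.
Qed.

Lemma sympart_block_h G : sympart (restr_form Q (U := h)) (block h (k + n) G) = 0 <->
  forall x y, x \in h -> y \in h -> Q (sympart Q G x) y = 0.
Proof.
have QH := restr_inner_product QP h.
have e x y : x \in h -> y \in h ->
    restr_form Q (sympart (restr_form Q (U := h)) (block h (k + n) G) (vsproj h x)) (vsproj h y) = Q (sympart Q G x) y.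
  by move=> xh yh; rewrite (sympart_ip QH) (sympart_ip QP) block_h // (ip_sym QH) block_h // (ip_sym QP x).
split=> [s0 x y xh yh|s0]; first by rewrite -e // s0 zero_lfunE (ip0l QH).
apply/lfunP => x; apply: (ip_inj QH) => y; rewrite zero_lfunE (ip0l QH).
by have := e _ _ (subvsP x) (subvsP y); rewrite !vsvalK s0 ?subvsP.
Qed.
End Blocks.

(** * The cycle of implications *)

Theorem proposition4p14 (R : realType) (gg : vectType R)
    (br : {bilinear gg -> gg -> gg}) (ip : {dot gg for idfun})
    (k p h n : {vspace gg}) (H : gg)
    (Ric : 'End(subvs_of p)) (c : R) (D : 'End(gg))
    (ipp := restr_form ip (U := p)) (iph := restr_form ip (U := h))
    (Dp := block p k D) (adpH := block p k (ad br H))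
    (brp := p_bracket br k (p := p)) :
  metric_reductive br k p ip ->
  (forall z x, z \in k -> x \in p -> killing br z x = 0) ->
  nilradical br n ->
  (h + n)%VS = p ->
  (forall x y, x \in h -> y \in n -> ip x y = 0) ->
  mean_curvature_vector br p ip H ->
  is_ricci_operator br k ipp Ric ->
  semi_algebraic_soliton br k ipp ->
  soliton_derivation br k p D ->
  Ric = c *: \1%VF + sympart ipp Dp ->
  c < 0 ->
  [<-> (* (i) *) algebraic_soliton br k p ip;
       (* (i), i.e. *) derivation br (sympart ip D);
       (* (ii) *) derivation brp (sympart ipp Dp);
       (* (iii) *) derivation brp (sympart ipp adpH);
       (* (iii), equivalently *) derivation br (sympart ip (ad br H));
       (* (iv) *) normal ipp adpH;
       (* (iv), equivalently *) normal ip (ad br H);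
       (* (v) *) sympart iph (block h (k + n) D) = 0;
       (* (vi) *) sympart iph (block h (k + n) (ad br H)) = 0;
       (* (vii) *) forall x : subvs_of p, vsval x \in h -> Ric x = c *: x].
Proof.
move=> mr kp nr hn hperp HP RicP sas [dD kD Dp'] RicE c0.
have QP := dot_inner_product ip; have QP' : inner_product ipp := restr_inner_product QP p.
have brL := mr_lie mr.
have [P PP] := orthoproj_exists QP p; have [T TP] := killing_operator br QP.
have vD : vertical k p D.
  split=> [z zk|x xp]; first by have := subvP kD z zk; rewrite memv_ker => /eqP.
  by apply: (subvP Dp'); apply: memv_img.
have vX : vertical k p (ad br H).
  by split=> [z zk|x xp]; rewrite adE; [apply: (ad_H_k mr HP)|apply: (ad_H_p mr kp HP)].
have dX := ad_deriv brL H.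
have vS G : vertical k p G -> vertical k p (sympart ip G) by apply: (vertical_sympart mr PP).
have sE : sympart ipp Dp = block p k (sympart ip D) by apply: (block_sympart mr PP).
have RicS x : vsval (Ric x) = c *: vsval x + sympart ip D (vsval x).
  by rewrite RicE add_lfunE scale_lfunE id_lfunE sE linearD linearZ /= (blockE mr PP) //; apply: vS.
have sd : soliton_data br k p ip P T (D + ad br H) c.
  split=> //.
  - by have := vertical_lin 1 vD vX; rewrite scale1r.
  - by have := derivation_lin 1 (br_bilin br) dD dX; rewrite scale1r.
  - move=> m e eP y yp; have := ricci_formula mr PP (vsproj p y) RicP HP eP.
    rewrite RicS vsprojK // (ipDl QP) (ipZl QP) (sympart_ip QP) (ip_sym QP y) add_lfunE (ipDl QP) adE.
    lra.
have F_h x : x \in h -> sympart ip (D + ad br H) x = 0 by apply: (F_h sd nr hperp).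
have FCA := FCA br ip D H.
have C_E : derivation br (sympart ip (ad br H)) -> derivation br (sympart ip D) := @C_deriv _ _ _ _ _ _ _ _ _ _ _ sd.
tfae.
(* The algebraic soliton structure comes with its own Ricci operator, constant and derivation. The
   Ricci formula fixes the quadratic form, so the two symmetric Ricci operators coincide. *)
- move=> [_ [Ric' [Ric'P [c' [D' [[dD' kD' pD'] sD' Ric'E]]]]]].
  have vD' : vertical k p D'.
    split=> [z zk|x xp]; first by have := subvP kD' z zk; rewrite memv_ker => /eqP.
    by apply: (subvP pD'); apply: memv_img.
  have Ric'S x : vsval (Ric' x) = c' *: vsval x + D' (vsval x).
    by rewrite Ric'E add_lfunE scale_lfunE id_lfunE linearD linearZ /= (blockE mr PP).
  have sRic : adjoint ipp Ric = Ric.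
    apply/esym/(adj_uniq QP') => x y; rewrite /ipp /restr_form !RicS (ipDl QP) (ipDr QP) (ipZl QP) (ipZr QP).
    by rewrite (adjE QP) (sympart_adj QP).
  have sRic' : adjoint ipp Ric' = Ric'.
    apply/esym/(adj_uniq QP') => x y; rewrite /ipp /restr_form !Ric'S (ipDl QP) (ipDr QP) (ipZl QP) (ipZr QP).
    by rewrite (adjE QP) sD'.
  have [m [e eP]] := onb_exists QP.
  have quad x : ipp (Ric x) x = ipp (Ric' x) x.
    by rewrite /ipp /restr_form (ricci_formula mr PP x RicP HP eP) (ricci_formula mr PP x Ric'P HP eP).
  have RR : Ric = Ric'.
    apply/lfunP => x; apply: (ip_inj QP') => y; have := quad (x + y).
    rewrite (raddfD Ric) (raddfD Ric') /= !(ipDl QP') !(ipDr QP') !quad.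
    have -> : ipp (Ric y) x = ipp (Ric x) y by rewrite (adjE QP') sRic (ip_sym QP').
    have -> : ipp (Ric' y) x = ipp (Ric' x) y by rewrite (adjE QP') sRic' (ip_sym QP').
    lra.
  have CE x : x \in p -> sympart ip D x = (c' - c) *: x + D' x.
    move=> xp; have := RicS (vsproj p x); rewrite RR Ric'S vsprojK // => e1.
    by rewrite scalerBl addrAC e1 addrC addKr.
  have CE' : sympart ip D = (c' - c) *: P + D'.
    have vCD := vS _ vD; apply/lfunP => x; rewrite [RHS]add_lfunE [X in X + _]scale_lfunE.
    have [z [y [zk yp ->]]] := decomp mr PP x.
    rewrite (raddfD (sympart ip D)) (raddfD P) (raddfD D') /= (vCD.1 z zk) (vD'.1 z zk) (P_k mr PP zk) (P_id PP yp) !add0r; exact: CE.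
  (* If the constants differ, pairing with [H], which is killed by the adjoints of [D] and [D'],
     gives (c' - c) |H|^2 = 0; then [ad H] is zero, and so trivially has a derivation as symmetric
     part. *)
  have [cc|cc] := eqVneq (c' - c) 0; first by rewrite CE' cc scale0r add0r.
  have D'H : D' H = 0 by rewrite -sD'; apply: (H_deriv HP).
  have aDH : adjoint ip D H = 0 by apply: (H_deriv HP).
  have H0 : H = 0.
    have := CE H (H_p HP); rewrite D'H addr0 => /(congr1 (ip H)).
    rewrite (ipZr QP) (ip_sym QP H) (sympart_ip QP) (adjE QP) (ip_sym QP _ (D H)) (adjE QP) aDH !(ip0r QP).
    by rewrite addr0 mulr0 => /esym/eqP; rewrite mulf_eq0 (negbTE cc) => /eqP/(ip_eq0 QP).
  apply: C_E; have -> : ad br H = 0 by apply/lfunP => x; rewrite adE H0 linear0l zero_lfunE.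
  rewrite /sympart (adj0 QP) addr0 scaler0 => x y; rewrite !zero_lfunE linear0l linear0r addr0 //.
- by move=> dC; rewrite sE; apply/(block_derivation mr PP (vS _ vD))/(vertical_deriv_pmu mr PP (vS _ vD)).
- rewrite sE (block_sympart mr PP vX) => /(block_derivation mr PP (vS _ vD)) dC.
  apply/(block_derivation mr PP (vS _ vX)).
  have -> : sympart ip (ad br H) = (-1) *: sympart ip D + sympart ip (D + ad br H).
    by rewrite FCA scaleN1r addrA addNr add0r.
  by apply: derivation_lin => //; [apply: pmu_bilin|apply: (F_deriv_pmu sd)].
- rewrite (block_sympart mr PP vX) => /(block_derivation mr PP (vS _ vX)) dA.
  by apply: (normal_A_deriv sd); apply: (A_pmu_normal sd HP).
- by move=> dA; apply/(block_normal mr PP vX)/(A_deriv_normal sd HP).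
- by move=> /(block_normal mr PP vX).
- move=> nX; apply/(sympart_block_h mr hn hperp) => x y xh yh.
  by rewrite (C_h sd HP nr hn hperp) ?(ip0l QP) //; apply/C_E/(normal_A_deriv sd).
- move=> /(sympart_block_h mr hn hperp) s0; apply/(sympart_block_h mr hn hperp) => x y xh yh.
  have := s0 x y xh yh; have := F_h _ xh; rewrite FCA add_lfunE => /(congr1 (ip^~ y)).
  by rewrite (ipDl QP) (ip0l QP) => + C0; rewrite C0 add0r.
- move=> /(sympart_block_h mr hn hperp) s0 x xh; apply: subvs_inj.
  (* The symmetric part of [ad H] preserves h, so a vanishing block means that it vanishes on h. *)
  have A0 : sympart ip (ad br H) (vsval x) = 0.
    by apply: (ip_eq0 QP); apply: s0 => //; apply: (A_h sd HP nr hn hperp).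
  have := F_h _ xh; rewrite FCA add_lfunE A0 addr0 => C0.
  by rewrite RicS C0 addr0 linearZ.
- move=> Rh; have Ch x : x \in h -> sympart ip D x = 0.
    move=> xh; have xp : x \in p by rewrite -hn (subvP (addvSl _ _)).
    have := RicS (vsproj p x); rewrite Rh ?vsprojK // linearZ /= vsprojK // => /eqP.
    by rewrite -[X in X == _]addr0 (inj_eq (addrI _)) eq_sym => /eqP.
  have dC := C_h_deriv sd HP nr hn hperp Ch.
  split=> //; exists Ric; split=> //; exists c, (sympart ip D); split.
  + split=> //; first by apply/subvP => z zk; rewrite memv_ker ((vS _ vD).1 z zk).
    by apply/subvP => _ /memv_imgP[x xp ->]; apply: (vS _ vD).2.
  + exact: (sympart_adj QP).
  + by rewrite RicE sE.
Qed.
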